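(* Let $\mathbb{D}_{Q_1}\subset\mathbb{M}^{d_1}$ and $\mathbb{D}_{Q_2}\subset\mathbb{M}^{d_2}$ be two nc operator balls. Then $A(\mathbb{D}_{Q_1})$ and $A(\mathbb{D}_{Q_2})$ are completely isometrically isomorphic (as algebras) if and only if $\mathbb{D}_{Q_1}$ and $\mathbb{D}_{Q_2}$ are linearly isomorphic.
   Context: $M_n^d$ is the set of $d$-tuples of complex $n\times n$ matrices; $\mathbb{M}^d=\sqcup_{n\ge1}M_n^d$; for $\Omega\subseteq\mathbb{M}^d$, $\Omega(n)=\Omega\cap M_n^d$. $\Omega$ is a nc set if it is closed under direct sums. A nc map $f:\Omega\to\mathbb{M}^l$ is a map that is graded ($X\in\Omega(n)\Rightarrow f(X)\in M_n^l$), satisfies $f(X\oplus Y)=f(X)\oplus f(Y)$, and $f(S^{-1}XS)=S^{-1}f(X)S$ whenever $S\in GL_n$ and $X,S^{-1}XS\in\Omega(n)$. NC operator ball: given Hilbert spaces $\mathcal{R},\mathcal{S}$ and linearly independent $Q_1,\dots,Q_d\in\mathcal{L}(\mathcal{R},\mathcal{S})$, put $Q(X)=\sum_jQ_j\otimes X_j$ for $X\in\mathbb{M}^d$ and $\mathbb{D}_Q=\{X\in\mathbb{M}^d:\|Q(X)\|<1\}$. $H^\infty(\mathbb{D}_Q)$ is the algebra of bounded nc functions $\mathbb{D}_Q\to\mathbb{M}^1$ with norm $\|f\|=\sup_{X\in\mathbb{D}_Q}\|f(X)\|$ and matrix norms $\|[f_{jk}]\|=\sup_{X\in\mathbb{D}_Q}\|[f_{jk}(X)]\|$;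 $A(\mathbb{D}_Q)$ is the norm closure in it of the free nc polynomials in $d$ variables. $\mathbb{D}_{Q_1}$ and $\mathbb{D}_{Q_2}$ are linearly isomorphic if there is a bijective nc map $L:\mathbb{D}_{Q_1}\to\mathbb{D}_{Q_2}$ that at each level is the restriction of a linear map $M_n^{d_1}\to M_n^{d_2}$. *)

(* Defs.v *)
From HB Require Import structures.
From mathcomp Require Import all_boot all_order all_algebra.
From mathcomp Require Import finmap complex.
From mathcomp Require Import boolp classical_sets functions reals ereal.
From mathcomp Require Import topology normedtype.

Set Implicit Arguments.
Unset Strict Implicit.
Unset Printing Implicit Defensive.

Import Order.TTheory GRing.Theory Num.Theory.
Import numFieldNormedType.Exports.

Local Open Scope classical_set_scope.
Local Open Scope complex_scope.
Local Open Scope ring_scope.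

HB.mixin Record NormedModule_isHilbert (R : realType) V
    of CompleteNormedModule R[i] V := {
  hdot : {dot V for (@Num.conj R[i])} ;
  hdot_norm : forall x : V, `|x| ^+ 2 = hdot x x
}.

#[short(type="hilbertType")]
HB.structure Definition Hilbert (R : realType) :=
  {V of CompleteNormedModule R[i] V & NormedModule_isHilbert R V}.

(* [n] stands for matrices of size [n.+1], as levels are numbered from 1. *)
Notation mtuple R d n := {ffun 'I_d -> 'M[R[i]]_n.+1}.

(* A graded subset of the nc universe, given by its levels. *)
Definition graded_set (R : realType) (d : nat) := forall n, set (mtuple R d n).

Section NcMaps.
Variable R : realType.

Definition dsum n m (A : 'M[R[i]]_n.+1) (B : 'M[R[i]]_m.+1) :
  'M[R[i]]_((n + m.+1).+1) := (block_mx A 0 0 B : 'M[R[i]]_(n.+1 + m.+1)).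

Definition tdsum d n m (X : mtuple R d n) (Y : mtuple R d m) :
  mtuple R d (n + m.+1) := [ffun j => dsum (X j) (Y j)].

Definition tconj d n (S : 'M[R[i]]_n.+1) (X : mtuple R d n) : mtuple R d n :=
  [ffun j => invmx S *m X j *m S].

Definition is_nc_map d l (Om : graded_set R d)
    (f : forall n, Om n -> mtuple R l n) : Prop :=
  (forall n m (X : Om n) (Y : Om m) (Z : Om (n + m.+1)%N),
     set_val Z = tdsum (set_val X) (set_val Y) ->
     f _ Z = tdsum (f _ X) (f _ Y)) /\
  (forall n (S : 'M[R[i]]_n.+1) (X Y : Om n), S \in unitmx ->
     set_val Y = tconj S (set_val X) -> f _ Y = tconj S (f _ X)).

(* Graded functions from [Om] to the one-variable universe, a 1-tuple of
   matrices being identified with its entry. *)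
Definition gfun d (Om : graded_set R d) := forall n, Om n -> 'M[R[i]]_n.+1.

Definition is_nc_fun d (Om : graded_set R d) (f : gfun Om) : Prop :=
  is_nc_map (l := 1) (Om := Om) (fun n X => [ffun=> f n X]).

Definition gfun_add d (Om : graded_set R d) (f g : gfun Om) : gfun Om :=
  fun n X => f n X + g n X.
Definition gfun_opp d (Om : graded_set R d) (f : gfun Om) : gfun Om :=
  fun n X => - f n X.
Definition gfun_mul d (Om : graded_set R d) (f g : gfun Om) : gfun Om :=
  fun n X => f n X *m g n X.
Definition gfun_scale d (Om : graded_set R d) (a : R[i]) (f : gfun Om) :
  gfun Om := fun n X => a *: f n X.

(* A free nc polynomial is a finitely supported family of coefficients
   indexed by the words in the [d] variables. *)
Definition ncpoly d := {fsfun seq 'I_d -> R[i] with 0}.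

Definition ncpoly_eval d (p : ncpoly d) n (X : mtuple R d n) :
  'M[R[i]]_n.+1 :=
  \sum_(w <- finsupp p) p w *: \prod_(j <- w) X j.

Definition ncpoly_fun d (Om : graded_set R d) (p : ncpoly d) : gfun Om :=
  fun n X => ncpoly_eval p (set_val X).

End NcMaps.
Arguments ncpoly_fun {R d} Om p n X.

Section Norms.
Variable R : realType.

Definition l2norm (V : normedZmodType R[i]) n (h : 'I_n -> V) : R :=
  Num.sqrt (\sum_(k < n) complex.Re `|h k| ^+ 2).

Definition mxnorm m n (A : 'M[R[i]]_(m, n)) : \bar R :=
  ereal_sup [set (l2norm (fun k => (A *m v) k 0))%:E
            | v in [set v : 'cV[R[i]]_n | l2norm (fun k => v k 0) <= 1]].

Definition gfun_norm d (Om : graded_set R d) (f : gfun Om) : \bar R :=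
  ereal_sup [set mxnorm (f (projT1 X) (projT2 X))
            | X in [set: {n & Om n}]].

Definition gfun_mxnorm d (Om : graded_set R d) m
    (F : 'I_m -> 'I_m -> gfun Om) : \bar R :=
  ereal_sup [set mxnorm (\mxblock_(j < m, k < m) F j k (projT1 X) (projT2 X))
            | X in [set: {n & Om n}]].

Definition Hinfty d (Om : graded_set R d) : set (gfun Om) :=
  [set f | is_nc_fun f /\ (gfun_norm f < +oo)%E].

Definition Aalg d (Om : graded_set R d) : set (gfun Om) :=
  [set f | Hinfty f /\ forall e : R, 0 < e -> exists p : ncpoly R d,
     (gfun_norm (gfun_add f (gfun_opp (ncpoly_fun Om p))) < e%:E)%E].

End Norms.
Arguments Hinfty {R d} Om _.
Arguments Aalg {R d} Om _.

Section OperatorBalls.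
Variables (R : realType) (H K : hilbertType R) (d : nat).
Implicit Type Q : 'I_d -> {linear H -> K}.

Definition bounded_ops Q : Prop := forall j, continuous (Q j).

Definition lin_indep Q : Prop :=
  forall a : 'I_d -> R[i],
    (forall h, \sum_(j < d) a j *: Q j h = 0) -> forall j, a j = 0.

(* The operator sum_j Q_j (x) X_j, where H (x) C^(n+1) is identified with
   the Hilbert sum of [n.+1] copies of [H] (and likewise for [K]). *)
Definition ampl Q n (X : mtuple R d n) (h : 'I_n.+1 -> H) : 'I_n.+1 -> K :=
  fun k => \sum_(j < d) \sum_(l < n.+1) X j k l *: Q j (h l).

Definition ampl_norm Q n (X : mtuple R d n) : \bar R :=
  ereal_sup [set (l2norm (ampl Q X h))%:E
            | h in [set h : 'I_n.+1 -> H | l2norm h <= 1]].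

Definition ncball Q : graded_set R d :=
  fun n => [set X | (ampl_norm Q X < 1)%E].

End OperatorBalls.

Section Isomorphisms.
Variables (R : realType) (d1 d2 : nat).

(* Only the restriction of [Phi] to [Aalg Om1] matters.  Preservation of the
   unit follows from multiplicativity and surjectivity. *)
Definition alg_completely_isometric_iso
    (Om1 : graded_set R d1) (Om2 : graded_set R d2) : Prop :=
  exists Phi : gfun Om1 -> gfun Om2,
    [/\ set_bij (Aalg Om1) (Aalg Om2) Phi,
        (forall f g, Aalg Om1 f -> Aalg Om1 g ->
           Phi (gfun_add f g) = gfun_add (Phi f) (Phi g)),
        (forall a f, Aalg Om1 f -> Phi (gfun_scale a f) = gfun_scale a (Phi f)),
        (forall f g, Aalg Om1 f -> Aalg Om1 g ->
           Phi (gfun_mul f g) = gfun_mul (Phi f) (Phi g)) &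
        (forall m (F : 'I_m -> 'I_m -> gfun Om1),
           (forall j k, Aalg Om1 (F j k)) ->
           gfun_mxnorm (fun j k => Phi (F j k)) = gfun_mxnorm F)].

Definition linearly_isomorphic
    (Om1 : graded_set R d1) (Om2 : graded_set R d2) : Prop :=
  exists L : forall n, Om1 n -> Om2 n,
    [/\ is_nc_map (Om := Om1) (fun n X => set_val (L n X)),
        (forall n, bijective (L n)) &
        (forall n, exists T : {linear mtuple R d1 n -> mtuple R d2 n},
           forall X, set_val (L n X) = T (set_val X))].

End Isomorphisms.

(* Main.v *)
(* Mutually inverse linear maps between the balls act on scalar coordinates and
   give the isomorphism of the algebras by composition.

   Conversely, an isomorphism Phi of the algebras and its inverse are
   composition with nc maps F and G between the balls, whose values may a
   priori lie in the closures.  The maximum principle puts the image of the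
   origin strictly inside the other ball.  Let a be such an image.  Conjugating
   one isomorphism by a rotation and composing with its inverse yields another
   isomorphism, for which the origin goes to (1 + i z) a up to an error O(|z|^2)
   that is uniform as long as |a| <= r0 < 1; with |1 + z| = 1 and
   |1 + i z| < 1 the image of the origin moves closer to the origin, so the
   infimum of |a| over all isomorphisms is 0.  The derivatives of F and G at 0
   and a are mutually inverse scalar matrices which, evaluated on the jets
   [a, Y; 0, a], are complete contractions up to a factor tending to 1 as
   |a| -> 0.  Their entries stay bounded, and a limit along a subsequence is a
   linear isomorphism of the balls.

   All Cauchy-type estimates come from evaluation at nilpotent matrices, so
   that no complex analysis is needed. *)

Require Import Defs.
From HB Require Import structures.
From mathcomp Require Import all_boot all_order all_algebra.
From mathcomp Require Import finmap complex.
From mathcomp Require Import boolp classical_sets functions reals ereal.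
From mathcomp Require Import topology normedtype.
From mathcomp Require Import ring lra.
Set Implicit Arguments.
Unset Strict Implicit.
Unset Printing Implicit Defensive.
Import Order.TTheory GRing.Theory Num.Theory.
Import numFieldNormedType.Exports.
Local Open Scope classical_set_scope.
Local Open Scope complex_scope.
Local Open Scope ring_scope.

(** * Real values of the norms, which over [R[i]] are complex numbers *)

Section RealNorm.
Variable R : realType.
Local Notation C := R[i].

(** An element of the algebra has no value on the boundary of the ball, so [Phi f] can be read as
    [f] composed with F only at points that F sends into the open ball; this is why interiority of
    the image of the origin is settled before any composition is evaluated. The improved isomorphism
    sends the origin to F(i G((1 + z) a)). As G(a) = 0 and multiplication by i commutes with the
    linear term of G at a, the point i G((1 + z) a) agrees with G((1 + i z) a) up to O(|z|^2), and F
    undoes G. A rotation of the second ball, harmless there, thus becomes a move towards the origin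
    in the first. The error is uniform because the coordinates are bounded on each ball by a
    constant that depends on the operators only. An isomorphism attaining the infimum is not sought:
    only the derivatives, matrices of fixed size, are passed to the limit. The nilpotent used for
    the Cauchy-type estimates is a shift: the Taylor coefficients of a slice appear in one column of
    a matrix, so the sum of their squares is bounded. This square sum, stronger than a bound on each
    coefficient, also yields the maximum principle. *)

Definition rn (V : normedZmodType C) (x : V) : R := complex.Re `|x|.

Section Zmod.
Variable V : normedZmodType C.
Implicit Types x y : V.

Lemma rnE x : `|x| = (rn x)%:C.
Proof.
rewrite /rn; have := normr_ge0 x; case: `|x| => a b.
by rewrite lecE /= => /andP[/eqP-> _].
Qed.

Lemma rn_ge0 x : 0 <= rn x.
Proof. by rewrite -(lecR 0) -rnE; exact: normr_ge0. Qed.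

Lemma rn0 : rn (0 : V) = 0.
Proof. by rewrite /rn normr0. Qed.

Lemma rn_eq0 x : rn x = 0 -> x = 0.
Proof. by move=> h; apply/eqP; rewrite -normr_eq0 rnE h. Qed.

Lemma rnD x y : rn (x + y) <= rn x + rn y.
Proof. by rewrite -lecR rmorphD /= -!rnE ler_normD. Qed.

Lemma rnN x : rn (- x) = rn x.
Proof. by rewrite /rn normrN. Qed.

Lemma rnB x y : rn (x - y) <= rn x + rn y.
Proof. by rewrite -(rnN y) rnD. Qed.

Lemma rn_sum I (r : seq I) (P : pred I) (F : I -> V) :
  rn (\sum_(i <- r | P i) F i) <= \sum_(i <- r | P i) rn (F i).
Proof.
elim/big_rec2: _ => [|i a b _ h]; first by rewrite rn0.
by apply: (le_trans (rnD _ _)); rewrite lerD2l.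
Qed.

End Zmod.

Lemma rnM (a b : C) : rn (a * b) = rn a * rn b.
Proof. by apply/complexI; rewrite rmorphM /= -!rnE normrM. Qed.

Lemma rnX (a : C) n : rn (a ^+ n) = rn a ^+ n.
Proof. by apply/complexI; rewrite rmorphXn /= -!rnE normrX. Qed.

Lemma rnZ (V : normedModType C) (a : C) (x : V) : rn (a *: x) = rn a * rn x.
Proof. by apply/complexI; rewrite rmorphM /= -!rnE normrZ. Qed.

Lemma rn_real (x : R) : rn (x%:C : C) = `|x|.
Proof. by rewrite /rn normc_def /= expr0n /= addr0 sqrtr_sqr. Qed.

Lemma rn1 : rn (1 : C) = 1.
Proof. by rewrite /rn normr1. Qed.

Lemma rn_sqr (z : C) : rn z ^+ 2 = complex.Re z ^+ 2 + complex.Im z ^+ 2.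
Proof. by apply/complexI; rewrite rmorphXn /= -rnE add_Re2_Im2. Qed.

Lemma mul_conj_rn (z : C) : z * z^* = (rn z ^+ 2)%:C.
Proof. by rewrite -normCK rnE rmorphXn. Qed.

Lemma rn_i : rn ('i : C) = 1.
Proof. by rewrite /rn normCi. Qed.

End RealNorm.

(** * Norms on finite Hilbert sums *)

Section L2.
Variable R : realType.
Local Notation C := R[i].

(** Expanding the squares of [s * x k - y k] gives a quadratic inequality in [s]; it is used at the
    minimiser [s = S / X], and [X = 0] is treated apart. *)
Lemma sumr_cauchy (I : finType) (x y : I -> R) :
  (forall k, 0 <= x k) -> (forall k, 0 <= y k) ->
  \sum_k x k * y k <=
  Num.sqrt (\sum_k x k ^+ 2) * Num.sqrt (\sum_k y k ^+ 2).
Proof.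
move=> x0 y0; set X := \sum_k x k ^+ 2; set Y := \sum_k y k ^+ 2.
have X0 : 0 <= X by apply: sumr_ge0 => k _; rewrite sqr_ge0.
have Y0 : 0 <= Y by apply: sumr_ge0 => k _; rewrite sqr_ge0.
have key s : 2 * s * (\sum_k x k * y k) <= s ^+ 2 * X + Y.
  rewrite /X /Y !mulr_sumr -big_split /=; apply: ler_sum => k _.
  by have := sqr_ge0 (s * x k - y k); nra.
have S0 : 0 <= \sum_k x k * y k by apply: sumr_ge0 => k _; rewrite mulr_ge0.
rewrite -sqrtrM // -[leLHS](ger0_norm S0) -sqrtr_sqr.
rewrite ler_sqrt ?mulr_ge0 //; set S := \sum_k _.
have [X00|Xp] := eqVneq X 0.
  have : S = 0.
    apply: big1 => k _.
    have /psumr_eq0P-/(_ _ k isT) : X = 0 by []. 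
    by move=> h; move/eqP: (h (fun _ _ => sqr_ge0 _)); rewrite sqrf_eq0 => /eqP->; rewrite mul0r.
  by move=> ->; rewrite expr0n /= mulr_ge0.
have {}Xp : 0 < X by rewrite lt_neqAle eq_sym Xp.
have := key (S / X); rewrite -/S => h.
have e1 : 2 * (S / X) * S = 2 * (S ^+ 2 / X) by field; rewrite gt_eqF.
have e2 : (S / X) ^+ 2 * X = S ^+ 2 / X by field; rewrite gt_eqF.
have : S ^+ 2 / X <= Y by lra.
by rewrite ler_pdivrMr // mulrC.
Qed.

Section Fam.
Variable V : normedZmodType C.
Implicit Types h : forall n, 'I_n -> V.

Lemma l2_ge0 n (h : 'I_n -> V) : 0 <= l2norm h.
Proof. exact: sqrtr_ge0. Qed.

Lemma l2_sqr n (h : 'I_n -> V) : l2norm h ^+ 2 = \sum_(k < n) rn (h k) ^+ 2.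
Proof. by rewrite sqr_sqrtr //; apply: sumr_ge0 => k _; rewrite sqr_ge0. Qed.

Lemma l2_eq0 n (h : 'I_n -> V) : l2norm h = 0 -> forall k, h k = 0.
Proof.
move=> h0 k; apply: rn_eq0; apply/eqP; rewrite -sqrf_eq0; apply/eqP.
have /psumr_eq0P : \sum_(k < n) rn (h k) ^+ 2 = 0 by rewrite -l2_sqr h0 expr0n.
by apply=> // i _; rewrite sqr_ge0.
Qed.

Lemma l2_comp n (h : 'I_n -> V) k : rn (h k) <= l2norm h.
Proof.
rewrite -(ler_pXn2r (n := 2)) ?nnegrE ?rn_ge0 ?l2_ge0 // l2_sqr.
by rewrite (bigD1 k) //= lerDl; apply: sumr_ge0 => i _; rewrite sqr_ge0.
Qed.

Lemma l2D n (h h' : 'I_n -> V) :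
  l2norm (fun k => h k + h' k) <= l2norm h + l2norm h'.
Proof.
rewrite -(ler_pXn2r (n := 2)) ?nnegrE ?addr_ge0 ?l2_ge0 // sqrrD !l2_sqr.
have := sumr_cauchy (fun k => rn_ge0 (h k)) (fun k => rn_ge0 (h' k)).
rewrite -/(l2norm h) -/(l2norm h') => hc.
apply: (@le_trans _ _ (\sum_k (rn (h k) + rn (h' k)) ^+ 2)).
  by apply: ler_sum => k _; rewrite ler_pXn2r ?nnegrE ?addr_ge0 ?rn_ge0 ?rnD.
under eq_bigr do rewrite sqrrD.
by rewrite !big_split /= lerD2r lerD2l mulr2n lerD.
Qed.

Lemma l2_leE n m (h : 'I_n -> V) (W : normedZmodType C) (g : 'I_m -> W) (c : R) :
  0 <= c -> (l2norm h <= c * l2norm g) =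
  (\sum_(k < n) rn (h k) ^+ 2 <= c ^+ 2 * \sum_(k < m) rn (g k) ^+ 2).
Proof.
move=> c0.
have g0 : 0 <= \sum_(k < m) rn (g k) ^+ 2 by apply: sumr_ge0 => *; exact: sqr_ge0.
rewrite -(ler_pXn2r (n := 2)) ?nnegrE ?mulr_ge0 ?sqrtr_ge0 // exprMn l2_sqr.
by rewrite sqr_sqrtr.
Qed.

Lemma l2_le n m (h : 'I_n -> V) (W : normedZmodType C) (g : 'I_m -> W) (c : R) :
  0 <= c ->
  \sum_(k < n) rn (h k) ^+ 2 <= c ^+ 2 * \sum_(k < m) rn (g k) ^+ 2 ->
  l2norm h <= c * l2norm g.
Proof. by move=> c0; rewrite l2_leE. Qed.

Lemma l2_le_comp n (h : 'I_n -> V) (W : normedZmodType C) (g : 'I_n -> W) (c : R) :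
  0 <= c -> (forall k, rn (h k) <= c * rn (g k)) -> l2norm h <= c * l2norm g.
Proof.
move=> c0 hh; apply: l2_le => //; rewrite mulr_sumr; apply: ler_sum => k _.
have := hh k; have := rn_ge0 (h k) => r0 hk.
by rewrite -exprMn ler_pXn2r ?nnegrE ?(le_trans r0 hk).
Qed.

Lemma l2_0 n : l2norm (fun _ : 'I_n => 0 : V) = 0.
Proof.
by rewrite /l2norm big1 ?sqrtr0 // => k _; rewrite -/(rn _) rn0 expr0n.
Qed.

Lemma l2_le_sum n (h : 'I_n -> V) : l2norm h <= \sum_k rn (h k).
Proof.
rewrite -(ler_pXn2r (n := 2)) ?nnegrE ?l2_ge0 ?sumr_ge0 // => [|k _]; last exact: rn_ge0.
rewrite l2_sqr expr2 mulr_suml; apply: ler_sum => k _.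
rewrite expr2 ler_wpM2l ?rn_ge0 // (bigD1 k) //= lerDl.
by apply: sumr_ge0 => *; exact: rn_ge0.
Qed.

End Fam.

Lemma l2Z (V : normedModType C) n (a : C) (h : 'I_n -> V) :
  l2norm (fun k => a *: h k) = rn a * l2norm h.
Proof.
apply/eqP; rewrite -(eqrXn2 (n := 2)) ?mulr_ge0 ?l2_ge0 ?rn_ge0 //.
rewrite exprMn !l2_sqr mulr_sumr; apply/eqP; apply: eq_bigr => k _.
by rewrite rnZ exprMn.
Qed.

Lemma l2Zc n (a : C) (h : 'I_n -> C) :
  l2norm (fun k => a * h k) = rn a * l2norm h.
Proof.
apply/eqP; rewrite -(eqrXn2 (n := 2)) ?mulr_ge0 ?l2_ge0 ?rn_ge0 //.
rewrite exprMn !l2_sqr mulr_sumr; apply/eqP; apply: eq_bigr => k _.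
by rewrite rnM exprMn.
Qed.

(* Both operator norms of [Defs] are suprema over the unit ball of a
   homogeneous function, so they share this description. *)
Lemma sup_unit_ballP (V : Type) (S : V -> R -> V) (p q : V -> R) (c : R) :
  0 <= c -> (forall v, 0 <= p v) -> (forall v, 0 <= q v) ->
  (forall v t, 0 <= t -> p (S v t) = t * p v) ->
  (forall v t, 0 <= t -> q (S v t) = t * q v) ->
  (forall v, p v = 0 -> q v = 0) ->
  (ereal_sup [set (q v)%:E | v in [set v | (p v <= 1)%R]] <= c%:E)%E <->
  (forall v, q v <= c * p v).
Proof.
move=> c0 p0 q0 hp hq pq; split=> [/ereal_supP h v|h].
  have [/[dup]pv0 /pq ->|pvN] := eqVneq (p v) 0; first by rewrite pv0 mulr0.
  have pv : 0 < p v by rewrite lt_neqAle eq_sym pvN p0.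
  have /h : [set (q v)%:E | v in [set v | p v <= 1]] (q (S v (p v)^-1))%:E.
    by exists (S v (p v)^-1) => //=; rewrite hp ?invr_ge0 ?p0 // mulVf.
  by rewrite lee_fin hq ?invr_ge0 ?p0 // mulrC ler_pdivrMr.
apply/ereal_supP => _ [v /= pv <-]; rewrite lee_fin (le_trans (h v)) //.
by rewrite -[leRHS]mulr1 ler_wpM2l.
Qed.

End L2.

(** * Bessel's inequality and Gram-Schmidt *)

Section Hilbert.
Variables (R : realType) (V : hilbertType R).
Local Notation C := R[i].
Implicit Types (x y : V) (e : nat -> V).

Local Notation "''[' u , v ]" := (hdot (s := V) u v) : ring_scope.

Lemma conjCreal (r : R) : ((r%:C : C)^*) = r%:C.
Proof. exact: conjc_real. Qed.

Lemma dotE x : '[x, x] = (rn x ^+ 2)%:C.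
Proof. by rewrite -hdot_norm rnE rmorphXn. Qed.

Lemma dot_sym x y : '[y, x] = ('[x, y])^*.
Proof. by rewrite (hermC (@hdot R V)) /= expr0 mul1r. Qed.

Lemma dot_suml I (r : seq I) (F : I -> V) y :
  '[\sum_(i <- r) F i, y] = \sum_(i <- r) '[F i, y].
Proof. exact: linear_sumlz. Qed.

Lemma dot_sumr I (r : seq I) (F : I -> V) x :
  '[x, \sum_(i <- r) F i] = \sum_(i <- r) '[x, F i].
Proof. exact: linear_sumr. Qed.

Lemma dotZl a x y : '[a *: x, y] = a * '[x, y].
Proof. exact: linearZl_LR. Qed.

Lemma dotZr a x y : '[x, a *: y] = a^* * '[x, y].
Proof. exact: linearZr_LR. Qed.

Lemma dotDl x y z : '[x + y, z] = '[x, z] + '[y, z].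
Proof. exact: linearDl. Qed.

Lemma dotDr z x y : '[z, x + y] = '[z, x] + '[z, y].
Proof. exact: linearDr. Qed.

Lemma dotBl x y z : '[x - y, z] = '[x, z] - '[y, z].
Proof. exact: linearBl. Qed.

Lemma dot0l y : '[0, y] = 0.
Proof. exact: linear0l. Qed.

Lemma dot0r y : '[y, 0] = 0.
Proof. exact: linear0r. Qed.

Definition orthonormal_or_zero e :=
  (forall u v, u != v -> '[e u, e v] = 0) /\
  (forall u, '[e u, e u] = 1 \/ e u = 0).

Lemma rn_ortho_le1 e u : orthonormal_or_zero e -> rn (e u) ^+ 2 <= 1.
Proof.
case=> _ /(_ u)[|->]; last by rewrite rn0 expr0n.
by rewrite dotE => /complexI ->.
Qed.

Lemma rn_ortho_sum e m (c : 'I_m -> C) : orthonormal_or_zero e ->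
  rn (\sum_(u < m) c u *: e u) ^+ 2 = \sum_(u < m) rn (c u) ^+ 2 * rn (e u) ^+ 2.
Proof.
move=> [oe _]; apply/complexI; rewrite -dotE dot_suml raddf_sum /=.
apply: eq_bigr => u _; rewrite dotZl dot_sumr (bigD1 u) //= big1 => [|v vu].
  by rewrite addr0 dotZr mulrA mul_conj_rn dotE -rmorphM.
by rewrite dotZr oe ?mulr0 // eq_sym.
Qed.

Lemma rn_ortho_sum_le e m (c : 'I_m -> C) : orthonormal_or_zero e ->
  rn (\sum_(u < m) c u *: e u) ^+ 2 <= \sum_(u < m) rn (c u) ^+ 2.
Proof.
move=> oe; rewrite rn_ortho_sum //; apply: ler_sum => u _.
by rewrite ler_piMr ?sqr_ge0 ?rn_ortho_le1.
Qed.

Lemma dot_ortho_norm e x u : orthonormal_or_zero e ->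
  rn '[x, e u] ^+ 2 * rn (e u) ^+ 2 = rn '[x, e u] ^+ 2.
Proof.
case=> _ /(_ u)[|->]; last by rewrite dot0r !rn0 expr0n mulr0.
by rewrite dotE => /complexI ->; rewrite mulr1.
Qed.

Lemma dot_ortho_residual e m x (u : nat) : orthonormal_or_zero e -> (u < m)%N ->
  '[x - \sum_(v < m) '[x, e v] *: e v, e u] = 0.
Proof.
move=> [oe ne] um; rewrite dotBl dot_suml (bigD1 (Ordinal um)) //= big1.
  by rewrite addr0 dotZl; case: (ne u) => [->|->]; rewrite ?dot0r ?mulr1 ?mul0r subrr.
by move=> v vu; rewrite dotZl oe ?mulr0.
Qed.

Lemma bessel e m x : orthonormal_or_zero e ->
  \sum_(u < m) rn '[x, e u] ^+ 2 <= rn x ^+ 2.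
Proof.
move=> oe; set p := \sum_(u < m) '[x, e u] *: e u.
have yp : '[p, x - p] = 0.
  rewrite {1}/p dot_suml big1 // => u _.
  by rewrite dotZl (dot_sym (x - p)) dot_ortho_residual // conjC0 mulr0.
have -> : \sum_(u < m) rn '[x, e u] ^+ 2 = rn p ^+ 2.
  rewrite rn_ortho_sum //; apply: eq_bigr => u _.
  by rewrite dot_ortho_norm.
have : rn x ^+ 2 = rn p ^+ 2 + rn (x - p) ^+ 2.
  apply/complexI; rewrite rmorphD /= -!dotE.
  rewrite -{1 2}(subrK p x) (dotDl (x - p)).
  rewrite !(dotDr _ (x - p) p) yp (dot_sym p (x - p)) yp.
  by rewrite conjC0 addr0 add0r addrC.
by move=> ->; rewrite lerDl sqr_ge0.
Qed.

Lemma cauchy_schwarz x y : rn '[x, y] <= rn x * rn y.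
Proof.
have [->|y0] := eqVneq y 0; first by rewrite dot0r !rn0 mulr0.
have ry : rn y != 0 by apply: contra_neq y0; exact: rn_eq0.
have ry0 : 0 < rn y by rewrite lt_neqAle eq_sym ry rn_ge0.
(* Cauchy-Schwarz is Bessel's inequality for the single unit vector along [y], padded by zeros. *)
pose e (u : nat) := if u == 0%N then (rn y)^-1%:C *: y else 0.
have oe : orthonormal_or_zero e.
  split=> [[|u] [|v]|[|u]] //=; rewrite /e /= ?dot0l ?dot0r //; last by right.
  left; rewrite dotZl dotZr dotE conjCreal.
  by rewrite -!rmorphM /= mulrA -expr2 exprVn mulVf ?sqrf_eq0.
have := bessel 1 x oe; rewrite big_ord1 ler_pXn2r ?nnegrE ?rn_ge0 //=.
rewrite dotZr conjCreal rnM rn_real.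
by rewrite ger0_norm ?invr_ge0 ?rn_ge0 // mulrC ler_pdivrMr.
Qed.

Lemma gram_schmidt (h : nat -> V) N : exists2 e, orthonormal_or_zero e &
  forall l, (l < N)%N -> forall m, (N <= m)%N ->
    h l = \sum_(u < m) '[h l, e u] *: e u.
Proof.
suff [e [oe ze he]] : exists e, [/\ orthonormal_or_zero e,
    forall u, (N <= u)%N -> e u = 0 &
    forall l, (l < N)%N -> h l = \sum_(u < N) '[h l, e u] *: e u].
  exists e => // l lN m Nm; rewrite {1}(he l lN).
  rewrite (big_ord_widen m (fun u => '[h l, e u] *: e u)) // big_mkcond /=.
  apply: eq_bigr => u _; case: ltnP => // /ze ->.
  by rewrite scaler0.
elim: N => [|N [e [oe ze he]]].
  by exists (fun=> 0); split=> //; split=> [u v|u]; [rewrite dot0l|right].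
pose y := h N - \sum_(u < N) '[h N, e u] *: e u.
(* When [h N] depends on its predecessors, [y = 0] and the new vector is 0 as well. *)
pose e' u := if u == N then (rn y)^-1%:C *: y else e u.
have ye u : (u < N)%N -> '[y, e u] = 0 by exact: dot_ortho_residual.
have ye0 u : u != N -> '[y, e u] = 0.
  by case: (ltngtP u N) => // [/ye|/ltnW/ze ->] // _; rewrite dot0r.
have oe' : orthonormal_or_zero e'.
  split=> [u v|u]; rewrite /e'.
    case: (eqVneq u N) => uN; case: (eqVneq v N) => vN; first by rewrite uN vN eqxx.
    - by move=> _; rewrite dotZl ye0 ?mulr0.
    - by move=> _; rewrite dotZr (dot_sym y) ye0 // conjC0 mulr0.
    - by case: oe => oe _; exact: oe.
  case: eqP => _; last by case: oe.
  have [->|y0] := eqVneq y 0; first by right; rewrite scaler0.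
  left; rewrite dotZl dotZr dotE conjCreal.
  have ry : rn y != 0 by apply: contra_neq y0; exact: rn_eq0.
  by rewrite -!rmorphM /= mulrA -expr2 exprVn mulVf ?sqrf_eq0.
have e'e u : (u < N)%N -> e' u = e u by rewrite /e' => uN; rewrite ltn_eqF.
exists e'; split=> // [u Nu|l].
  by rewrite /e' gtn_eqF // ze // ltnW.
rewrite ltnS leq_eqVlt => /orP[/eqP ->|lN]; rewrite big_ord_recr /=.
  under eq_bigr => u _ do rewrite e'e //.
  set s := \sum_(u < N) _; have hN : h N = s + y by rewrite addrC subrK.
  rewrite /e' eqxx; have [y0|y0] := eqVneq y 0.
    by rewrite y0 !scaler0 addr0 hN y0 addr0.
  have ry : rn y != 0 by apply: contra_neq y0; exact: rn_eq0.
  rewrite {1 2}hN; congr (_ + _); rewrite dotDl.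
  have -> : '[s, (rn y)^-1%:C *: y] = 0.
    rewrite dotZr dot_suml big1 ?mulr0 // => u _.
    by rewrite dotZl (dot_sym y) ye // conjC0 mulr0.
  rewrite add0r dotZr conjCreal dotE.
  rewrite scalerA -!rmorphM /=.
  rewrite (_ : _ * _ = 1) ?scale1r //; by field.
have -> : '[h l, e' N] = 0.
  rewrite /e' eqxx dotZr (he l lN) dot_suml big1 ?mulr0 // => u _.
  by rewrite dotZl (dot_sym y) ye // conjC0 mulr0.
rewrite scale0r addr0 {1}(he l lN); apply: eq_bigr => u _.
by rewrite e'e.
Qed.

End Hilbert.

(** * Operator norms of matrices and block matrices *)

Section MatrixNorm.
Variable R : realType.
Local Notation C := R[i].

Definition vnorm n (v : 'cV[C]_n) : R := l2norm (fun k => v k 0).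

Definition mx_le m n (A : 'M[C]_(m, n)) (c : R) : Prop :=
  forall v : 'cV[C]_n, vnorm (A *m v) <= c * vnorm v.

Lemma vnormZ n a (v : 'cV[C]_n) : vnorm (a *: v) = rn a * vnorm v.
Proof.
by rewrite /vnorm -l2Zc; congr (l2norm _); apply/funext => k; rewrite mxE.
Qed.

Lemma vnorm0 n : vnorm (0 : 'cV[C]_n) = 0.
Proof. by rewrite /vnorm -[RHS](l2_0 C n); congr (l2norm _); apply/funext => k; rewrite mxE. Qed.

Lemma vnorm_eq0 n (v : 'cV[C]_n) : vnorm v = 0 -> v = 0.
Proof. by move=> /l2_eq0 h; apply/colP => k; rewrite h mxE. Qed.

Lemma vnormD n (v w : 'cV[C]_n) : vnorm (v + w) <= vnorm v + vnorm w.
Proof.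
apply: le_trans (l2D _ _).
by rewrite le_eqVlt; apply/orP; left; apply/eqP; congr (l2norm _); apply/funext => k; rewrite mxE.
Qed.

Lemma vnorm_delta n (i : 'I_n) : vnorm (delta_mx i 0 : 'cV[C]_n) = 1.
Proof.
apply/eqP; rewrite -(eqrXn2 (n := 2)) ?l2_ge0 // expr1n l2_sqr.
rewrite (bigD1 i) //= big1 => [|k ki].
  by rewrite mxE !eqxx rn1 expr1n addr0.
by rewrite mxE (negbTE ki) /= rn0 expr0n.
Qed.

Lemma mxnormP m n (A : 'M[C]_(m, n)) c : 0 <= c ->
  (mxnorm A <= c%:E)%E <-> mx_le A c.
Proof.
move=> c0; apply: (@sup_unit_ballP _ _ (fun v t => t%:C *: v)
  (@vnorm n) (fun v => vnorm (A *m v))) => //= [v|v|v t t0|v t t0|v].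
- exact: l2_ge0.
- exact: l2_ge0.
- by rewrite vnormZ rn_real ger0_norm.
- by rewrite -scalemxAr vnormZ rn_real ger0_norm.
- by move=> /vnorm_eq0 ->; rewrite mulmx0 vnorm0.
Qed.

Lemma mx_le_trans m n (A : 'M[C]_(m, n)) c c' : c <= c' -> mx_le A c -> mx_le A c'.
Proof.
by move=> cc h v; apply: (le_trans (h v)); rewrite ler_wpM2r ?l2_ge0.
Qed.

Lemma mx_leD m n (A B : 'M[C]_(m, n)) c c' :
  mx_le A c -> mx_le B c' -> mx_le (A + B) (c + c').
Proof.
move=> hA hB v; rewrite mulmxDl; apply: (le_trans (vnormD _ _)).
by rewrite mulrDl lerD.
Qed.

Lemma mx_leZ m n (A : 'M[C]_(m, n)) a c : mx_le A c -> mx_le (a *: A) (rn a * c).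
Proof.
by move=> hA v; rewrite -scalemxAl vnormZ -mulrA ler_wpM2l ?rn_ge0.
Qed.

Lemma mx_leN m n (A : 'M[C]_(m, n)) c : mx_le A c -> mx_le (- A) c.
Proof.
by move=> /(mx_leZ (-1)); rewrite scaleN1r rnN rn1 mul1r.
Qed.

Lemma mx_leM m n p (A : 'M[C]_(m, n)) (B : 'M[C]_(n, p)) c c' : 0 <= c ->
  mx_le A c -> mx_le B c' -> mx_le (A *m B) (c * c').
Proof.
move=> c0 hA hB v; rewrite -mulmxA; apply: (le_trans (hA _)).
by rewrite -mulrA ler_wpM2l.
Qed.

Lemma mx_le0 m n c : 0 <= c -> mx_le (0 : 'M[C]_(m, n)) c.
Proof. by move=> c0 v; rewrite mul0mx vnorm0 mulr_ge0 ?l2_ge0. Qed.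

Lemma mx_le1 n : mx_le (1%:M : 'M[C]_n) 1.
Proof. by move=> v; rewrite mul1mx mul1r. Qed.

Lemma mx_le_sum m n I (r : seq I) (F : I -> 'M[C]_(m, n)) (c : I -> R) :
  (forall i, mx_le (F i) (c i)) -> mx_le (\sum_(i <- r) F i) (\sum_(i <- r) c i).
Proof.
move=> h; elim/big_rec2: _ => [|i A x _ hx]; first exact: mx_le0.
exact: mx_leD.
Qed.

Lemma mx_le_col m n (A : 'M[C]_(m, n)) c j : 0 <= c ->
  mx_le A c -> \sum_i rn (A i j) ^+ 2 <= c ^+ 2.
Proof.
move=> c0 /(_ (delta_mx j 0)); rewrite vnorm_delta mulr1 -colE => h.
have -> : \sum_i rn (A i j) ^+ 2 = vnorm (col j A) ^+ 2.
  by rewrite l2_sqr; apply: eq_bigr => i _; rewrite mxE.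
by rewrite ler_pXn2r // nnegrE ?l2_ge0.
Qed.

Lemma mx_le_entry m n (A : 'M[C]_(m, n)) c i j : mx_le A c -> rn (A i j) <= c.
Proof.
move=> /(_ (delta_mx j 0)); rewrite vnorm_delta mulr1 -colE; apply: le_trans.
by have := l2_comp (fun k => col j A k 0) i; rewrite mxE.
Qed.

(* Transposition to the action on [m] copies of [C^n] avoids the indexing of block matrices. *)
Definition block_le m n (F : 'I_m -> 'I_m -> 'M[C]_n) (c : R) : Prop :=
  forall v : 'I_m -> 'cV[C]_n,
    \sum_j vnorm (\sum_k F j k *m v k) ^+ 2 <= c ^+ 2 * \sum_k vnorm (v k) ^+ 2.

Lemma sum_tagnat (V : nmodType) m (p : 'I_m -> nat) (F : 'I_(\sum_i p i) -> V) :
  \sum_k F k = \sum_i \sum_(l < p i) F (tagnat.Rank i l).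
Proof.
rewrite (reindex (@tagnat.rank m p)) /=; last exact: onW_bij (tagnat.rank_bij).
rewrite sig_big_dep /=.
by apply: eq_bigr => -[i l] _; rewrite tagnat.rankE.
Qed.

Lemma vnorm_mxcol m n (v : 'I_m -> 'cV[C]_n) :
  vnorm (\mxcol_(j < m) v j) ^+ 2 = \sum_j vnorm (v j) ^+ 2.
Proof.
rewrite l2_sqr sum_tagnat; apply: eq_bigr => j _; rewrite l2_sqr.
by apply: eq_bigr => l _; congr (rn _ ^+ 2); rewrite -[in RHS](mxcolK v j) [RHS]mxE.
Qed.

Lemma block_leP m n (F : 'I_m -> 'I_m -> 'M[C]_n) c : 0 <= c ->
  (mxnorm (\mxblock_(j < m, k < m) F j k) <= c%:E)%E <-> block_le F c.
Proof.
move=> c0; rewrite mxnormP //; split=> [h v|h v].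
  have := h (\mxcol_k v k); rewrite mul_mxblock_mxrow.
  rewrite -(ler_pXn2r (n := 2)) ?nnegrE ?mulr_ge0 ?l2_ge0 //.
  by rewrite exprMn !vnorm_mxcol.
rewrite -[v]submxcolK mul_mxblock_mxrow.
rewrite -(ler_pXn2r (n := 2)) ?nnegrE ?mulr_ge0 ?l2_ge0 //.
by rewrite exprMn !vnorm_mxcol.
Qed.

End MatrixNorm.

(** * The operators Q(X) and their balls *)

Section Ampliation.
Variables (R : realType) (H K : hilbertType R) (d : nat).
Local Notation C := R[i].
Variable Q : 'I_d -> {linear H -> K}.

Definition ampl_le n (X : mtuple R d n) (c : R) : Prop :=
  forall h : 'I_n.+1 -> H, l2norm (ampl Q X h) <= c * l2norm h.

Definition pencil (y : 'I_d -> C) (h : H) : K := \sum_(j < d) y j *: Q j h.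

Definition pencil_le (y : 'I_d -> C) (c : R) : Prop :=
  forall h, rn (pencil y h) <= c * rn h.

Definition tens n (y : 'I_d -> C) (S : 'M[C]_n.+1) : mtuple R d n :=
  [ffun j => y j *: S].

Lemma amplD n (X Y : mtuple R d n) h k :
  ampl Q [ffun j => X j + Y j] h k = ampl Q X h k + ampl Q Y h k.
Proof.
rewrite /ampl -big_split; apply: eq_bigr => j _; rewrite -big_split.
by apply: eq_bigr => l _; rewrite ffunE mxE scalerDl.
Qed.

Lemma amplZ n (X : mtuple R d n) a h k :
  ampl Q [ffun j => a *: X j] h k = a *: ampl Q X h k.
Proof.
rewrite /ampl scaler_sumr; apply: eq_bigr => j _; rewrite scaler_sumr.
by apply: eq_bigr => l _; rewrite ffunE mxE scalerA.
Qed.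

Lemma amplZr n (X : mtuple R d n) a h k :
  ampl Q X (fun l => a *: h l) k = a *: ampl Q X h k.
Proof.
rewrite /ampl scaler_sumr; apply: eq_bigr => j _; rewrite scaler_sumr.
by apply: eq_bigr => l _; rewrite linearZ /= !scalerA mulrC.
Qed.

Lemma ampl_tens n y (S : 'M[C]_n.+1) h k :
  ampl Q (tens y S) h k = \sum_(l < n.+1) S k l *: pencil y (h l).
Proof.
rewrite /ampl exchange_big /=; apply: eq_bigr => l _; rewrite scaler_sumr.
by apply: eq_bigr => j _; rewrite ffunE mxE scalerA mulrC.
Qed.

Lemma ampl_leP n (X : mtuple R d n) c : 0 <= c ->
  (ampl_norm Q X <= c%:E)%E <-> ampl_le X c.
Proof.
move=> c0; apply: (@sup_unit_ballP _ _ (fun h t => fun k => t%:C *: h k)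
  (@l2norm R H n.+1) (fun h => l2norm (ampl Q X h))) => //= [h|h|h t t0|h t t0|h h0].
- exact: l2_ge0.
- exact: l2_ge0.
- by rewrite l2Z rn_real ger0_norm.
- rewrite -(ger0_norm t0) -rn_real -l2Z; congr (l2norm _); apply/funext => k.
  by rewrite amplZr rn_real ger0_norm.
- rewrite -[RHS](l2_0 K n.+1); congr (l2norm _); apply/funext => k.
  by rewrite /ampl big1 // => j _; rewrite big1 // => l _; rewrite (l2_eq0 h0) linear0 scaler0.
Qed.

Lemma ampl_norm_ge0 n (X : mtuple R d n) : (0 <= ampl_norm Q X)%E.
Proof.
apply: le_ereal_sup_tmp; exists (l2norm (ampl Q X (fun=> 0)))%:E.
  by exists (fun=> 0) => //=; rewrite l2_0.
by rewrite lee_fin l2_ge0.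
Qed.

Lemma ncballP n (X : mtuple R d n) :
  ncball Q X <-> exists c, [/\ 0 <= c, c < 1 & ampl_le X c].
Proof.
rewrite /ncball /=; split=> [h|[c [c0 c1 /(ampl_leP _ c0) h]]]; last first.
  by apply: (le_lt_trans h); rewrite lte_fin.
have h0 := ampl_norm_ge0 X; have hf : ampl_norm Q X \is a fin_num.
  rewrite ge0_fin_numE //; exact: lt_trans h (ltey _).
have h0' : 0 <= fine (ampl_norm Q X) by rewrite fine_ge0.
exists (fine (ampl_norm Q X)); split=> //; first by rewrite -lte_fin fineK.
by apply/ampl_leP => //; rewrite fineK.
Qed.

Lemma ampl_le_mono n (X : mtuple R d n) c c' :
  c <= c' -> ampl_le X c -> ampl_le X c'.
Proof.
by move=> cc h v; apply: (le_trans (h v)); rewrite ler_wpM2r ?l2_ge0.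
Qed.

Lemma pencil_le_mono y c c' : c <= c' -> pencil_le y c -> pencil_le y c'.
Proof.
by move=> cc h v; apply: (le_trans (h v)); rewrite ler_wpM2r ?rn_ge0.
Qed.

Lemma ampl_leD n (X Y : mtuple R d n) c c' :
  ampl_le X c -> ampl_le Y c' -> ampl_le [ffun j => X j + Y j] (c + c').
Proof.
move=> hX hY h; rewrite mulrDl; apply: (le_trans _ (lerD (hX h) (hY h))).
apply: le_trans (l2D _ _); rewrite le_eqVlt; apply/orP; left; apply/eqP.
by congr (l2norm _); apply/funext => k; rewrite amplD.
Qed.

Lemma ampl_leZ n (X : mtuple R d n) a c :
  ampl_le X c -> ampl_le [ffun j => a *: X j] (rn a * c).
Proof.
move=> hX h; have -> : ampl Q [ffun j => a *: X j] h = fun k => a *: ampl Q X h k.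
  by apply/funext => k; rewrite amplZ.
by rewrite l2Z -mulrA ler_wpM2l ?rn_ge0.
Qed.

Lemma pencilD y y' h : pencil (fun j => y j + y' j) h = pencil y h + pencil y' h.
Proof. by rewrite /pencil -big_split; apply: eq_bigr => j _; rewrite scalerDl. Qed.

Lemma pencilZ y a h : pencil (fun j => a * y j) h = a *: pencil y h.
Proof. by rewrite /pencil scaler_sumr; apply: eq_bigr => j _; rewrite scalerA. Qed.

Lemma pencil_leD y y' c c' : pencil_le y c -> pencil_le y' c' ->
  pencil_le (fun j => y j + y' j) (c + c').
Proof.
move=> h h' v; rewrite pencilD mulrDl; apply: (le_trans (rnD _ _)).
exact: lerD.
Qed.

Lemma pencil_leZ y a c : pencil_le y c -> pencil_le (fun j => a * y j) (rn a * c).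
Proof. by move=> h v; rewrite pencilZ rnZ -mulrA ler_wpM2l ?rn_ge0. Qed.

Lemma pencil_le0 c : 0 <= c -> pencil_le (fun=> 0) c.
Proof.
by move=> c0 h; rewrite /pencil big1 ?rn0 ?mulr_ge0 ?rn_ge0 // => j _; rewrite scale0r.
Qed.

Lemma ampl_le_tens1 n y c : 0 <= c -> pencil_le y c ->
  ampl_le (tens y (1%:M : 'M_n.+1)) c.
Proof.
move=> c0 hy h; apply: l2_le_comp => // k; rewrite ampl_tens (bigD1 k) //= big1.
  by rewrite mxE eqxx scale1r addr0.
by move=> l lk; rewrite mxE eq_sym (negbTE lk) scale0r.
Qed.

Lemma pencil_leP y c : 0 <= c -> ampl_le (tens y (1%:M : 'M_1)) c -> pencil_le y c.
Proof.
move=> c0 h v; have := h (fun=> v).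
rewrite /l2norm !big_ord1 !sqrtr_sqr -!/(rn _) !ger0_norm ?rn_ge0 //.
by rewrite ampl_tens big_ord1 mxE scale1r.
Qed.

(** The nilpotent lower shift. Its powers move the first basis vector through the whole basis, so a
    polynomial in it displays its coefficients in column 0. *)
Definition shift n : 'M[C]_n.+1 := \matrix_(i, j) (i == j.+1 :> nat)%:R.

Lemma ampl_le_shift n y c : 0 <= c -> pencil_le y c ->
  ampl_le (tens y (shift n)) c.
Proof.
move=> c0 hy h; apply: l2_le => //.
(* Row 0 of the shift vanishes and its last column does too: output [i + 1] is compared with input
   [i], and the last input is dropped. *)
rewrite big_ord_recl big_ord_recr /= ampl_tens big1 => [|l _]; last first.
  by rewrite mxE scale0r.
rewrite rn0 expr0n add0r mulrDr; apply: (@le_trans _ _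
  (c ^+ 2 * \sum_(i < n) rn (h (widen_ord (leqnSn n) i)) ^+ 2)); last first.
  by rewrite lerDl mulr_ge0 ?sqr_ge0.
rewrite mulr_sumr; apply: ler_sum => i _.
rewrite ampl_tens (bigD1 (widen_ord (leqnSn n) i)) //= big1 => [|l li]; last first.
  rewrite mxE; case: eqP => [/= il|_]; last by rewrite scale0r.
  by case/negP: li; apply/eqP/val_inj => /=; case: il.
rewrite mxE /= /bump /= eqxx scale1r addr0 -exprMn.
have := hy (h (widen_ord (leqnSn n) i)).
have := rn_ge0 (pencil y (h (widen_ord (leqnSn n) i))) => r0 r1.
by rewrite ler_pXn2r // nnegrE // (le_trans r0 r1).
Qed.

Lemma ncball_tens y c : 0 <= c < 1 -> pencil_le y c ->
  ncball Q (tens y (1%:M : 'M_1)).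
Proof.
by move=> /andP[c0 c1] h; apply/ncballP; exists c; split=> //; exact: ampl_le_tens1.
Qed.

Definition upper n (Y : mtuple R d n) : mtuple R d (n + n.+1) :=
  [ffun j => (block_mx 0 (Y j) 0 0 : 'M_(n.+1 + n.+1))].

(* [[a, Y], [0, a]]: its image under an nc function carries the derivative at the scalar point a. *)
Definition jet n (a : 'I_d -> C) (Y : mtuple R d n) : mtuple R d (n + n.+1) :=
  [ffun j => (block_mx (a j)%:M (Y j) 0 (a j)%:M : 'M_(n.+1 + n.+1))].

Lemma jetE n a (Y : mtuple R d n) :
  jet a Y = [ffun j => tens a (1%:M : 'M_((n + n.+1).+1)) j + upper Y j].
Proof.
apply/ffunP => j; rewrite !ffunE scalemx1.
have -> : (a j)%:M = block_mx (a j)%:M 0 0 (a j)%:M :> 'M_(n.+1 + n.+1) by rewrite scalar_mx_block.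
have := add_block_mx (a j)%:M 0 0 (a j)%:M 0 (Y j) 0 (0 : 'M_n.+1).
by rewrite !addr0 add0r => /esym.
Qed.

Lemma ampl_le_upper n (Y : mtuple R d n) c : 0 <= c -> ampl_le Y c -> ampl_le (upper Y) c.
Proof.
move=> c0 hY h.
pose hr (k : 'I_n.+1) : H := h (rshift n.+1 k : 'I_(n.+1 + n.+1)).
have aL k : ampl Q (upper Y) h (lshift n.+1 k : 'I_(n.+1 + n.+1)) = ampl Q Y hr k.
  rewrite /ampl; apply: eq_bigr => j _.
  rewrite (@big_split_ord _ _ _ n.+1 n.+1) /= big1 ?add0r.
    by apply: eq_bigr => l _; congr (_ *: _); rewrite ffunE; exact: block_mxEur.
  by move=> l _; rewrite ffunE [X in X *: _](etrans (block_mxEul _ _ _ _ _ _) (mxE _ _ _ _)) scale0r.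
have aR k : ampl Q (upper Y) h (rshift n.+1 k : 'I_(n.+1 + n.+1)) = 0.
  rewrite /ampl big1 // => j _.
  rewrite (@big_split_ord _ _ _ n.+1 n.+1) /= !big1 ?add0r // => l _.
    by rewrite ffunE [X in X *: _](etrans (block_mxEdr _ _ _ _ _ _) (mxE _ _ _ _)) scale0r.
  by rewrite ffunE [X in X *: _](etrans (block_mxEdl _ _ _ _ _ _) (mxE _ _ _ _)) scale0r.
have hrh : l2norm hr <= l2norm h.
  rewrite -[leRHS]mul1r; apply: l2_le => //; rewrite expr1n mul1r.
  rewrite [leRHS](@big_split_ord _ _ _ n.+1 n.+1) /= lerDr.
  by apply: sumr_ge0 => k _; rewrite sqr_ge0.
apply: (@le_trans _ _ (c * l2norm hr)); last by rewrite ler_wpM2l.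
apply: le_trans (hY hr); rewrite -[leRHS]mul1r; apply: l2_le => //.
rewrite (@big_split_ord _ _ _ n.+1 n.+1) /= expr1n mul1r.
under eq_bigr do rewrite aL.
by rewrite [X in _ + X]big1 ?addr0 // => k _; rewrite aR rn0 expr0n.
Qed.

Lemma ampl_le_jet n a (Y : mtuple R d n) r c : 0 <= r -> 0 <= c ->
  pencil_le a r -> ampl_le Y c -> ampl_le (jet a Y) (r + c).
Proof.
move=> r0 c0 ha hY; rewrite jetE; apply: ampl_leD.
  exact: ampl_le_tens1.
exact: ampl_le_upper.
Qed.

(** Q(Y) is the corner of Q(jet) from the second half of the copies of [H] to the first half of the
    copies of [K], and a corner of an operator has no larger norm. *)
Lemma ampl_le_jet_corner n a (Y : mtuple R d n) c : 0 <= c ->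
  ampl_le (jet a Y) c -> ampl_le Y c.
Proof.
move=> c0 hW h.
pose h' (k : 'I_(n.+1 + n.+1)) : H := match fintype.split k with inl _ => 0 | inr l => h l end.
have hL k : h' (lshift n.+1 k) = 0 by rewrite /h' (unsplitK (inl _ k)).
have hR k : h' (rshift n.+1 k) = h k by rewrite /h' (unsplitK (inr _ k)).
have -> : l2norm h = l2norm (h' : 'I_(n + n.+1).+1 -> H).
  rewrite /l2norm; congr (Num.sqrt _); rewrite [RHS](@big_split_ord _ _ _ n.+1 n.+1) /=.
  rewrite [X in _ = X + _]big1 ?add0r; first by apply: eq_bigr => k _; rewrite hR.
  by move=> k _; rewrite hL normr0 /= expr0n.
apply: le_trans (hW h'); rewrite -[leRHS]mul1r; apply: l2_le => //.
rewrite expr1n mul1r [leRHS](@big_split_ord _ _ _ n.+1 n.+1) /=.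
rewrite -[leLHS]addr0 lerD //; last by apply: sumr_ge0 => k _; rewrite sqr_ge0.
rewrite le_eqVlt; apply/orP; left; apply/eqP; apply: eq_bigr => k _; congr (rn _ ^+ 2).
rewrite /ampl; apply: eq_bigr => j _.
rewrite [RHS](@big_split_ord _ _ _ n.+1 n.+1) /= [X in _ = X + _]big1 ?add0r.
  by apply: eq_bigr => l _; rewrite hR; congr (_ *: _); rewrite ffunE; apply: esym; exact: block_mxEur.
by move=> l _; rewrite hL linear0 scaler0.
Qed.

Lemma ampl_le_dsum n m (X : mtuple R d n) (Y : mtuple R d m) c : 0 <= c ->
  ampl_le X c -> ampl_le Y c -> ampl_le (tdsum X Y) c.
Proof.
move=> c0 hX hY h; apply: l2_le => //.
rewrite !(@big_split_ord _ _ _ n.+1 m.+1) /= mulrDr.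
pose hl (k : 'I_n.+1) : H := h (lshift m.+1 k : 'I_(n.+1 + m.+1)).
pose hr (k : 'I_m.+1) : H := h (rshift n.+1 k : 'I_(n.+1 + m.+1)).
apply: lerD.
  have := hX hl; rewrite l2_leE //.
  apply: le_trans; rewrite le_eqVlt; apply/orP; left; apply/eqP.
  apply: eq_bigr => k _; congr (rn _ ^+ 2); rewrite /ampl; apply: eq_bigr => j _.
  rewrite (@big_split_ord _ _ _ n.+1 m.+1) /= [X in _ + X = _]big1 ?addr0.
    by apply: eq_bigr => l _; congr (_ *: _); rewrite ffunE; exact: block_mxEul.
  by move=> l _; rewrite ffunE [X in X *: _](etrans (block_mxEur _ _ _ _ _ _) (mxE _ _ _ _)) scale0r.
have := hY hr; rewrite l2_leE //.
apply: le_trans; rewrite le_eqVlt; apply/orP; left; apply/eqP.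
apply: eq_bigr => k _; congr (rn _ ^+ 2); rewrite /ampl; apply: eq_bigr => j _.
rewrite (@big_split_ord _ _ _ n.+1 m.+1) /= big1 ?add0r.
  by apply: eq_bigr => l _; congr (_ *: _); rewrite ffunE; exact: block_mxEdr.
by move=> l _; rewrite ffunE [X in X *: _](etrans (block_mxEdl _ _ _ _ _ _) (mxE _ _ _ _)) scale0r.
Qed.

Lemma ncball_dsum n m (X : mtuple R d n) (Y : mtuple R d m) :
  ncball Q X -> ncball Q Y -> ncball Q (tdsum X Y).
Proof.
move=> /ncballP[c [c0 c1 hX]] /ncballP[c' [c'0 c'1 hY]].
apply/ncballP; exists (Num.max c c'); split; first by rewrite le_max c0.
  by rewrite gt_max c1.
by apply: ampl_le_dsum; [by rewrite le_max c0| |];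
  [apply: ampl_le_mono hX | apply: ampl_le_mono hY]; rewrite le_max lexx ?orbT.
Qed.

Lemma ncball0 n : ncball Q (0 : mtuple R d n).
Proof.
apply/ncballP; exists 0; split=> // h; rewrite mul0r -(l2_0 K n.+1).
rewrite le_eqVlt; apply/orP; left; apply/eqP; congr (l2norm _); apply/funext => k.
by rewrite /ampl big1 // => j _; rewrite big1 // => l _; rewrite ffunE mxE scale0r.
Qed.

Lemma ncballZ n (X : mtuple R d n) a : rn a <= 1 -> ncball Q X ->
  ncball Q [ffun j => a *: X j].
Proof.
move=> a1 /ncballP[c [c0 c1 hX]]; apply/ncballP; exists (rn a * c).
split; [by rewrite mulr_ge0 ?rn_ge0| |exact: ampl_leZ].
by apply: le_lt_trans c1; rewrite ler_piMl.
Qed.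

Lemma ncball_expand n (X : mtuple R d n) : ncball Q X ->
  exists2 t : R, 1 < t & ncball Q [ffun j => t%:C *: X j].
Proof.
(* As [c < 1], the factor [2 / (1 + c)] exceeds 1 while its product with [c] stays below 1. *)
move=> /ncballP[c [c0 c1 hX]]; exists (2 / (1 + c)).
  by rewrite ltr_pdivlMr; lra.
apply/ncballP; exists (2 / (1 + c) * c).
have p : 0 < 1 + c by lra.
have q : 0 <= 2 / (1 + c) by rewrite divr_ge0 // ltW.
split; first by rewrite mulr_ge0.
  by rewrite mulrAC ltr_pdivrMr //; lra.
by have := ampl_leZ (2 / (1 + c))%:C hX; rewrite rn_real ger0_norm.
Qed.

Hypothesis Q_bounded : bounded_ops Q.

Lemma ops_bound : exists2 M : R, 0 < M & forall j h, rn (Q j h) <= M * rn h.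
Proof.
have single j : exists2 M : R, 0 < M & forall h, rn (Q j h) <= M * rn h.
  have /linear_boundedP : bounded_near (Q j) (nbhs (0 : H)).
    apply: (@continuous_linear_bounded R[i] H K 0 (Q j)); exact: Q_bounded.
  move=> /pinfty_ex_gt0[M M0 hM]; have M_real := gtr0_real M0.
  exists (complex.Re M); last move=> h.
    by move: M0; rewrite ltcE /= => /andP[].
  have := hM h; rewrite !rnE -(RRe_real M_real) -rmorphM lecR.
  by rewrite /= .
have [M hM] := choice (fun j => let: ex_intro2 M a b := single j in ex_intro _ M (conj a b)).
exists (1 + \sum_j M j) => [|j h].
  by rewrite ltr_wpDr // sumr_ge0 // => j _; case: (hM j) => /ltW.
case: (hM j) => _ /(_ h) /le_trans; apply; rewrite ler_wpM2r ?rn_ge0 //.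
rewrite (bigD1 j) //= addrCA lerDl addr_ge0 // sumr_ge0 // => i _.
by case: (hM i) => /ltW.
Qed.

(** A crude sum over all entries, enough for absorption and for small perturbations at a fixed
    level. The factor [d.+1] keeps the constant positive when [d = 0]. *)
Lemma ampl_le_entries : exists2 M : R, 0 < M &
  forall n (X : mtuple R d n) e, 0 <= e -> (forall j k l, rn (X j k l) <= e) ->
    ampl_le X (M * (n.+1 * n.+1)%:R * e).
Proof.
have [M M0 hM] := ops_bound; exists (M * (d.+1)%:R); first by rewrite mulr_gt0 ?ltr0n.
move=> n X e e0 hX h; apply: (le_trans (l2_le_sum _)).

apply: (@le_trans _ _ (\sum_(k < n.+1) \sum_(j < d) \sum_(l < n.+1) e * (M * l2norm h))).
  apply: ler_sum => k _; apply: (le_trans (rn_sum _ _ _)); apply: ler_sum => j _.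
  apply: (le_trans (rn_sum _ _ _)); apply: ler_sum => l _; rewrite rnZ.
  apply: ler_pM; rewrite ?rn_ge0 //; apply: (le_trans (hM _ _)).
  by rewrite ler_wpM2l ?(ltW M0) ?l2_comp.
rewrite !sumr_const !card_ord natrM.
set L := l2norm h; have L0 : 0 <= L := l2_ge0 h.
have -> : e * (M * L) *+ n.+1 *+ d *+ n.+1 = (M * e * L * n.+1%:R * n.+1%:R) * d%:R.
  by rewrite -[LHS]mulr_natr -[_ *+ d]mulr_natr -[_ *+ n.+1]mulr_natr; ring.
have -> : M * d.+1%:R * (n.+1%:R * n.+1%:R) * e * L = (M * e * L * n.+1%:R * n.+1%:R) * d.+1%:R.
  by ring.
by rewrite ler_wpM2l ?ler_nat // !mulr_ge0 // ltW.
Qed.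

End Ampliation.

(** * Coordinates of X recovered from Q(X) *)

Section Coordinates.
Variables (R : realType) (H K : hilbertType R) (d : nat).
Local Notation C := R[i].
Variable Q : 'I_d -> {linear H -> K}.

Lemma l2_scale_vec n (v : 'cV[C]_n) (h : H) :
  l2norm (fun l => v l 0 *: h) = rn h * vnorm v.
Proof.
apply/eqP; rewrite -(eqrXn2 (n := 2)) ?mulr_ge0 ?l2_ge0 ?rn_ge0 //.
rewrite exprMn !l2_sqr mulr_sumr; apply/eqP; apply: eq_bigr => k _.
by rewrite rnZ exprMn mulrC.
Qed.

(** The matrix is a compression of Q(X): component [p] of its value at [v] is the inner product with
    [g] of component [p] of Q(X) applied to [v] tensor [h]. Cauchy-Schwarz then applies
    componentwise. *)
Lemma mx_le_compress n (X : mtuple R d n) c h g : 0 <= c -> ampl_le Q X c ->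
  mx_le (\sum_j (hdot (Q j h) g : C) *: X j) (rn h * rn g * c).
Proof.
move=> c0 hX v; apply: (@le_trans _ _ (rn g * l2norm (ampl Q X (fun l => v l 0 *: h)))).
  apply: l2_le_comp => [|p]; first exact: rn_ge0.
  rewrite (_ : (_ *m _) _ _ = hdot (ampl Q X (fun l => v l 0 *: h) p) g).
    by rewrite mulrC; exact: cauchy_schwarz.
  rewrite /ampl dot_suml mulmx_suml summxE; apply: eq_bigr => j _.
  rewrite dot_suml mxE; apply: eq_bigr => l _.
  by rewrite mxE linearZ /= dotZl dotZl; ring.
rewrite (_ : rn h * rn g * c * _ = rn g * (c * (rn h * vnorm v))); last by ring.
by rewrite ler_wpM2l ?rn_ge0 // -l2_scale_vec.
Qed.

(** Induction on the dimension of the left kernel. A nonzero kernel vector [a] has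
    [pencil Q a x != 0] for some [x]; the new pair [x], [pencil Q a x] contributes the squared norm
    of that vector as the value at [a], so [a] leaves the kernel and the dimension drops. *)
Lemma separating_family : lin_indep Q -> exists N (h : 'I_N -> H) (g : 'I_N -> K),
  row_free (\matrix_(j < d, k < N) hdot (Q j (h k)) (g k) : 'M[C]_(d, N)).
Proof.
move=> Qi; pose G N (h : 'I_N -> H) (g : 'I_N -> K) : 'M[C]_(d, N) :=
  \matrix_(j, k) hdot (Q j (h k)) (g k).
suff step r : (exists N h g, (\rank (kermx (@G N h g)) <= r)%N) ->
    exists N h g, row_free (@G N h g).
  by apply: (step d); exists 0%N, (fun=> 0), (fun=> 0); exact: rank_leq_row.
elim: r => [|r ih] [N [h [g hr]]].
  exists N, h, g; rewrite -kermx_eq0 -mxrank_eq0; by move: hr; rewrite leqn0.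
have [/eqP k0|k0] := boolP (kermx (G N h g) == 0).
  by exists N, h, g; rewrite -kermx_eq0 k0.
have [a [aG a0]] : exists a : 'rV_d, a *m G N h g = 0 /\ a != 0.
  by case/rowV0Pn: k0 => a /sub_kermxP; exists a.
have [x xa] : exists x, pencil Q (a 0) x != 0.
  apply: contrapT => hx; case/negP: a0; apply/eqP/rowP => j; rewrite mxE.
  by apply: Qi => x; apply: contrapT => px; apply: hx; exists x; apply/eqP.
pose h' (k : 'I_(N + 1)) := if fintype.split k is inl k0 then h k0 else x.
pose g' (k : 'I_(N + 1)) := if fintype.split k is inl k0 then g k0 else pencil Q (a 0) x.
apply: ih; exists (N + 1)%N, h', g'; rewrite -ltnS; apply: leq_trans hr.
have G'G (u : 'rV_d) : u *m G _ h' g' = 0 -> u *m G _ h g = 0.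
  move=> /rowP hu; apply/rowP => k; move: (hu (lshift 1 k)); rewrite !mxE => hk; rewrite -[RHS]hk.
  by apply: eq_bigr => j _; rewrite !mxE /h' /g' (unsplitK (inl _ k)).
apply: rank_ltmx; rewrite ltmxE; apply/andP; split.
  by apply/rV_subP => u /sub_kermxP /G'G /sub_kermxP.
apply/negP => /rV_subP /(_ a) ha.
have /sub_kermxP/rowP/(_ (rshift N 0)) : (a <= kermx (G _ h' g'))%MS by apply/ha/sub_kermxP.
rewrite !mxE => hz.
case/negP: xa; apply/eqP/rn_eq0/eqP; rewrite -sqrf_eq0; apply/eqP/complexI.
rewrite -dotE -[RHS]hz {1}/pencil dot_suml; apply: eq_bigr => j _.
by rewrite mxE dotZl /h' /g' (unsplitK (inr _ 0)).
Qed.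

(** A right inverse of the separating matrix writes each coordinate as a combination of finitely
    many compressions of Q(X). The constant does not depend on the level, which is what makes
    polynomials bounded on the whole ball. *)
Lemma coord_bound : lin_indep Q -> exists2 M : R, 0 <= M &
  forall n (X : mtuple R d n) c, 0 <= c -> ampl_le Q X c ->
    forall j, mx_le (X j) (M * c).
Proof.
move=> /separating_family[N [h [g /row_freeP[B GB]]]].
pose M := \sum_j \sum_k rn (B k j) * (rn (h k) * rn (g k)).
have M0 j : 0 <= \sum_k rn (B k j) * (rn (h k) * rn (g k)).
  by apply: sumr_ge0 => k _; rewrite !mulr_ge0 ?rn_ge0.
exists M => [|n X c c0 hX j]; first by apply: sumr_ge0.
have XE : X j = \sum_k B k j *: \sum_i (hdot (Q i (h k)) (g k) : C) *: X i.
  under eq_bigr do rewrite scaler_sumr.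
  rewrite exchange_big /= [LHS](_ : _ = \sum_i (i == j)%:R *: X i).
    apply: eq_bigr => i _; under eq_bigr do rewrite scalerA.
    rewrite -scaler_suml; congr (_ *: _).
    move/matrixP/(_ i j): GB; rewrite !mxE => <-.
    by apply: eq_bigr => k _; rewrite mxE mulrC.
  rewrite (bigD1 j) //= eqxx scale1r big1 ?addr0 // => i /negbTE ->.
  by rewrite scale0r.
rewrite XE; apply: (@mx_le_trans _ _ _ _ (\sum_k rn (B k j) * (rn (h k) * rn (g k) * c))).
  rewrite /M (bigD1 j) //= mulrDl; under eq_bigr do rewrite mulrA.
  rewrite -mulr_suml lerDl mulr_ge0 // sumr_ge0 //.
apply: mx_le_sum => k; apply: mx_leZ.
exact: mx_le_compress.
Qed.

End Coordinates.

(** * Free polynomials, direct sums and nc functions *)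

Section FreePolynomials.
Variables (R : realType) (d : nat).
Local Notation C := R[i].
Implicit Types p q : ncpoly R d.

Lemma ncpoly_eval_supp p (s : {fset seq 'I_d}) n (X : mtuple R d n) :
  (finsupp p `<=` s)%fset ->
  ncpoly_eval p X = \sum_(w <- s) p w *: \prod_(j <- w) X j.
Proof.
move=> ps; rewrite /ncpoly_eval; apply: big_fset_incl => // w _ pw.
by rewrite fsfun_dflt // scale0r.
Qed.

(** Polynomials are combined through the functions they induce at all levels, so that no algebra
    structure on [ncpoly] has to be set up. *)
Definition is_poly (f : forall n, mtuple R d n -> 'M[C]_n.+1) : Prop :=
  exists p, forall n X, f n X = ncpoly_eval p X.

Lemma is_poly_word (w : seq 'I_d) : is_poly (fun n X => \prod_(j <- w) X j).
Proof.
exists [fsfun x in [fset w]%fset => 1 : C | 0] => n X.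
rewrite (@ncpoly_eval_supp _ [fset w]%fset); last exact: finsupp_sub.
by rewrite big_seq_fset1 fsfunE in_fset1 eqxx scale1r.
Qed.

Lemma is_polyD f g : is_poly f -> is_poly g -> is_poly (fun n X => f n X + g n X).
Proof.
move=> [p hp] [q hq].
exists [fsfun x in (finsupp p `|` finsupp q)%fset => p x + q x | 0] => n X.
rewrite (@ncpoly_eval_supp _ (finsupp p `|` finsupp q)%fset); last exact: finsupp_sub.
rewrite hp hq !(@ncpoly_eval_supp _ (finsupp p `|` finsupp q)%fset);
  [|exact: fsubsetUr|exact: fsubsetUl].
rewrite -big_split /= big_seq [RHS]big_seq; apply: eq_bigr => w ws.
by rewrite fsfunE ws scalerDl.
Qed.

Lemma is_polyZ f a : is_poly f -> is_poly (fun n X => a *: f n X).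
Proof.
move=> [p hp]; exists [fsfun x in finsupp p => a * p x | 0] => n X.
rewrite (@ncpoly_eval_supp _ (finsupp p)); last exact: finsupp_sub.
rewrite hp scaler_sumr big_seq [RHS]big_seq; apply: eq_bigr => w ws.
by rewrite fsfunE ws scalerA.
Qed.

Lemma is_poly_sum I (r : seq I) (f : I -> forall n, mtuple R d n -> 'M[C]_n.+1) :
  (forall i, is_poly (f i)) -> is_poly (fun n X => \sum_(i <- r) f i n X).
Proof.
move=> h; elim: r => [|i r [p hp]].
  have [p hp] := is_polyZ 0 (is_poly_word [::]).
  by exists p => n X; rewrite -hp scale0r big_nil.
have [q hq] := is_polyD (h i) (ex_intro _ p hp).
by exists q => n X; rewrite big_cons hq.
Qed.

Lemma is_polyM f g : is_poly f -> is_poly g -> is_poly (fun n X => f n X * g n X).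
Proof.
move=> [p hp] [q hq].
have [r hr] : is_poly (fun n X => \sum_(u <- finsupp p) \sum_(v <- finsupp q)
    (p u * q v) *: \prod_(j <- u ++ v) X j).
  by apply: is_poly_sum => u; apply: is_poly_sum => v; apply/is_polyZ/is_poly_word.
exists r => n X; rewrite -hr hp hq /ncpoly_eval mulr_suml; apply: eq_bigr => u _.
rewrite mulr_sumr; apply: eq_bigr => v _.
by rewrite -scalerAl -scalerAr scalerA big_cat.
Qed.

Lemma is_poly1 : is_poly (fun n X => 1).
Proof. by have [p hp] := is_poly_word [::]; exists p => n X; rewrite -hp big_nil. Qed.

Lemma is_poly_var j : is_poly (fun n X => X j).
Proof. by have [p hp] := is_poly_word [:: j]; exists p => n X; rewrite -hp big_seq1. Qed.

Lemma is_poly_lin (c : 'I_d -> C) : is_poly (fun n X => \sum_j c j *: X j).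
Proof. by apply: is_poly_sum => j; apply/is_polyZ/is_poly_var. Qed.

End FreePolynomials.

Section DirectSums.
Variables (R : realType).
Local Notation C := R[i].

Lemma dsumD n m (A A' : 'M[C]_n.+1) (B B' : 'M[C]_m.+1) :
  dsum (A + A') (B + B') = dsum A B + dsum A' B'.
Proof.
by have := add_block_mx A 0 0 B A' 0 0 B'; rewrite !addr0 => /esym.
Qed.

Lemma dsumM n m (A A' : 'M[C]_n.+1) (B B' : 'M[C]_m.+1) :
  dsum (A *m A') (B *m B') = dsum A B *m dsum A' B'.
Proof.
by have := mulmx_block A 0 0 B A' 0 0 B'; rewrite !mulmx0 !mul0mx !addr0 !add0r => /esym.
Qed.

Lemma dsumZ n m a (A : 'M[C]_n.+1) (B : 'M[C]_m.+1) :
  dsum (a *: A) (a *: B) = a *: dsum A B.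
Proof. by have := scale_block_mx a A 0 0 B; rewrite !scaler0 => /esym. Qed.

Lemma dsum0 n m : dsum (0 : 'M[C]_n.+1) (0 : 'M[C]_m.+1) = 0.
Proof. by rewrite /dsum; exact: (block_mx0 C n.+1 m.+1 n.+1 m.+1). Qed.

End DirectSums.

Section NcFunctions.
Variables (R : realType) (d : nat) (Om : graded_set R d).
Arguments Om : clear implicits.
Local Notation C := R[i].
Implicit Types f g : gfun Om.

Lemma is_nc_funP f : is_nc_fun f <->
  (forall (n m : nat) (X : Om n) (Y : Om m) (Z : Om (n + m.+1)%N),
     set_val Z = tdsum (set_val X) (set_val Y) -> f _ Z = dsum (f _ X) (f _ Y)) /\
  (forall (n : nat) (S : 'M[C]_n.+1) (X Y : Om n), S \in unitmx ->
     set_val Y = tconj S (set_val X) -> f _ Y = invmx S *m f _ X *m S).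
Proof.
split=> -[hd hc]; split=> [n m X Y Z e|n S X Y Su e].
- by have /ffunP/(_ ord0) := hd _ _ _ _ _ e; rewrite !ffunE.
- by have /ffunP/(_ ord0) := hc _ _ _ _ Su e; rewrite !ffunE.
- by apply/ffunP => j; rewrite !ffunE; exact: hd.
- by apply/ffunP => j; rewrite !ffunE; exact: hc.
Qed.

Lemma is_nc_fun_add f g : is_nc_fun f -> is_nc_fun g -> is_nc_fun (gfun_add f g).
Proof.
move=> /is_nc_funP[df cf] /is_nc_funP[dg cg]; apply/is_nc_funP; split.
  by move=> n m X Y Z e; rewrite /gfun_add (df _ _ _ _ _ e) (dg _ _ _ _ _ e) dsumD.
move=> n S X Y Su e; rewrite /gfun_add (cf _ _ _ _ Su e) (cg _ _ _ _ Su e).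
by rewrite mulmxDr mulmxDl.
Qed.

Lemma is_nc_fun_scale a f : is_nc_fun f -> is_nc_fun (gfun_scale a f).
Proof.
move=> /is_nc_funP[df cf]; apply/is_nc_funP; split.
  by move=> n m X Y Z e; rewrite /gfun_scale (df _ _ _ _ _ e) dsumZ.
move=> n S X Y Su e; rewrite /gfun_scale (cf _ _ _ _ Su e).
by rewrite -scalemxAr -scalemxAl.
Qed.

Lemma is_nc_fun_mul f g : is_nc_fun f -> is_nc_fun g -> is_nc_fun (gfun_mul f g).
Proof.
move=> /is_nc_funP[df cf] /is_nc_funP[dg cg]; apply/is_nc_funP; split.
  by move=> n m X Y Z e; rewrite /gfun_mul (df _ _ _ _ _ e) (dg _ _ _ _ _ e) dsumM.
move=> n S X Y Su e; rewrite /gfun_mul (cf _ _ _ _ Su e) (cg _ _ _ _ Su e).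
by rewrite !mulmxA mulmxK.
Qed.

Lemma is_nc_fun_cst a : is_nc_fun (fun n (X : Om n) => a%:M).
Proof.
apply/is_nc_funP; split=> [n m X Y Z _|n S X Y Su _].
  by rewrite /dsum -scalar_mx_block.
by rewrite -mulmxA -scalar_mxC mulKmx.
Qed.

Lemma is_nc_fun_var j : is_nc_fun (fun n (X : Om n) => set_val X j).
Proof.
by apply/is_nc_funP; split=> [n m X Y Z ->|n S X Y Su ->]; rewrite ffunE.
Qed.

Lemma is_nc_fun_poly (p : ncpoly R d) : is_nc_fun (ncpoly_fun Om p).
Proof.
rewrite /ncpoly_fun /ncpoly_eval; elim: (enum_fset (finsupp p)) => [|w s ih].
  rewrite (_ : (fun _ _ => _) = (fun n (X : Om n) => 0%:M)); first exact: is_nc_fun_cst.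
  by apply/functional_extensionality_dep => n; apply/funext => X; rewrite big_nil raddf0.
rewrite (_ : (fun _ _ => _) = gfun_add
    (gfun_scale (p w) (fun n (X : Om n) => \prod_(j <- w) set_val X j))
    (fun n (X : Om n) => \sum_(w <- s) p w *: \prod_(j <- w) set_val X j)).
  apply: is_nc_fun_add; last exact: ih.
  apply: is_nc_fun_scale.
  elim: w => [|j w ihw].
    rewrite (_ : (fun _ _ => _) = (fun n (X : Om n) => 1%:M)); first exact: is_nc_fun_cst.
    by apply/functional_extensionality_dep => n; apply/funext => X; rewrite big_nil.
  rewrite (_ : (fun _ _ => _) = gfun_mul (fun n (X : Om n) => set_val X j)
    (fun n (X : Om n) => \prod_(j <- w) set_val X j)).
    by apply: is_nc_fun_mul; [exact: is_nc_fun_var|exact: ihw].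
  by apply/functional_extensionality_dep => n; apply/funext => X; rewrite big_cons.
by apply/functional_extensionality_dep => n; apply/funext => X; rewrite big_cons.
Qed.

End NcFunctions.

(** * The algebra of a ball *)

Section BallAlgebra.
Variables (R : realType) (H K : hilbertType R) (d : nat).
Local Notation C := R[i].
Variable Q : 'I_d -> {linear H -> K}.
Implicit Types f g : gfun (ncball Q).

Definition ball_pt n (X : mtuple R d n) (hX : ncball Q X) : ncball Q (n := n) :=
  SigSub (mem_set hX).

Lemma ball_ptE n (X : mtuple R d n) (hX : ncball Q X) : set_val (ball_pt hX) = X.
Proof. by []. Qed.

Lemma ball_valP n (X : ncball Q (n := n)) : ncball Q (set_val X).
Proof. exact: set_valP. Qed.

Lemma ball_val_inj n (X Y : ncball Q (n := n)) : set_val X = set_val Y -> X = Y.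
Proof. exact: val_inj. Qed.

Definition gfun_le f (c : R) : Prop := forall n (X : ncball Q (n := n)), mx_le (f n X) c.

Lemma gfun_normP f c : 0 <= c -> (gfun_norm f <= c%:E)%E <-> gfun_le f c.
Proof.
move=> c0; split=> [/ereal_supP h n X|h].
  by apply/mxnormP => //; apply: h; exists (existT _ n X).
by apply/ereal_supP => _ [[n X] _ <-] /=; apply/mxnormP.
Qed.

Lemma gfun_mxnormP m (F : 'I_m -> 'I_m -> gfun (ncball Q)) c : 0 <= c ->
  (gfun_mxnorm F <= c%:E)%E <->
  forall n (X : ncball Q (n := n)), block_le (fun j k => F j k n X) c.
Proof.
move=> c0; split=> [/ereal_supP h n X|h].
  by apply/block_leP => //; apply: h; exists (existT _ n X).
by apply/ereal_supP => _ [[n X] _ <-] /=; apply/block_leP => //; exact: h.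
Qed.

Definition poly_approx f : Prop := forall e : R, 0 < e -> exists p : ncpoly R d,
  forall n (X : ncball Q (n := n)), mx_le (f n X - ncpoly_eval p (set_val X)) e.

Lemma gfun_norm_ge0 f : (0 <= gfun_norm f)%E.
Proof.
pose X := ball_pt (ncball0 Q 0).
apply: le_ereal_sup_tmp; exists (mxnorm (f 0%N X)).
  by exists (existT _ 0%N X).
apply: le_ereal_sup_tmp; exists (vnorm (f 0%N X *m 0))%:E; last by rewrite lee_fin l2_ge0.
by exists 0 => //=; rewrite -/(vnorm _) vnorm0.
Qed.

Lemma approx_norm f : poly_approx f <-> forall e : R, 0 < e -> exists p : ncpoly R d,
  (gfun_norm (gfun_add f (gfun_opp (ncpoly_fun (ncball Q) p))) < e%:E)%E.
Proof.
split=> h e e0.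
  (* Halving [e] turns the pointwise non-strict bound into a strict one for the supremum. *)
  have [|p hp] := h (e / 2); first by rewrite divr_gt0.
  exists p; apply: (@le_lt_trans _ _ (e / 2)%:E); last by rewrite lte_fin; lra.
  by apply/gfun_normP; [rewrite divr_ge0 // ltW|].
have [p /ltW hp] := h e e0; exists p => n X.
by move/gfun_normP: hp; apply; exact: ltW.
Qed.

Hypothesis Q_indep : lin_indep Q.

Lemma ball_coord_bound : exists2 M : R, 0 <= M &
  forall j n (X : ncball Q (n := n)), mx_le (set_val X j) M.
Proof.
have [M M0 hM] := coord_bound Q_indep; exists M => // j n X.
have /ncballP[c [c0 c1 hX]] := ball_valP X.
by apply: mx_le_trans (hM _ _ _ c0 hX j); rewrite ler_piMr // ltW.
Qed.

Lemma poly_bound (p : ncpoly R d) : exists2 M : R, 0 <= M & gfun_le (ncpoly_fun _ p) M.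
Proof.
have [M M0 hM] := ball_coord_bound.
exists (\sum_(w <- finsupp p) rn (p w) * \prod_(j <- w) M) => [|n X].
  by apply: sumr_ge0 => w _; rewrite mulr_ge0 ?rn_ge0 // prodr_ge0.
apply: mx_le_sum => w; apply: mx_leZ; elim: w => [|j w ih].
  by rewrite !big_nil; exact: mx_le1.
by rewrite !big_cons; apply: mx_leM.
Qed.

(** A uniform limit of polynomials is bounded because each polynomial is bounded on the ball, by the
    bound on the coordinates. *)
Lemma AalgP f : Aalg (ncball Q) f <-> is_nc_fun f /\ poly_approx f.
Proof.
split=> [[[ncf _] /approx_norm af]|[ncf af]]; first by [].
split; last exact/approx_norm.
split=> //; have [p hp] := af 1 ltr01; have [M M0 hM] := poly_bound p.
apply: (@le_lt_trans _ _ (1 + M)%:E); last exact: ltey.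
apply/gfun_normP => [|n X]; first by rewrite addr_ge0.
by rewrite -(subrK (ncpoly_eval p (set_val X)) (f n X)); apply: mx_leD => //; exact: hM.
Qed.

Lemma Aalg_bound f : Aalg (ncball Q) f -> exists2 M : R, 0 <= M & gfun_le f M.
Proof.
move=> [[_ h] _]; have h0 := gfun_norm_ge0 f.
have hf : gfun_norm f \is a fin_num by rewrite ge0_fin_numE.
by exists (fine (gfun_norm f)); [rewrite fine_ge0|apply/gfun_normP; rewrite ?fine_ge0 ?fineK].
Qed.

Lemma Aalg_poly p : Aalg (ncball Q) (ncpoly_fun _ p).
Proof.
apply/AalgP; split; first exact: is_nc_fun_poly.
by move=> e e0; exists p => n X; rewrite subrr; exact/mx_le0/ltW.
Qed.

Lemma Aalg_is_poly F : is_poly F -> Aalg (ncball Q) (fun n X => F n (set_val X)).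
Proof.
move=> [p hp]; rewrite (_ : (fun _ _ => _) = ncpoly_fun (ncball Q) p); first exact: Aalg_poly.
by apply/functional_extensionality_dep => n; apply/funext => X; rewrite hp.
Qed.

Lemma Aalg_add f g : Aalg (ncball Q) f -> Aalg (ncball Q) g -> Aalg (ncball Q) (gfun_add f g).
Proof.
move=> /AalgP[nf af] /AalgP[ng ag]; apply/AalgP; split; first exact: is_nc_fun_add.
move=> e e0; have e2 : 0 < e / 2 by rewrite divr_gt0.
have [p hp] := af _ e2; have [q hq] := ag _ e2.
have [r hr] := is_polyD (ex_intro _ p (fun n X => erefl)) (ex_intro _ q (fun n X => erefl)).
exists r => n X; rewrite -hr /gfun_add.
by rewrite opprD addrACA [e]splitr; apply: mx_leD.
Qed.

Lemma Aalg_scale a f : Aalg (ncball Q) f -> Aalg (ncball Q) (gfun_scale a f).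
Proof.
move=> /AalgP[nf af]; apply/AalgP; split; first exact: is_nc_fun_scale.
move=> e e0; have e2 : 0 < e / (rn a + 1) by rewrite divr_gt0 // ltr_wpDl ?rn_ge0.
have [p hp] := af _ e2.
have [r hr] := is_polyZ a (ex_intro _ p (fun n X => erefl)).
exists r => n X; rewrite -hr /gfun_scale -scalerBr.
apply: mx_le_trans (mx_leZ a (hp n X)).
have := rn_ge0 a => a0; rewrite mulrA ler_pdivrMr ?ltr_wpDl // mulrC.
by rewrite ler_pM2l //; lra.
Qed.

Lemma Aalg_mul f g : Aalg (ncball Q) f -> Aalg (ncball Q) g -> Aalg (ncball Q) (gfun_mul f g).
Proof.
move=> Af Ag; have [Mg Mg0 hMg] := Aalg_bound Ag.
move/AalgP: Af => [nf af]; move/AalgP: Ag => [ng ag].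
apply/AalgP; split; first exact: is_nc_fun_mul.
(* The tolerance for [q] is fixed after [p], since it depends on the bound of [p]; the added 1 keeps
   the denominators positive. *)
move=> e e0; have [p hp] := af (e / 2 / (Mg + 1)) ltac:(by rewrite !divr_gt0 // ltr_wpDl).
have [Mp Mp0 hMp] := poly_bound p.
have [q hq] := ag (e / 2 / (Mp + 1)) ltac:(by rewrite !divr_gt0 // ltr_wpDl).
have [r hr] := is_polyM (ex_intro _ p (fun n X => erefl)) (ex_intro _ q (fun n X => erefl)).
exists r => n X; rewrite -hr /gfun_mul.
have -> : f n X *m g n X - ncpoly_eval p (set_val X) * ncpoly_eval q (set_val X) =
  (f n X - ncpoly_eval p (set_val X)) *m g n X +
  ncpoly_eval p (set_val X) *m (g n X - ncpoly_eval q (set_val X)).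
  by rewrite mulmxBl mulmxBr addrA subrK.
rewrite [e]splitr; apply: mx_leD.
  apply: mx_le_trans (mx_leM _ (hp n X) (hMg n X)); last by rewrite !divr_ge0 ?ltW // ltr_wpDl.
  by rewrite mulrAC ler_pdivrMr ?ltr_wpDl // ler_pM2l ?divr_gt0 //; lra.
apply: mx_le_trans (mx_leM Mp0 (hMp n X) (hq n X)).
by rewrite mulrC mulrAC ler_pdivrMr ?ltr_wpDl // ler_pM2l ?divr_gt0 //; lra.
Qed.

Definition gfun_cst (a : C) : gfun (ncball Q) := fun n X => a%:M.
Definition gfun_var (j : 'I_d) : gfun (ncball Q) := fun n X => set_val X j.
Definition gfun_lin (c : 'I_d -> C) : gfun (ncball Q) :=
  fun n X => \sum_j c j *: set_val X j.

Lemma Aalg_cst a : Aalg (ncball Q) (gfun_cst a).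
Proof.
have [p hp] := is_polyZ a (is_poly1 R d).
apply: (@Aalg_is_poly (fun n _ => a%:M)); exists p => n X; rewrite -hp.
by rewrite scalemx1.
Qed.

Lemma Aalg_var j : Aalg (ncball Q) (gfun_var j).
Proof. exact: (Aalg_is_poly (is_poly_var R j)). Qed.

Lemma Aalg_lin c : Aalg (ncball Q) (gfun_lin c).
Proof. exact: (Aalg_is_poly (is_poly_lin c)). Qed.

End BallAlgebra.

Lemma gfunP (R : realType) d (Om : graded_set R d) (f g : gfun Om) :
  (forall n X, f n X = g n X) -> f = g.
Proof.
by move=> h; apply/functional_extensionality_dep => n; apply/funext => X.
Qed.

(** * Linear substitutions and pairs of inverse isomorphisms *)

Section LinearTuples.
Variable R : realType.
Local Notation C := R[i].

Definition mxtup d1 d2 (B : 'M[C]_(d2, d1)) n (X : mtuple R d1 n) : mtuple R d2 n :=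
  [ffun i => \sum_j B i j *: X j].

Lemma mxtup_dsum d1 d2 (B : 'M[C]_(d2, d1)) n m (X : mtuple R d1 n) (Y : mtuple R d1 m) :
  mxtup B (tdsum X Y) = tdsum (mxtup B X) (mxtup B Y).
Proof.
apply/ffunP => i; rewrite !ffunE.
rewrite (eq_bigr (fun j => dsum (B i j *: X j) (B i j *: Y j))); last first.
  by move=> j _; rewrite ffunE dsumZ.
elim: (index_enum _) => [|j s ih]; first by rewrite !big_nil dsum0.
by rewrite !big_cons ih dsumD.
Qed.

Lemma mxtup_conj d1 d2 (B : 'M[C]_(d2, d1)) n (S : 'M[C]_n.+1) (X : mtuple R d1 n) :
  mxtup B (tconj S X) = tconj S (mxtup B X).
Proof.
apply/ffunP => i; rewrite !ffunE mulmx_sumr mulmx_suml; apply: eq_bigr => j _.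
by rewrite ffunE -scalemxAr -scalemxAl.
Qed.

Lemma mxtup_mul d1 d2 d3 (A : 'M[C]_(d3, d2)) (B : 'M[C]_(d2, d1)) n (X : mtuple R d1 n) :
  mxtup A (mxtup B X) = mxtup (A *m B) X.
Proof.
apply/ffunP => i; rewrite !ffunE.
under eq_bigr do rewrite ffunE scaler_sumr.
rewrite exchange_big; apply: eq_bigr => j _; rewrite mxE scaler_suml.
by apply: eq_bigr => k _; rewrite scalerA.
Qed.

Lemma mxtup1 d n (X : mtuple R d n) : mxtup 1%:M X = X.
Proof.
apply/ffunP => i; rewrite ffunE (bigD1 i) //= big1 ?addr0 => [|j ji].
  by rewrite mxE eqxx scale1r.
by rewrite mxE eq_sym (negbTE ji) scale0r.
Qed.

End LinearTuples.
Arguments mxtup {R d1 d2} B {n} X.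

Section IsoPairs.
Variables (R : realType) (H1 K1 H2 K2 : hilbertType R) (d1 d2 : nat).
Local Notation C := R[i].
Variables (Q1 : 'I_d1 -> {linear H1 -> K1}) (Q2 : 'I_d2 -> {linear H2 -> K2}).

Definition alg_contraction (Phi : gfun (ncball Q1) -> gfun (ncball Q2)) : Prop :=
  [/\ (forall f, Aalg (ncball Q1) f -> Aalg (ncball Q2) (Phi f)),
      (forall f g, Aalg (ncball Q1) f -> Aalg (ncball Q1) g ->
         Phi (gfun_add f g) = gfun_add (Phi f) (Phi g)),
      (forall a f, Aalg (ncball Q1) f -> Phi (gfun_scale a f) = gfun_scale a (Phi f)),
      (forall f g, Aalg (ncball Q1) f -> Aalg (ncball Q1) g ->
         Phi (gfun_mul f g) = gfun_mul (Phi f) (Phi g)) &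
      (forall m (F : 'I_m -> 'I_m -> gfun (ncball Q1)),
         (forall j k, Aalg (ncball Q1) (F j k)) ->
         (gfun_mxnorm (fun j k => Phi (F j k)) <= gfun_mxnorm F)%E)].

End IsoPairs.

Section IsoPairs2.
Variables (R : realType) (H1 K1 H2 K2 : hilbertType R) (d1 d2 : nat).
Local Notation C := R[i].
Variables (Q1 : 'I_d1 -> {linear H1 -> K1}) (Q2 : 'I_d2 -> {linear H2 -> K2}).

(** Two mutually inverse complete contractions are complete isometries. This form is symmetric in
    the two balls and closed under composition, both of which are used repeatedly. *)
Definition iso_pair (Phi : gfun (ncball Q1) -> gfun (ncball Q2))
    (Psi : gfun (ncball Q2) -> gfun (ncball Q1)) : Prop :=
  [/\ alg_contraction Phi, alg_contraction Psi,
      (forall f, Aalg (ncball Q1) f -> Psi (Phi f) = f) &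
      (forall g, Aalg (ncball Q2) g -> Phi (Psi g) = g)].

Hypotheses (Q1_indep : lin_indep Q1).
Hypotheses (Q2_indep : lin_indep Q2).

Lemma alg_isoP : alg_completely_isometric_iso (ncball Q1) (ncball Q2) <->
  exists Phi Psi, iso_pair Phi Psi.
Proof.
split=> [[Phi [bij pD pZ pM pN]]|[Phi [Psi [[PA PD PZ PM PN] [SA SD SZ SM SN] PK SK]]]].
  case: bij => PA Pinj Psurj.
  (* The value 0 serves functions without a preimage in the algebra; surjectivity excludes it on the
     second algebra. *)
  pose Psi g := if pselect (exists f, Aalg (ncball Q1) f /\ Phi f = g) is left e
    then projT1 (cid e) else gfun_cst 0.
  have PsiP g : Aalg (ncball Q2) g -> Aalg (ncball Q1) (Psi g) /\ Phi (Psi g) = g.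
    move=> /Psurj[f Af fg]; rewrite /Psi; case: pselect => [e|[]]; last by exists f.
    exact: projT2 (cid e).
  clearbody Psi; have SA g : Aalg (ncball Q2) g -> Aalg (ncball Q1) (Psi g) by move=> /PsiP[].
  have SK g : Aalg (ncball Q2) g -> Phi (Psi g) = g by move=> /PsiP[].
  have inj f g : Aalg (ncball Q1) f -> Aalg (ncball Q2) g -> Phi f = g -> Psi g = f.
    move=> Af Ag e; apply: Pinj; [exact/mem_set/SA|exact: mem_set|].
    by rewrite SK.
  exists Phi, Psi; split=> [|||//].
  - by split=> // m F AF; rewrite pN.
  - split=> [//|f g Af Ag|a f Af|f g Af Ag|m F AF].
    + apply: inj; [by apply: Aalg_add; try exact: SA|exact: Aalg_add|].
      by rewrite pD ?SK //; exact: SA.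
    + apply: inj; [by apply: Aalg_scale; try exact: SA|exact: Aalg_scale|].
      by rewrite pZ ?SK //; exact: SA.
    + apply: inj; [by apply: Aalg_mul; try exact: SA|exact: Aalg_mul|].
      by rewrite pM ?SK //; exact: SA.
    + rewrite -pN => [|j k]; last exact: SA.
      rewrite (_ : (fun j k => Phi (Psi (F j k))) = F) //.
      by apply/funext => j; apply/funext => k; rewrite SK.
  - by move=> f Af; apply: inj => //; exact: PA.
exists Phi; split=> //.
  split=> [f /PA //|f g /set_mem Af /set_mem Ag e|g Ag /=].
    by rewrite -(PK f) // e PK.
  by exists (Psi g); [exact: SA|exact: SK].
move=> m F AF; apply/eqP; rewrite eq_le PN //=.
have := SN m (fun j k => Phi (F j k)) (fun j k => PA _ (AF j k)).
by rewrite (_ : (fun j k => Psi (Phi (F j k))) = F) //; apply/funext => j; apply/funext => k; rewrite PK.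
Qed.

End IsoPairs2.

Section Pullback.
Variables (R : realType) (H1 K1 H2 K2 : hilbertType R) (d1 d2 : nat).
Local Notation C := R[i].
Variables (Q1 : 'I_d1 -> {linear H1 -> K1}) (Q2 : 'I_d2 -> {linear H2 -> K2}).
Hypotheses (Q1_indep : lin_indep Q1).
Hypotheses (Q2_indep : lin_indep Q2).

Definition maps_ball (B : 'M[C]_(d1, d2)) : Prop :=
  forall n (Y : mtuple R d2 n), ncball Q2 Y -> ncball Q1 (mxtup B Y).

Definition pullback B (hB : maps_ball B) (f : gfun (ncball Q1)) : gfun (ncball Q2) :=
  fun n Y => f n (ball_pt (hB _ _ (ball_valP Y))).

Lemma is_poly_mxtup (B : 'M[C]_(d1, d2)) (p : ncpoly R d1) :
  is_poly (fun n (Y : mtuple R d2 n) => ncpoly_eval p (mxtup B Y)).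
Proof.
apply: is_poly_sum => w; apply: is_polyZ; elim: w => [|j w [q hq]].
  by have [q hq] := is_poly1 R d2; exists q => n X; rewrite -hq big_nil.
have [r hr] := is_polyM (is_poly_lin (fun k => B j k)) (ex_intro _ q hq).
by exists r => n X; rewrite -hr big_cons ffunE.
Qed.

Lemma pullback_contraction B (hB : maps_ball B) : alg_contraction (pullback hB).
Proof.
split=> // [f|m F _].
  move=> /AalgP-/(_ Q1_indep)[/is_nc_funP[df cf] af].
  apply/AalgP => //; split.
    apply/is_nc_funP; split=> [n m X Y Z e|n S X Y Su e].
      by apply: df; apply: etrans (mxtup_dsum _ _ _); rewrite -e.
    by apply: cf => //; apply: etrans (mxtup_conj _ _ _); rewrite -e.
  move=> e /af[p hp]; have [q hq] := is_poly_mxtup B p.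
  by exists q => n Y; rewrite -hq; exact: hp.
apply: ereal_sup_le => _ [[n Y] _ <-] /=.
by exists (existT _ n (ball_pt (hB _ _ (ball_valP Y)))).
Qed.

End Pullback.

Section PullbackIso.
Variables (R : realType) (H1 K1 H2 K2 : hilbertType R) (d1 d2 : nat).
Local Notation C := R[i].
Variables (Q1 : 'I_d1 -> {linear H1 -> K1}) (Q2 : 'I_d2 -> {linear H2 -> K2}).
Hypotheses (Q1_indep : lin_indep Q1).
Hypotheses (Q2_indep : lin_indep Q2).

Lemma pullback_iso_pair (B : 'M[C]_(d1, d2)) (A : 'M[C]_(d2, d1))
    (hB : maps_ball Q1 Q2 B) (hA : maps_ball Q2 Q1 A) :
  B *m A = 1%:M -> A *m B = 1%:M -> iso_pair (pullback hB) (pullback hA).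
Proof.
move=> BA AB; split; try exact: pullback_contraction.
  move=> f _; apply: gfunP => n X; rewrite /pullback; congr (f n _).
  by apply: ball_val_inj; rewrite [LHS](mxtup_mul B A) BA mxtup1.
move=> f _; apply: gfunP => n X; rewrite /pullback; congr (f n _).
by apply: ball_val_inj; rewrite [LHS](mxtup_mul A B) AB mxtup1.
Qed.

End PullbackIso.

(** * Linear isomorphisms of balls as pairs of scalar matrices *)

Section LinearIso.
Variable R : realType.
Local Notation C := R[i].

Lemma mxtup_is_linear d1 d2 (A : 'M[C]_(d2, d1)) n : linear (mxtup A : mtuple R d1 n -> mtuple R d2 n).
Proof.
move=> a X Y; apply/ffunP => i; rewrite !ffunE scaler_sumr -big_split.
by apply: eq_bigr => j _; rewrite !ffunE scalerDr !scalerA mulrC.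
Qed.

HB.instance Definition _ d1 d2 (A : 'M[C]_(d2, d1)) n :=
  GRing.isLinear.Build C (mtuple R d1 n) (mtuple R d2 n) *:%R (mxtup A) (@mxtup_is_linear d1 d2 A n).

Lemma tdsumZ d n m (X : mtuple R d n) (Y : mtuple R d m) a :
  tdsum (a *: X) (a *: Y) = a *: tdsum X Y.
Proof. by apply/ffunP => j; rewrite !ffunE dsumZ. Qed.

Lemma tconjZ d n (X : mtuple R d n) S a : tconj S (a *: X) = a *: tconj S X.
Proof. by apply/ffunP => j; rewrite !ffunE -scalemxAr -scalemxAl. Qed.

(** Every tuple can be scaled into the ball, so homogeneous identities known on the ball hold
    everywhere. *)
Lemma ball_absorbing (H K : hilbertType R) d (Q : 'I_d -> {linear H -> K}) n (X : mtuple R d n) :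
  bounded_ops Q -> exists2 t : R, 0 < t & forall s : R, 0 <= s -> s <= t -> ncball Q (s%:C *: X).
Proof.
move=> Qb; have [M M0 hM] := ampl_le_entries Qb.
pose e := \sum_j \sum_k \sum_l rn (X j k l).
have e0 : 0 <= e by do 3!(apply: sumr_ge0 => ? _); exact: rn_ge0.
have hX := hM n X e e0; set c := _ * _ * e in hX.
have c0 : 0 <= c by rewrite !mulr_ge0 // ltW.
have {}hX : ampl_le Q X c.
  apply: hX => j k l; rewrite /e (bigD1 j) //= (bigD1 k) //= (bigD1 l) //= -!addrA lerDl.
  by do ?apply: addr_ge0; do ?(apply: sumr_ge0 => ? _); exact: rn_ge0.
exists (1 + c)^-1 => [|s s0 st]; first by rewrite invr_gt0 ltr_pwDl.
apply/ncballP; exists (s * c); split; first by rewrite mulr_ge0.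
  apply: (@le_lt_trans _ _ ((1 + c)^-1 * c)); first by rewrite ler_wpM2r.
  by rewrite mulrC ltr_pdivrMr; lra.
rewrite (_ : s%:C *: X = [ffun j => s%:C *: X j]); last by apply/ffunP => j; rewrite !ffunE.
by have := ampl_leZ s%:C hX; rewrite rn_real ger0_norm.
Qed.

Section LinearForm.
Variables (d1 d2 : nat) (T : forall n, {linear mtuple R d1 n -> mtuple R d2 n}).
Hypothesis T_dsum : forall n m (X : mtuple R d1 n) (Y : mtuple R d1 m),
  T _ (tdsum X Y) = tdsum (T _ X) (T _ Y).
Hypothesis T_conj : forall n (S : 'M[C]_n.+1) (X : mtuple R d1 n), S \in unitmx ->
  T _ (tconj S X) = tconj S (T _ X).

Definition one_tuple n (j : 'I_d1) (M : 'M[C]_n.+1) : mtuple R d1 n :=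
  [ffun k => (k == j)%:R *: M].

Definition linear_form_mx : 'M[C]_(d2, d1) :=
  \matrix_(i, j) T 0 (one_tuple j 1) i 0 0.

Lemma one_tuple_linear n j a (M N : 'M[C]_n.+1) :
  one_tuple j (a *: M + N) = a *: one_tuple j M + one_tuple j N.
Proof. by apply/ffunP => k; rewrite !ffunE scalerDr !scalerA mulrC. Qed.

Lemma sum_one_tuple n (X : mtuple R d1 n) : X = \sum_j one_tuple j (X j).
Proof.
apply/ffunP => k; rewrite sum_ffunE (bigD1 k) //= ffunE eqxx scale1r big1 ?addr0 //.
by move=> j jk; rewrite ffunE eq_sym (negbTE jk) scale0r.
Qed.

Lemma one_tuple_dsum n m j (M : 'M[C]_n.+1) (N : 'M[C]_m.+1) :
  one_tuple j (dsum M N) = tdsum (one_tuple j M) (one_tuple j N).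
Proof. by apply/ffunP => k; rewrite !ffunE dsumZ. Qed.

Lemma one_tuple_conj n j (S M : 'M[C]_n.+1) :
  one_tuple j (invmx S *m M *m S) = tconj S (one_tuple j M).
Proof. by apply/ffunP => k; rewrite !ffunE -scalemxAr -scalemxAl. Qed.

Lemma linear_form0 j (M : 'M[C]_1) :
  T 0 (one_tuple j M) = mxtup linear_form_mx (one_tuple j M).
Proof.
have -> : M = M 0 0 *: 1 + 0.
  by apply/matrixP => k l; rewrite !ord1 !mxE eqxx mulr1 addr0.
have o0 : one_tuple j (0 : 'M[C]_1) = 0 by apply/ffunP => k; rewrite !ffunE scaler0.
rewrite one_tuple_linear o0 addr0 !linearZ /=; congr (_ *: _).
apply/ffunP => i; rewrite ffunE (bigD1 j) //= big1 ?addr0 => [|k kj].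
  apply/matrixP => k l; rewrite !ord1 !mxE ffunE eqxx scale1r mxE eqxx mulr1.
  by [].
by rewrite ffunE (negbTE kj) scale0r scaler0.
Qed.

(* Off-diagonal blocks are reached from the idempotents [1, b; 0, 0] and [1, 0; c, 0], which are similar to [1, 0; 0, 0]. *)
Lemma linear_formE n (X : mtuple R d1 n) : T n X = mxtup linear_form_mx X.
Proof.
suff main j (M : 'M[C]_n.+1) : T n (one_tuple j M) = mxtup linear_form_mx (one_tuple j M).
  by rewrite [X in LHS]sum_one_tuple [X in RHS]sum_one_tuple !linear_sum; apply: eq_bigr.
elim: n j M {X} => [|n ih] j M.
  exact: linear_form0.
pose P (M : 'M[C]_n.+2) := T _ (one_tuple j M) = mxtup linear_form_mx (one_tuple j M).
have PD M1 M2 : P M1 -> P M2 -> P (M1 + M2).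
  rewrite /P -[M1]scale1r => h1 h2; rewrite one_tuple_linear !scale1r in h1 *.
  by rewrite !linearD /= h1 h2.
(* Splitting off a 1 by 1 block carries the induction and forces the same scalar matrix at every
   level. *)
have Pd (a : 'M[C]_1) (D : 'M[C]_n.+1) : P (dsum a D).
  have : T (0 + n.+1)%N (one_tuple j (dsum a D)) = mxtup linear_form_mx (one_tuple j (dsum a D)).
    by rewrite one_tuple_dsum T_dsum mxtup_dsum ih linear_form0.
  by [].
have PC (S N : 'M[C]_n.+2) : S \in unitmx -> P N -> P (invmx S *m N *m S).
  by move=> Su PN; rewrite /P one_tuple_conj T_conj // PN mxtup_conj.
pose blk (a : 'M[C]_1) b c (D : 'M[C]_n.+1) : 'M[C]_n.+2 := block_mx a b c D.
have blkM a b c D a' b' c' D' : blk a b c D *m blk a' b' c' D' =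
  blk (a *m a' + b *m c') (a *m b' + b *m D') (c *m a' + D *m c') (c *m b' + D *m D').
  by have := mulmx_block a b c D a' b' c' D'.
have blk1 : blk 1%:M 0 0 1%:M = 1%:M by rewrite /blk -scalar_mx_block.
have Pblk S S' : S' *m S = 1%:M -> P (S' *m blk 1%:M 0 0 0 *m S).
  move=> SS; have Su : S \in unitmx by have [] := mulmx1_unit SS.
  rewrite (_ : S' = invmx S); first by apply: PC => //; exact: Pd.
  by rewrite -[S']mulmx1 -(mulmxV Su) mulmxA SS mul1mx.
have Pb b : P (blk 1%:M b 0 0).
  have := Pblk (blk 1%:M b 0 1%:M) (blk 1%:M (- b) 0 1%:M).
  rewrite !blkM !(mulmx0, mul0mx, mulmx1, mul1mx, addr0, add0r, subrr, addrN, mulmx1).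
  by apply.
have Pc c : P (blk 1%:M 0 c 0).
  have := Pblk (blk 1%:M 0 (- c) 1%:M) (blk 1%:M 0 c 1%:M).
  rewrite !blkM !(mulmx0, mul0mx, mulmx1, mul1mx, addr0, add0r, subrr, addrN, mulmx1).
  by apply.
have blkD a b c D a' b' c' D' : blk a b c D + blk a' b' c' D' =
  blk (a + a') (b + b') (c + c') (D + D').
  by have := add_block_mx a b c D a' b' c' D'.
(* Each of the two idempotents adds 1 in the upper left corner, whence the two subtracted
   identities. *)
have -> : M = blk (@ulsubmx _ 1 n.+1 1 n.+1 M - 1%:M - 1%:M) 0 0 (@drsubmx _ 1 n.+1 1 n.+1 M) +
    (blk 1%:M (@ursubmx _ 1 n.+1 1 n.+1 M) 0 0 + blk 1%:M 0 (@dlsubmx _ 1 n.+1 1 n.+1 M) 0).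
  rewrite !blkD !add0r !addr0 addrA !subrK.
  exact: esym (@submxK _ 1 n.+1 1 n.+1 M).
apply: (PD); first exact: Pd.
by apply: (PD).
Qed.

End LinearForm.

Section Equiv.
Variables (H1 K1 H2 K2 : hilbertType R) (d1 d2 : nat).
Variables (Q1 : 'I_d1 -> {linear H1 -> K1}) (Q2 : 'I_d2 -> {linear H2 -> K2}).
Hypotheses (Q1_bounded : bounded_ops Q1) (Q2_bounded : bounded_ops Q2).

Lemma linearly_isomorphicP : linearly_isomorphic (ncball Q1) (ncball Q2) <->
  exists (A : 'M[C]_(d2, d1)) (B : 'M[C]_(d1, d2)),
    [/\ A *m B = 1%:M, B *m A = 1%:M, maps_ball Q2 Q1 A & maps_ball Q1 Q2 B].
Proof.
split=> [[L [[Ld Lc] Lb LT]]|[A [B [AB BA hA hB]]]]; last first.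
  exists (fun n X => ball_pt (hA _ _ (ball_valP X))); split.
  - split=> [n m X Y Z e|n S X Y Su e].
      by apply: etrans (mxtup_dsum _ _ _); rewrite -e.
    by apply: etrans (mxtup_conj _ _ _); rewrite -e.
  - move=> n; exists (fun Y => ball_pt (hB _ _ (ball_valP Y))) => X; apply: ball_val_inj.
      by rewrite [LHS](mxtup_mul B A) BA mxtup1.
    by rewrite [LHS](mxtup_mul A B) AB mxtup1.
  - by move=> n; exists (mxtup A).
pose T n := projT1 (cid (LT n)).
have hT n (X : ncball Q1 (n := n)) : set_val (L n X) = T n (set_val X).
  exact: (projT2 (cid (LT n))).
(* [L] respects direct sums only inside the ball: both tuples are scaled into it by a common factor,
   which linearity of [T] removes afterwards. *)
have T_dsum n m (X : mtuple R d1 n) (Y : mtuple R d1 m) :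
    T _ (tdsum X Y) = tdsum (T _ X) (T _ Y).
  have [t t0 ht] := ball_absorbing X Q1_bounded.
  have [s s0 hs] := ball_absorbing Y Q1_bounded.
  pose r := Num.min t s; have r0 : 0 < r by rewrite lt_min t0.
  have hX : ncball Q1 (r%:C *: X) by apply: ht; rewrite ?ge_min ?lexx // ltW.
  have hY : ncball Q1 (r%:C *: Y) by apply: hs; rewrite ?ge_min ?lexx ?orbT // ltW.
  have := Ld _ _ (ball_pt hX) (ball_pt hY) (ball_pt (ncball_dsum hX hY)) erefl.
  rewrite !hT !ball_ptE tdsumZ !linearZ /= tdsumZ => /(congr1 (fun Z => (r%:C)^-1 *: Z)).
  rewrite !scalerA mulVf ?scale1r //.
  by rewrite -[0]/(0%:C) (inj_eq (@complexI _)) gt_eqF.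
have T_conj n (S : 'M[C]_n.+1) (X : mtuple R d1 n) : S \in unitmx ->
    T _ (tconj S X) = tconj S (T _ X).
  move=> Su.
  have [t t0 ht] := ball_absorbing X Q1_bounded.
  have [s s0 hs] := ball_absorbing (tconj S X) Q1_bounded.
  pose r := Num.min t s; have r0 : 0 < r by rewrite lt_min t0.
  have hX : ncball Q1 (r%:C *: X) by apply: ht; rewrite ?ge_min ?lexx // ltW.
  have hY : ncball Q1 (r%:C *: tconj S X) by apply: hs; rewrite ?ge_min ?lexx ?orbT // ltW.
  have := Lc _ S (ball_pt hX) (ball_pt hY) Su.
  rewrite !hT !ball_ptE tconjZ !linearZ /= tconjZ => /(_ erefl).
  move=> /(congr1 (fun Z => (r%:C)^-1 *: Z)); rewrite !scalerA mulVf ?scale1r //.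
  by rewrite -[0]/(0%:C) (inj_eq (@complexI _)) gt_eqF.
pose A := linear_form_mx T.
have LA n X : set_val (L n X) = mxtup A (set_val X).
  by rewrite hT (linear_formE T_dsum T_conj).
have tens_vec (d : nat) (H K : hilbertType R) (Q : 'I_d -> {linear H -> K}) (c : 'cV[C]_d) :
    bounded_ops Q -> exists2 t : R, 0 < t & ncball Q (tens (fun j => t%:C * c j 0) (1%:M : 'M_1)).
  move=> Qb; have [t t0 ht] := ball_absorbing (tens (fun j => c j 0) (1%:M : 'M_1)) Qb.
  exists t => //; rewrite (_ : tens _ _ = t%:C *: tens (fun j => c j 0) 1%:M); last first.
    by apply/ffunP => j; rewrite !ffunE scalerA.
  by apply: ht => //; exact: ltW.
(* A multiple of a kernel vector is a scalar point of the ball with the same image as the origin,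
   and [L] is injective at level 0. *)
have injA (c : 'cV[C]_d1) : A *m c = 0 -> c = 0.
  move=> Ac; have [t t0 ht] := tens_vec _ _ _ _ c Q1_bounded.
  have /(congr1 (fun X => set_val X)) : ball_pt ht = ball_pt (ncball0 Q1 0).
    apply: (bij_inj (Lb 0%N)); apply: ball_val_inj; rewrite !LA !ball_ptE linear0.
    apply/ffunP => i; rewrite !ffunE.
    move/colP/(_ i): Ac; rewrite !mxE => Aci.
    rewrite -[RHS](scale0r (t%:C *: 1%:M)) -Aci scaler_suml; apply: eq_bigr => j _.
    by rewrite ffunE !scalerA mulrA mulrAC.
  rewrite !ball_ptE => /ffunP h0; apply/colP => j.
  have := h0 j; rewrite !ffunE => /matrixP/(_ 0 0); rewrite !mxE mulr1 => /eqP.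
  rewrite mulf_eq0 -[0]/(0%:C) (inj_eq (@complexI _)) gt_eqF //= => /eqP ->.
  by [].
have [B BA] : exists B : 'M[C]_(d1, d2), B *m A = 1%:M.
  have /row_freeP[B' hB'] : row_free A^T.
    rewrite -kermx_eq0; apply/rowV0P => v /sub_kermxP vA.
    apply: trmx_inj; rewrite trmx0; apply: injA.
    by apply: trmx_inj; rewrite trmx_mul trmxK trmx0.
  by exists B'^T; apply: trmx_inj; rewrite trmx_mul trmxK trmx1.
(* The left inverse is two-sided because [A] is onto: every vector has a multiple in the second
   ball, and [L] is onto at level 0. *)
have AB : A *m B = 1%:M.
  have surj (w : 'cV[C]_d2) : exists c : 'cV[C]_d1, A *m c = w.
    have [t t0 ht] := tens_vec _ _ _ _ w Q2_bounded.
    have [L' _ LK] := Lb 0%N; pose X := L' (ball_pt ht).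
    exists (\col_j ((t%:C)^-1 * set_val X j 0 0)).
    have := LA _ X; rewrite /X LK ball_ptE -/X => /ffunP e.
    apply/colP => i; have /matrixP/(_ 0 0) := e i.
    rewrite !ffunE !mxE mulr1 summxE => e'.
    have tN : t%:C != 0 by rewrite -[0]/(0%:C) (inj_eq (@complexI _)) gt_eqF.
    apply: (mulfI tN); rewrite e' mulr_sumr; apply: eq_bigr => j _.
    by rewrite !mxE mulrCA mulVKf.
  apply/matrixP => i j; have [c hc] := surj (delta_mx j 0).
  have : (A *m B) *m delta_mx j 0 = delta_mx j 0 :> 'cV_d2.
    by rewrite -hc -mulmxA (mulmxA B) BA mul1mx.
  by rewrite -colE => /colP/(_ i); rewrite !mxE eqxx andbT.
exists A, B; split=> //.
  move=> n X hX; rewrite -[X](ball_ptE hX) -LA; exact: ball_valP.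
move=> n Y hY; have [L' _ LK] := Lb n.
have : Y = mxtup A (set_val (L' (ball_pt hY))) by rewrite -LA LK.
by move=> ->; rewrite mxtup_mul BA mxtup1; exact: ball_valP.
Qed.

End Equiv.

End LinearIso.

Lemma mx_eq_eps (R : realType) n (A B : 'M[R[i]]_n.+1) (c : R) : 0 < c ->
  (forall e, 0 < e -> mx_le (A - B) (c * e)) -> A = B.
Proof.
move=> c0 h; apply/matrixP => i j; apply/eqP; rewrite -subr_eq0; apply/eqP/rn_eq0.
apply/eqP; rewrite eq_le rn_ge0 andbT; apply/ler_addgt0Pl => e e0; rewrite addr0.
have := h (e / c) (divr_gt0 e0 c0) => /(mx_le_entry i j); rewrite mulrC divfK ?gt_eqF //.
by rewrite !mxE.
Qed.

Lemma mx_le_dist (R : realType) n (A B P : 'M[R[i]]_n) e :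
  mx_le (A - P) e -> mx_le (B - P) e -> mx_le (A - B) (2 * e).
Proof.
move=> hA hB; rewrite (_ : A - B = (A - P) - (B - P)); last by rewrite opprB addrA subrK.
by rewrite mulr_natl mulr2n; apply: mx_leD; last exact: mx_leN.
Qed.

(** * Q(X) tested by scalar block matrices *)

Section Compression.
Variables (R : realType) (H K : hilbertType R) (d : nat).
Local Notation C := R[i].
Variable Q : 'I_d -> {linear H -> K}.

Definition compress (h : H) (g : K) : gfun (ncball Q) :=
  gfun_lin (fun j => hdot (Q j h) g).

Lemma compress_blockE n (X : mtuple R d n) m (e : nat -> H) (g : K)
    (v : 'I_m -> 'cV[C]_n.+1) p :
  (\sum_(w < m) (\sum_j (hdot (Q j (e w)) g : C) *: X j) *m v w) p 0 =
  hdot (ampl Q X (fun l => \sum_(w < m) v w l 0 *: e w) p) g.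
Proof.
rewrite summxE /ampl dot_suml.
under [RHS]eq_bigr do rewrite dot_suml.
rewrite (eq_bigr (fun w : 'I_m => \sum_j \sum_l
  (hdot (Q j (e w)) g : C) * X j p l * v w l 0)); last first.
  move=> w _; rewrite mulmx_suml summxE; apply: eq_bigr => j _.
  by rewrite mxE; apply: eq_bigr => l _; rewrite mxE.
rewrite exchange_big /=; apply: eq_bigr => j _.
rewrite exchange_big /=; apply: eq_bigr => l _.
rewrite dotZl linear_sum /= dot_suml mulr_sumr; apply: eq_bigr => w _.
by rewrite linearZ /= dotZl; ring.
Qed.

Lemma sum_vnorm_compress n (X : mtuple R d n) m (e : nat -> H) (g : nat -> K)
    (v : 'I_m -> 'cV[C]_n.+1) :
  \sum_(u < m) vnorm (\sum_(w < m) (\sum_j (hdot (Q j (e w)) (g u) : C) *: X j) *m v w) ^+ 2 =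
  \sum_p \sum_(u < m) rn (hdot (ampl Q X (fun l => \sum_(w < m) v w l 0 *: e w) p) (g u)) ^+ 2.
Proof.
rewrite exchange_big /=; apply: eq_bigr => u _; rewrite l2_sqr.
by apply: eq_bigr => p _; rewrite compress_blockE.
Qed.

(** These matrices over the algebra are what a complete contraction is tested on. In coordinates
    along [e] and [g] they are compressions of Q(X): Bessel's inequality controls the output and
    orthogonality the input. *)
Lemma compress_norm m (e : nat -> H) (g : nat -> K) :
  orthonormal_or_zero e -> orthonormal_or_zero g ->
  (gfun_mxnorm (fun u w : 'I_m => compress (e w) (g u)) <= 1%:E)%E.
Proof.
move=> oe og; apply/gfun_mxnormP => // n X v; rewrite expr1n mul1r.
rewrite sum_vnorm_compress.
have /ncballP[c [c0 c1 hX]] := ball_valP X.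
have := hX (fun l => \sum_(w < m) v w l 0 *: e w); rewrite l2_leE // => hl.
apply: le_trans (le_trans hl _).
  by apply: ler_sum => p _; exact: bessel.
apply: (@le_trans _ _ (\sum_l rn (\sum_(w < m) v w l 0 *: e w) ^+ 2)).
  rewrite ler_piMl //; first by apply: sumr_ge0 => l _; rewrite sqr_ge0.
  by rewrite expr_le1 // ltW.
under [leRHS]eq_bigr do rewrite l2_sqr.
rewrite exchange_big /=; apply: ler_sum => l _.
exact: rn_ortho_sum_le.
Qed.

(* Gram-Schmidt bases of the spans of [h] and of its image compress the
   ampliation to a scalar block matrix without changing its norm at [h]. *)
Lemma ampl_le_compress n (X : mtuple R d n) :
  (forall (e : nat -> H) (g : nat -> K), orthonormal_or_zero e -> orthonormal_or_zero g ->
    block_le (fun u w : 'I_n.+1 => \sum_j (hdot (Q j (e w)) (g u) : C) *: X j) 1) ->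
  ampl_le Q X 1.
Proof.
move=> hX h; pose y := ampl Q X h.
have [e oe he] := gram_schmidt (fun l => h (inord l)) n.+1.
have [g og hg] := gram_schmidt (fun l => y (inord l)) n.+1.
pose v (w : 'I_n.+1) : 'cV[C]_n.+1 := \col_l hdot (h l) (e w).
have hv : (fun l => \sum_(w < n.+1) v w l 0 *: e w) = h.
  apply/funext => l; have := he l (ltn_ord l) n.+1 (leqnn _); rewrite inord_val => ->.
  by apply: eq_bigr => w _; rewrite mxE.
have := hX e g oe og v; rewrite sum_vnorm_compress hv expr1n !mul1r => hb.
rewrite -[leRHS]mul1r; apply: l2_le => //; rewrite expr1n mul1r.
have parseval (V : hilbertType R) (x : V) (b : nat -> V) : orthonormal_or_zero b ->
    x = \sum_(u < n.+1) hdot x (b u) *: b u ->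
    rn x ^+ 2 = \sum_(u < n.+1) rn (hdot x (b u) : C) ^+ 2.
  move=> ob hx; rewrite {1}hx rn_ortho_sum //; apply: eq_bigr => u _.
  by rewrite dot_ortho_norm.
rewrite (eq_bigr (fun p => \sum_(u < n.+1) rn (hdot (y p) (g u) : C) ^+ 2)); last first.
  move=> p _; apply: parseval => //.
  by have := hg p (ltn_ord p) n.+1 (leqnn _); rewrite inord_val.
apply: (le_trans hb); rewrite (eq_bigr (fun w : 'I_n.+1 => \sum_l rn (hdot (h l) (e w) : C) ^+ 2)).
  rewrite exchange_big /= le_eqVlt; apply/orP; left; apply/eqP; apply: eq_bigr => l _.
  rewrite -parseval //.
  by have := he l (ltn_ord l) n.+1 (leqnn _); rewrite inord_val.
by move=> w _; rewrite l2_sqr; apply: eq_bigr => l _; rewrite mxE.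
Qed.

End Compression.

(** * The nc map behind an isomorphism of algebras *)

Section Spectrum.
Variables (R : realType) (H1 K1 H2 K2 : hilbertType R) (d1 d2 : nat).
Local Notation C := R[i].
Variables (Q1 : 'I_d1 -> {linear H1 -> K1}) (Q2 : 'I_d2 -> {linear H2 -> K2}).
Hypotheses (Q1_indep : lin_indep Q1) (Q2_indep : lin_indep Q2).
Variables (Phi : gfun (ncball Q1) -> gfun (ncball Q2)) (Psi : gfun (ncball Q2) -> gfun (ncball Q1)).
Hypothesis iso : iso_pair Phi Psi.

(* The nc map between the balls that induces [Phi] by composition. *)
Definition spec n (Y : ncball Q2 (n := n)) : mtuple R d1 n :=
  [ffun j => Phi (gfun_var j) Y].

(** [Phi 1] is a left unit for [Phi (Psi 1)], which is 1. *)
Lemma Phi_one : Phi (gfun_cst 1) = gfun_cst 1.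
Proof.
case: iso => [[PA _ _ PM _] [SA _ _ _ _] PK SK].
have A1 := Aalg_cst Q1_indep 1; have A2 := Aalg_cst Q2_indep 1.
have one_mul d (Om : graded_set R d) (f : gfun Om) : gfun_mul (fun n X => 1%:M) f = f.
  by apply: gfunP => n X; rewrite /gfun_mul mul1mx.
have mul_one d (Om : graded_set R d) (f : gfun Om) : gfun_mul f (fun n X => 1%:M) = f.
  by apply: gfunP => n X; rewrite /gfun_mul mulmx1.
have : gfun_mul (Phi (gfun_cst 1)) (Phi (Psi (gfun_cst 1))) = Phi (Psi (gfun_cst 1)).
  by rewrite -(PM _ _ A1 (SA _ A2)); congr Phi; exact: one_mul.
by rewrite (SK _ A2); exact: etrans (esym (mul_one _ _ _)).
Qed.

Lemma Phi_poly p n (Y : ncball Q2 (n := n)) :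
  Phi (ncpoly_fun _ p) Y = ncpoly_eval p (spec Y).
Proof.
case: iso => [[_ PD PZ PM _] _ _ _].
have Aw (w : seq 'I_d1) : Aalg (ncball Q1) (fun n X => \prod_(j <- w) set_val X j).
  exact: (Aalg_is_poly Q1_indep (is_poly_word R w)).
have Pw (w : seq 'I_d1) : Phi (fun n X => \prod_(j <- w) set_val X j) Y = \prod_(j <- w) spec Y j.
  elim: w => [|j w ih].
    rewrite big_nil (_ : (fun _ _ => _) = gfun_cst 1) ?Phi_one //.
    by apply: gfunP => k X; rewrite big_nil.
  rewrite (_ : (fun _ _ => _) = gfun_mul (gfun_var j) (fun n X => \prod_(j <- w) set_val X j)).
    by rewrite PM //; [rewrite big_cons ffunE -ih|exact: Aalg_var].
  by apply: gfunP => k X; rewrite big_cons.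
have As (s : seq (seq 'I_d1)) :
    Aalg (ncball Q1) (fun n X => \sum_(w <- s) p w *: \prod_(j <- w) set_val X j).
  apply: (Aalg_is_poly Q1_indep (F := fun n X => \sum_(w <- s) p w *: \prod_(j <- w) X j)).
  by apply: is_poly_sum => w; apply/is_polyZ/is_poly_word.
rewrite /ncpoly_fun /ncpoly_eval; elim: (enum_fset (finsupp p)) => [|w s ih].
  rewrite big_nil (_ : (fun _ _ => _) = gfun_scale 0 (gfun_cst 1)).
    by rewrite PZ; [rewrite /gfun_scale scale0r|exact: Aalg_cst].
  by apply: gfunP => k X; rewrite big_nil /gfun_scale scale0r.
rewrite (_ : (fun _ _ => _) = gfun_add (gfun_scale (p w) (fun n X => \prod_(j <- w) set_val X j))
    (fun n X => \sum_(w <- s) p w *: \prod_(j <- w) set_val X j)).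
  rewrite PD; [|exact: Aalg_scale|exact: As].
  by rewrite PZ // big_cons /gfun_add ih /gfun_scale Pw.
by apply: gfunP => k X; rewrite big_cons.
Qed.

Lemma Phi_is_poly F n (Y : ncball Q2 (n := n)) : is_poly F ->
  Phi (fun n X => F n (set_val X)) Y = F n (spec Y).
Proof.
move=> [p hp]; rewrite hp -Phi_poly.
have -> : (fun n X => F n (set_val X)) = ncpoly_fun (ncball Q1) p by apply: gfunP => k X; exact: hp.
by [].
Qed.

Lemma Phi_le f c : 0 <= c -> Aalg (ncball Q1) f -> gfun_le f c -> gfun_le (Phi f) c.
Proof.
case: iso => [[_ _ _ _ PN] _ _ _] c0 Af fc.
have : (gfun_mxnorm (fun _ _ : 'I_1 => f) <= c%:E)%E.
  apply/gfun_mxnormP => // n X v; rewrite !big_ord1.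
  by rewrite -exprMn ler_pXn2r ?nnegrE ?mulr_ge0 ?l2_ge0 //; exact: fc.
move=> /(le_trans (PN _ _ (fun _ _ => Af))) /gfun_mxnormP-/(_ c0) h n X v.
have := h n X (fun=> v); rewrite !big_ord1.
by rewrite -exprMn ler_pXn2r ?nnegrE ?mulr_ge0 ?l2_ge0.
Qed.

Lemma Phi_sub_poly f p c n (Y : ncball Q2 (n := n)) : 0 <= c -> Aalg (ncball Q1) f ->
  (forall n (X : ncball Q1 (n := n)), mx_le (f n X - ncpoly_eval p (set_val X)) c) ->
  mx_le (Phi f Y - ncpoly_eval p (spec Y)) c.
Proof.
move=> c0 Af fp; have [[_ PD PZ _ _] _ _ _] := iso.
have Ap := Aalg_poly Q1_indep p.
have := @Phi_le (gfun_add f (gfun_scale (-1) (ncpoly_fun _ p))) c c0.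
rewrite (PD _ _ Af (Aalg_scale Q1_indep _ Ap)) (PZ _ _ Ap).
move=> /(_ (Aalg_add Q1_indep Af (Aalg_scale Q1_indep _ Ap))) h.
have := h _ n Y; rewrite /gfun_add /gfun_scale scaleN1r Phi_poly; apply.
by move=> k X; rewrite scaleN1r; exact: fp.
Qed.

(** For a polynomial [p] close to [f], both sides are close to [p] at [spec Y]: the left one since
    [Phi] is contractive, the right one since [spec Y] lies in the ball. At a boundary value of
    [spec], only the comparison [Phi_sub_poly] remains. *)
Lemma Phi_comp n (Y : ncball Q2 (n := n)) (hX : ncball Q1 (spec Y)) f :
  Aalg (ncball Q1) f -> Phi f Y = f n (ball_pt hX).
Proof.
move=> Af; apply: (@mx_eq_eps _ _ _ _ 2) => // e e0.
have /AalgP-/(_ Q1_indep)[_ /(_ e e0)[p hp]] := Af.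
have h1 := Phi_sub_poly Y (ltW e0) Af hp.
have h2 := hp _ (ball_pt hX).
exact: mx_le_dist h1 h2.
Qed.

(** Complete contractivity is essential here: [Phi] maps the matrices of compressions of norm at
    most 1 to matrices whose values at [Y] are the compressions of Q1 at [spec Y]. *)
Lemma spec_closed_ball n (Y : ncball Q2 (n := n)) : ampl_le Q1 (spec Y) 1.
Proof.
apply: ampl_le_compress => e g oe og.
have [[_ _ _ _ PN] _ _ _] := iso.
have := le_trans (PN _ _ (fun u w => Aalg_lin Q1_indep _)) (compress_norm Q1 n.+1 oe og).
move=> /gfun_mxnormP-/(_ ler01 n Y).
rewrite (_ : (fun _ _ => _) = (fun u w : 'I_n.+1 =>
  \sum_j (hdot (Q1 j (e w)) (g u) : C) *: spec Y j)) //.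
apply/funext => u; apply/funext => w.
exact: (Phi_is_poly Y (is_poly_lin (fun j => hdot (Q1 j (e w)) (g u)))).
Qed.

End Spectrum.

(** * Taylor coefficients along slices, Cauchy estimates, maximum principle *)

Section PowerSeries.
Variable R : realType.
Local Notation C := R[i].

Lemma geometric_sum_le (x : R) n : 0 <= x < 1 -> \sum_(k < n) x ^+ k <= (1 - x)^-1.
Proof.
move=> /andP[x0 x1]; have x1' : 0 < 1 - x by rewrite subr_gt0.
rewrite -[leRHS]mul1r ler_pdivlMr // mulrC.
have := subrX1 x n; have := exprn_ge0 n x0; set s := \sum_(i < n) _ => xn e.
have -> : (1 - x) * s = 1 - x ^+ n by rewrite -opprB mulNr -e opprB.
by rewrite lerBlDr lerDl.
Qed.

Lemma ler_div_half (a x : R) : 0 <= a -> x <= 1 / 2 -> a / (1 - x) <= 2 * a.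
Proof.
move=> a0 x2; have : 0 < 1 - x by lra.
by move=> ?; rewrite ler_pdivrMr //; nra.
Qed.

Lemma rn_tail_le (c : nat -> C) (z : C) b n m : 0 <= b -> rn z < 1 ->
  (forall k, (m <= k)%N -> rn (c k) <= b) ->
  rn (\sum_(k < n) c (m + k)%N * z ^+ (m + k)) <= b * rn z ^+ m / (1 - rn z).
Proof.
move=> b0 z1 hc; apply: (le_trans (rn_sum _ _ _)).
apply: (@le_trans _ _ (\sum_(k < n) b * rn z ^+ m * rn z ^+ k)).
  apply: ler_sum => k _; rewrite rnM rnX exprD mulrA !ler_wpM2r ?exprn_ge0 ?rn_ge0 //.
  by rewrite hc // leq_addr.
rewrite -mulr_sumr ler_wpM2l ?mulr_ge0 ?exprn_ge0 ?rn_ge0 //.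
by apply: geometric_sum_le; rewrite rn_ge0.
Qed.

Lemma horner_split (q : {poly C}) z m : exists n,
  q.[z] = \sum_(k < m) q`_k * z ^+ k + \sum_(k < n) q`_(m + k) * z ^+ (m + k).
Proof.
exists (size q); rewrite (@horner_coef_wide _ (m + size q)) ?leq_addl //.
by rewrite big_split_ord.
Qed.

Lemma horner_sub0_le (q : {poly C}) z b : 0 <= b -> rn z < 1 ->
  (forall k, (0 < k)%N -> rn q`_k <= b) ->
  rn (q.[z] - q`_0) <= b * rn z / (1 - rn z).
Proof.
move=> b0 z1 hq; have [n ->] := horner_split q z 1.
rewrite big_ord1 expr0 mulr1 addrAC subrr add0r.
by have := rn_tail_le (c := fun k => q`_k) n b0 z1 hq; rewrite expr1.
Qed.

(** The linear terms cancel, which leaves two tails of order 2; each is at most [2 * b * rn z ^+ 2]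
    by the geometric series. *)
Lemma horner_quarter_turn_le (q : {poly C}) z b : 0 <= b -> rn z <= 1 / 2 ->
  (forall k, rn q`_k <= b) ->
  rn ('i * (q.[z] - q`_0) - (q.['i * z] - q`_0)) <= 4 * b * rn z ^+ 2.
Proof.
move=> b0 z1 hq; have z1' : rn z < 1 by apply: le_lt_trans z1 _; lra.
have [n ->] := horner_split q z 2.
have -> : q.['i * z] = \sum_(k < 2) q`_k * ('i * z) ^+ k +
    \sum_(k < size q) q`_(2 + k) * ('i * z) ^+ (2 + k).
  by rewrite (@horner_coef_wide _ (2 + size q)) ?leq_addl // big_split_ord.
set t1 := \sum_(k < n) _; set t2 := \sum_(k < size q) _.
have h1 : rn t1 <= 2 * b * rn z ^+ 2.
  have := rn_tail_le (c := fun k => q`_k) n b0 z1' (fun k (_ : (2 <= k)%N) => hq k).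
  move=> /le_trans; apply; apply: le_trans (ler_div_half _ z1) _; last by rewrite mulrA.
  by rewrite mulr_ge0 ?sqr_ge0.
have iz : rn ('i * z) = rn z by rewrite rnM rn_i mul1r.
have h2 : rn t2 <= 2 * b * rn z ^+ 2.
  have := rn_tail_le (c := fun k => q`_k) (size q) b0 (z := 'i * z); rewrite iz.
  move=> /(_ 2 z1' (fun k (_ : (2 <= k)%N) => hq k)) /le_trans; apply.
  apply: le_trans (ler_div_half _ z1) _; last by rewrite mulrA.
  by rewrite mulr_ge0 ?sqr_ge0.
rewrite !big_ord_recl !big_ord0 /= /bump /= !expr0 !expr1 !mulr1 !addr0.
rewrite (_ : _ - _ = 'i * t1 - t2); last by ring.
apply: (le_trans (rnB _ _)); rewrite rnM rn_i mul1r.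
have -> : 4 * b * rn z ^+ 2 = 2 * b * rn z ^+ 2 + 2 * b * rn z ^+ 2 by ring.
exact: lerD.
Qed.

Lemma shift_expr N i (k : 'I_N.+1) : ((shift R N) ^+ i) k 0 = (k == i :> nat)%:R.
Proof.
elim: i k => [|i ih] k; first by rewrite expr0 mxE.
rewrite exprS mxE; have [iN|Ni] := ltnP i N.+1.
  rewrite (bigD1 (Ordinal iN)) //= big1 ?addr0 => [|l li]; first by rewrite ih !mxE eqxx mulr1.
  by rewrite ih (negbTE (_ : (l != i :> nat))) ?mulr0.
rewrite big1 => [|l _]; last by rewrite ih ltn_eqF ?mulr0 // (leq_trans (ltn_ord l)).
by rewrite ltn_eqF // (leq_trans (ltn_ord k)) // ltnW.
Qed.

Lemma horner_shift N (q : {poly C}) (k : 'I_N.+1) : (horner_mx (shift R N) q) k 0 = q`_k.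
Proof.
rewrite -[q in LHS]coefK poly_def linear_sum summxE.
rewrite (eq_bigr (fun i : 'I_(size q) => q`_i * (k == i :> nat)%:R)); last first.
  by move=> i _; rewrite linearZ /= rmorphXn /= horner_mx_X mxE shift_expr.
have [kq|qk] := ltnP k (size q); last first.
  rewrite nth_default // big1 // => i _.
  by rewrite gtn_eqF ?mulr0 // (leq_trans (ltn_ord i)).
rewrite (bigD1 (Ordinal kq)) //= eqxx mulr1 big1 ?addr0 // => i ik.
by rewrite (negbTE (_ : k != i :> nat)) ?mulr0 // eq_sym.
Qed.

End PowerSeries.

Section Slices.
Variables (R : realType) (H K : hilbertType R) (d : nat).
Local Notation C := R[i].
Variable Q : 'I_d -> {linear H -> K}.
Hypothesis Q_indep : lin_indep Q.
Implicit Types y : 'I_d -> C.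

(** The restriction of [p] to a complex line of scalar points. With a single variable left, ['X] may
    be specialised to a scalar or to the shift. *)
Definition slice (p : ncpoly R d) y0 y1 : {poly C} :=
  \sum_(w <- finsupp p) p w *: \prod_(j <- w) ((y0 j)%:P + y1 j *: 'X).

Definition pt y : mtuple R d 0 := tens y (1%:M : 'M_1).

Lemma slice_horner p y0 y1 z :
  ncpoly_eval p (pt (fun j => y0 j + z * y1 j)) = ((slice p y0 y1).[z])%:M.
Proof.
rewrite /slice horner_sum raddf_sum; apply: eq_bigr => w _.
rewrite /= hornerZ -scale_scalar_mx; congr (_ *: _).
elim: w => [|j w ih]; first by rewrite !big_nil hornerE.
rewrite !big_cons ih hornerM scalar_mxM ffunE scalemx1; congr (_%:M * _).
by rewrite !hornerE mulrC.
Qed.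

Lemma slice_shift p y0 y1 N :
  ncpoly_eval p [ffun j => tens y0 (1%:M : 'M_N.+1) j + tens y1 (shift R N) j] =
  horner_mx (shift R N) (slice p y0 y1).
Proof.
rewrite /slice linear_sum; apply: eq_bigr => w _; rewrite linearZ; congr (_ *: _).
elim: w => [|j w ih]; first by rewrite !big_nil rmorph1.
rewrite !big_cons ih rmorphM; congr (_ * _).
by rewrite !ffunE rmorphD /= horner_mx_C linearZ /= horner_mx_X scalemx1.
Qed.

(* Evaluating at the nilpotent tuple y0 + y1 (x) shift turns the Taylor
   coefficients of the slice into the first column of a contraction. *)
Lemma slice_coef_le p y0 y1 r0 r1 c N : 0 <= r0 -> 0 <= r1 -> r0 + r1 < 1 -> 0 <= c ->
  pencil_le Q y0 r0 -> pencil_le Q y1 r1 -> gfun_le (ncpoly_fun (ncball Q) p) c ->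
  \sum_(k < N.+1) rn (slice p y0 y1)`_k ^+ 2 <= c ^+ 2.
Proof.
move=> r00 r10 r01 c0 h0 h1 hp.
have hX : ncball Q [ffun j => tens y0 (1%:M : 'M_N.+1) j + tens y1 (shift R N) j].
  apply/ncballP; exists (r0 + r1); split=> //; first exact: addr_ge0.
  by apply: ampl_leD; [exact: ampl_le_tens1|exact: ampl_le_shift].
have := hp _ (ball_pt hX); rewrite /ncpoly_fun ball_ptE slice_shift.
move=> /(mx_le_col 0 c0); apply: le_trans; rewrite le_eqVlt; apply/orP; left; apply/eqP.
by apply: eq_bigr => k _; rewrite horner_shift.
Qed.

Lemma slice_coef_le1 p y0 y1 r0 r1 c k : 0 <= r0 -> 0 <= r1 -> r0 + r1 < 1 -> 0 <= c ->
  pencil_le Q y0 r0 -> pencil_le Q y1 r1 -> gfun_le (ncpoly_fun (ncball Q) p) c ->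
  rn (slice p y0 y1)`_k <= c.
Proof.
move=> r00 r10 r01 c0 h0 h1 hp.
rewrite -(ler_pXn2r (n := 2)) ?nnegrE ?rn_ge0 //.
apply: le_trans (slice_coef_le k r00 r10 r01 c0 h0 h1 hp).
rewrite (bigD1 ord_max) //= lerDl; by apply: sumr_ge0 => i _; rewrite sqr_ge0.
Qed.

(** The maximum principle in quantitative form: a constant coefficient nearly as large as [c] leaves
    no room in the sum of squares for the others. *)
Lemma slice_coef_le2 p y0 y1 r0 r1 c k : (0 < k)%N ->
  0 <= r0 -> 0 <= r1 -> r0 + r1 < 1 -> 0 <= c ->
  pencil_le Q y0 r0 -> pencil_le Q y1 r1 -> gfun_le (ncpoly_fun (ncball Q) p) c ->
  rn (slice p y0 y1)`_k ^+ 2 <= c ^+ 2 - rn (slice p y0 y1)`_0 ^+ 2.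
Proof.
case: k => // k _ r00 r10 r01 c0 h0 h1 hp; rewrite lerBrDl.
apply: le_trans (slice_coef_le k.+1 r00 r10 r01 c0 h0 h1 hp).
rewrite (bigD1 ord0) //= lerD2l (bigD1 ord_max) //= lerDl.
by apply: sumr_ge0 => i _; rewrite sqr_ge0.
Qed.

Definition val_at (f : gfun (ncball Q)) y (hy : ncball Q (pt y)) : C :=
  f 0%N (ball_pt hy) 0 0.

Lemma approx_val f e p y (hy : ncball Q (pt y)) :
  (forall n (X : ncball Q (n := n)), mx_le (f n X - ncpoly_eval p (set_val X)) e) ->
  rn (val_at f hy - ncpoly_eval p (pt y) 0 0) <= e.
Proof. by move=> /(_ _ (ball_pt hy))/(mx_le_entry 0 0); rewrite !mxE. Qed.

Lemma approx_le f e p c :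
  (forall n (X : ncball Q (n := n)), mx_le (f n X - ncpoly_eval p (set_val X)) e) ->
  gfun_le f c -> gfun_le (ncpoly_fun (ncball Q) p) (c + e).
Proof.
move=> hp hf n X; rewrite /ncpoly_fun -[ncpoly_eval p _](subKr (f n X)).
apply: mx_leD => //; exact/mx_leN.
Qed.

Lemma slice_val p y0 y1 z y : y = (fun j => y0 j + z * y1 j) ->
  ncpoly_eval p (pt y) 0 0 = (slice p y0 y1).[z].
Proof. by move=> ->; rewrite slice_horner mxE mulr1n. Qed.

Lemma slice_val0 p y0 y1 : ncpoly_eval p (pt y0) 0 0 = (slice p y0 y1)`_0.
Proof.
rewrite (@slice_val p y0 y1 0) ?horner_coef0 //.
by apply/funext => j; rewrite mul0r addr0.
Qed.

Section Estimates.
Variables (f : gfun (ncball Q)) (c : R).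
Hypotheses (Af : Aalg (ncball Q) f) (c0 : 0 <= c) (fc : gfun_le f c).

Lemma val_lipschitz y0 y1 r0 r1 z y (hy0 : ncball Q (pt y0)) (hy : ncball Q (pt y)) :
  0 <= r0 -> 0 <= r1 -> r0 + r1 < 1 -> pencil_le Q y0 r0 -> pencil_le Q y1 r1 ->
  rn z <= 1 / 2 -> y = (fun j => y0 j + z * y1 j) ->
  rn (val_at f hy - val_at f hy0) <= 2 * c * rn z.
Proof.
move=> r00 r10 r1' h0 h1 z2 ey; apply/ler_addgt0Pr => e e0.
(* Two thirds pay for the approximation at the two points, one for the enlarged bound [c + e / 3],
   since [2 * rn z <= 1]. *)
have e3 : 0 < e / 3 by rewrite divr_gt0.
have /AalgP-/(_ Q_indep)[_ /(_ _ e3)[p hp]] := Af.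
have := approx_val hy hp; have := approx_val hy0 hp.
rewrite (slice_val p ey) (slice_val0 p y0 y1).
set q := slice p y0 y1 => a0 a1.
have ce : 0 <= c + e / 3 by rewrite addr_ge0 // ltW.
have hq k : rn q`_k <= c + e / 3.
  exact: slice_coef_le1 r00 r10 r1' ce h0 h1 (approx_le hp fc).
have z1 : rn z < 1 by apply: le_lt_trans z2 _; lra.
have := horner_sub0_le ce z1 (fun k _ => hq k).
set s := rn (_ - q`_0) => hs.
rewrite (_ : val_at f hy - val_at f hy0 =
  (val_at f hy - q.[z]) + (q.[z] - q`_0) - (val_at f hy0 - q`_0)); last by ring.
apply: (le_trans (rnB _ _)); have := rnD (val_at f hy - q.[z]) (q.[z] - q`_0).
rewrite -/s => hD.
have : (c + e / 3) * rn z / (1 - rn z) <= 2 * (c + e / 3) * rn z.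
  apply: le_trans (ler_div_half _ z2) _; last by rewrite mulrA.
  by rewrite mulr_ge0 ?rn_ge0.
have := rn_ge0 z; nra.
Qed.

Lemma val_quarter_turn y0 y1 r0 r1 z y y' (hy0 : ncball Q (pt y0)) (hy : ncball Q (pt y))
    (hy' : ncball Q (pt y')) :
  0 <= r0 -> 0 <= r1 -> r0 + r1 < 1 -> pencil_le Q y0 r0 -> pencil_le Q y1 r1 ->
  rn z <= 1 / 2 -> y = (fun j => y0 j + z * y1 j) -> y' = (fun j => y0 j + 'i * z * y1 j) ->
  rn ('i * (val_at f hy - val_at f hy0) - (val_at f hy' - val_at f hy0)) <= 4 * c * rn z ^+ 2.
Proof.
move=> r00 r10 r1' h0 h1 z2 ey ey'; apply/ler_addgt0Pr => e e0.
(* Four fifths pay for the approximation errors, that at [y0] being counted twice, and one for the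
   enlarged bound, since [4 * rn z ^+ 2 <= 1]. *)
have e5 : 0 < e / 5 by rewrite divr_gt0.
have /AalgP-/(_ Q_indep)[_ /(_ _ e5)[p hp]] := Af.
have := approx_val hy hp; have := approx_val hy0 hp; have := approx_val hy' hp.
rewrite (slice_val p ey) (slice_val p ey') (slice_val0 p y0 y1).
set q := slice p y0 y1 => a2 a0 a1.
have ce : 0 <= c + e / 5 by rewrite addr_ge0 // ltW.
have hq k : rn q`_k <= c + e / 5.
  exact: slice_coef_le1 r00 r10 r1' ce h0 h1 (approx_le hp fc).
have := horner_quarter_turn_le ce z2 hq.
set s := 'i * (q.[z] - q`_0) - (q.['i * z] - q`_0) => hs.
set a := val_at f hy - q.[z] in a1; set b := val_at f hy0 - q`_0 in a0.
set g := val_at f hy' - q.['i * z] in a2.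
rewrite (_ : 'i * _ - _ = s + ('i * (a - b) - (g - b))); last by rewrite /s /a /b /g; ring.
have n1 := rnD s ('i * (a - b) - (g - b)); have n2 := rnB ('i * (a - b)) (g - b).
have n3 := rnB a b; have n4 := rnB g b; rewrite rnM rn_i mul1r in n2.
have z0 := rn_ge0 z; have : rn z ^+ 2 <= 1 / 4 by nra.
nra.
Qed.

End Estimates.

(** A function of norm at most 1 that is nearly unimodular at the origin has only small higher
    coefficients along a slice. The last term [2 * dl] pays for the polynomial approximation at the
    two points. *)
Lemma val_almost_constant f y1 r1 z dl y (hy0 : ncball Q (pt (fun=> 0))) (hy : ncball Q (pt y)) :
  Aalg (ncball Q) f -> gfun_le f 1 -> 0 <= r1 < 1 -> pencil_le Q y1 r1 -> rn z < 1 ->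
  y = (fun j => z * y1 j) -> 0 < dl <= 1 / 2 -> 1 - dl <= rn (val_at f hy0) ->
  rn (val_at f hy - val_at f hy0) <= Num.sqrt (6 * dl) / (1 - rn z) + 2 * dl.
Proof.
move=> Af f1 /andP[r10 r11] h1 z1 ey /andP[dl0 dl2] hf.
have /AalgP-/(_ Q_indep)[_ /(_ _ dl0)[p hp]] := Af.
have := approx_val hy hp; have := approx_val hy0 hp.
have ey' : y = (fun j => 0 + z * y1 j) by rewrite ey; apply/funext => j; rewrite add0r.
rewrite (slice_val p ey') (slice_val0 p (fun=> 0) y1).
set q := slice p _ y1 => a0 a1.
have d1 : 0 <= 1 + dl by lra.
have q0 : 1 - 2 * dl <= rn q`_0.
  have := rnD (val_at f hy0 - q`_0) q`_0; rewrite subrK; lra.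
have s0 := sqrtr_ge0 (6 * dl).
have hq k : (0 < k)%N -> rn q`_k <= Num.sqrt (6 * dl).
  (* The 6 comes from [(1 + dl) ^+ 2 - (1 - 2 * dl) ^+ 2 <= 6 * dl]. *)
  move=> k0; rewrite -(ler_pXn2r (n := 2)) ?nnegrE ?rn_ge0 // sqr_sqrtr; last by lra.
  have r01 : 0 + r1 < 1 by rewrite add0r.
  have := slice_coef_le2 k0 (lexx 0) r10 r01 d1 (pencil_le0 Q (lexx 0)) h1 (approx_le hp f1).
  rewrite -/q => /le_trans; apply; nra.
have := horner_sub0_le s0 z1 hq; set s := rn (_ - q`_0) => hs.
rewrite (_ : val_at f hy - val_at f hy0 =
  (val_at f hy - q.[z]) + (q.[z] - q`_0) - (val_at f hy0 - q`_0)); last by ring.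
apply: (le_trans (rnB _ _)); have := rnD (val_at f hy - q.[z]) (q.[z] - q`_0).
rewrite -/s => hD.
have : Num.sqrt (6 * dl) * rn z / (1 - rn z) <= Num.sqrt (6 * dl) / (1 - rn z).
  have z1w := ltW z1.
  by rewrite ler_wpM2r ?invr_ge0 ?subr_ge0 // ler_piMr.
lra.
Qed.

End Slices.

(** * Scalar points, rotations and composition of isomorphisms *)

Section Points.
Variables (R : realType) (H K : hilbertType R) (d : nat).
Local Notation C := R[i].
Variable Q : 'I_d -> {linear H -> K}.

Lemma origin : ncball Q (pt (fun=> 0)).
Proof. by apply: (@ncball_tens _ _ _ _ _ _ 0); [rewrite lexx ltr01|exact: pencil_le0]. Qed.

Lemma val_at_var j y (hy : ncball Q (pt y)) : val_at (gfun_var j) hy = y j.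
Proof. by rewrite /val_at /gfun_var ball_ptE ffunE !mxE mulr1. Qed.

Lemma mx1E (M : 'M[C]_1) : M = (M 0 0)%:M.
Proof. by apply/matrixP => i j; rewrite !ord1 mxE mulr1n. Qed.

Lemma pencil_entries : bounded_ops Q -> exists2 M : R, 0 < M &
  forall y e, 0 <= e -> (forall j, rn (y j) <= e) -> pencil_le Q y (M * e).
Proof.
move=> Qb; have [M M0 hM] := ops_bound Qb.
exists (d.+1%:R * M) => [|y e e0 hy h]; first by rewrite mulr_gt0.
apply: (le_trans (rn_sum _ _ _)).
apply: (@le_trans _ _ (\sum_(j < d) M * e * rn h)).
  apply: ler_sum => j _; rewrite rnZ -mulrA [leRHS]mulrCA.
  by rewrite ler_pM ?rn_ge0.
rewrite sumr_const card_ord -[leLHS]mulr_natl.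
have -> : d.+1%:R * M * e * rn h = d.+1%:R * (M * e * rn h) by ring.
by rewrite ler_wpM2r ?ler_nat // !mulr_ge0 ?rn_ge0 // ltW.
Qed.

Lemma maps_ball_scalar c : rn c <= 1 -> maps_ball Q Q (c%:M).
Proof.
move=> c1 n Y hY; have := ncballZ c1 hY; congr (ncball Q _).
apply/ffunP => i; rewrite !ffunE (bigD1 i) //= big1 ?addr0 => [|j ji].
  by rewrite mxE eqxx mulr1n.
by rewrite mxE eq_sym (negbTE ji) mulr0n scale0r.
Qed.

Lemma mxtup_scalar_pt (c : C) (y : 'I_d -> C) : mxtup (c%:M : 'M_d) (pt y) = pt (fun j => c * y j).
Proof.
apply/ffunP => i; rewrite !ffunE (bigD1 i) //= big1 ?addr0 => [|j ji].
  by rewrite mxE eqxx mulr1n ffunE scalerA.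
by rewrite mxE eq_sym (negbTE ji) mulr0n scale0r.
Qed.

Lemma val_at_rotate c (hc : maps_ball Q Q (c%:M)) f y (hy : ncball Q (pt y))
    (hy' : ncball Q (pt (fun j => c * y j))) :
  val_at (pullback hc f) hy = val_at f hy'.
Proof.
by rewrite /val_at /pullback; congr (f _ _ _ _); apply: ball_val_inj; rewrite [LHS]mxtup_scalar_pt.
Qed.

Hypothesis Q_indep : lin_indep Q.

Lemma rotation_iso c (hc : maps_ball Q Q (c%:M)) : rn c = 1 ->
  exists Rot', iso_pair (pullback hc) Rot'.
Proof.
move=> c1; have c0 : c != 0 by apply/eqP => c0; move: c1; rewrite c0 rn0 => /eqP; rewrite eq_sym oner_eq0.
have cV : rn c^-1 <= 1 by rewrite -(mulr1 (rn c^-1)) -[X in _ * X]c1 -rnM mulVf // rn1.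
exists (pullback (maps_ball_scalar cV)).
by apply: pullback_iso_pair => //; rewrite -scalar_mxM ?mulfV ?mulVf.
Qed.

End Points.

Section IsoComposition.
Variables (R : realType).

Lemma iso_pair_sym (H1 K1 H2 K2 : hilbertType R) d1 d2
  (Q1 : 'I_d1 -> {linear H1 -> K1}) (Q2 : 'I_d2 -> {linear H2 -> K2}) Phi Psi :
  @iso_pair R H1 K1 H2 K2 d1 d2 Q1 Q2 Phi Psi -> iso_pair Psi Phi.
Proof. by case. Qed.

Lemma iso_pair_comp (H1 K1 H2 K2 H3 K3 : hilbertType R) d1 d2 d3
  (Q1 : 'I_d1 -> {linear H1 -> K1}) (Q2 : 'I_d2 -> {linear H2 -> K2})
  (Q3 : 'I_d3 -> {linear H3 -> K3}) Phi Psi Phi' Psi' :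
  @iso_pair R H1 K1 H2 K2 d1 d2 Q1 Q2 Phi Psi ->
  @iso_pair R H2 K2 H3 K3 d2 d3 Q2 Q3 Phi' Psi' ->
  iso_pair (Phi' \o Phi) (Psi \o Psi').
Proof.
move=> [[PA PD PZ PM PN] [SA SD SZ SM SN] PK SK].
move=> [[PA' PD' PZ' PM' PN'] [SA' SD' SZ' SM' SN'] PK' SK'].
split; first (split=> /=).
- by move=> f Af; exact/PA'/PA.
- by move=> f g Af Ag; rewrite (PD _ _ Af Ag) (PD' _ _ (PA _ Af) (PA _ Ag)).
- by move=> a f Af; rewrite (PZ _ _ Af) (PZ' _ _ (PA _ Af)).
- by move=> f g Af Ag; rewrite (PM _ _ Af Ag) (PM' _ _ (PA _ Af) (PA _ Ag)).
- by move=> m F AF; apply: le_trans (PN _ _ AF); apply: PN' => j k; exact: PA.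
- split=> /=.
  + by move=> f Af; exact/SA/SA'.
  + by move=> f g Af Ag; rewrite (SD' _ _ Af Ag) (SD _ _ (SA' _ Af) (SA' _ Ag)).
  + by move=> a f Af; rewrite (SZ' _ _ Af) (SZ _ _ (SA' _ Af)).
  + by move=> f g Af Ag; rewrite (SM' _ _ Af Ag) (SM _ _ (SA' _ Af) (SA' _ Ag)).
  + by move=> m F AF; apply: le_trans (SN' _ _ AF); apply: SN => j k; exact: SA'.
- by move=> f Af /=; rewrite (PK' _ (PA _ Af)) PK.
- by move=> f Af /=; rewrite (SK _ (SA' _ Af)) SK'.
Qed.

End IsoComposition.

Section Image.
Variables (R : realType) (H1 K1 H2 K2 : hilbertType R) (d1 d2 : nat).
Local Notation C := R[i].
Variables (Q1 : 'I_d1 -> {linear H1 -> K1}) (Q2 : 'I_d2 -> {linear H2 -> K2}).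
Hypotheses (Q1_indep : lin_indep Q1) (Q2_indep : lin_indep Q2).
Variables (Phi : gfun (ncball Q1) -> gfun (ncball Q2)) (Psi : gfun (ncball Q2) -> gfun (ncball Q1)).
Hypothesis iso : iso_pair Phi Psi.

Definition img y (hy : ncball Q2 (pt y)) : 'I_d1 -> C := fun j => val_at (Phi (gfun_var j)) hy.

Lemma spec_pt y (hy : ncball Q2 (pt y)) : spec Phi (ball_pt hy) = pt (img hy).
Proof. by apply/ffunP => j; rewrite !ffunE scalemx1 [LHS]mx1E. Qed.

Lemma img_closed y (hy : ncball Q2 (pt y)) : pencil_le Q1 (img hy) 1.
Proof.
apply: pencil_leP => //; rewrite -[tens _ _]/(pt _) -spec_pt.
exact: spec_closed_ball iso _ _.
Qed.

Lemma img_comp y (hy : ncball Q2 (pt y)) (hx : ncball Q1 (pt (img hy))) f :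
  Aalg (ncball Q1) f -> val_at (Phi f) hy = val_at f hx.
Proof.
move=> Af; have hX : ncball Q1 (spec Phi (ball_pt hy)) by rewrite spec_pt.
rewrite /val_at (Phi_comp Q1_indep Q2_indep iso hX Af); congr (f _ _ _ _).
by apply: ball_val_inj; rewrite [LHS]spec_pt.
Qed.

Lemma img_back y (hy : ncball Q2 (pt y)) (hx : ncball Q1 (pt (img hy))) g :
  Aalg (ncball Q2) g -> val_at (Psi g) hx = val_at g hy.
Proof.
case: iso => [_ [SA _ _ _ _] _ SK] Ag.
by rewrite -(img_comp hx (SA _ Ag)) SK.
Qed.

Lemma img_lin y (hy : ncball Q2 (pt y)) c :
  val_at (Phi (gfun_lin c)) hy = \sum_j c j * img hy j.
Proof.
rewrite /val_at (Phi_is_poly Q1_indep Q2_indep iso (ball_pt hy) (is_poly_lin c)).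
by rewrite summxE; apply: eq_bigr => j _; rewrite mxE ffunE.
Qed.

End Image.

Lemma horner_lipschitz_at1 (R : realType) (q : {poly R[i]}) : exists2 M : R, 0 <= M &
  forall t : R, 0 <= t <= 1 -> rn (q.[t%:C] - q.[1]) <= M * (1 - t).
Proof.
have /factor_theorem[g hg] : root (q - q.[1]%:P) 1 by rewrite rootE !hornerE subrr.
exists (\sum_(k < size g) rn g`_k) => [|t /andP[t0 t1]].
  by apply: sumr_ge0 => k _; exact: rn_ge0.
have -> : q.[t%:C] - q.[1] = g.[t%:C] * (t%:C - 1).
  by have := congr1 (fun p => p.[t%:C]) hg; rewrite /= !hornerE.
have -> : t%:C - 1 = (t - 1)%:C :> R[i] by rewrite rmorphB.
rewrite rnM rn_real distrC ger0_norm ?subr_ge0 //.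
rewrite ler_wpM2r ?subr_ge0 // horner_coef; apply: (le_trans (rn_sum _ _ _)).
apply: ler_sum => k _; rewrite rnM rnX rn_real ger0_norm //.
by rewrite ler_piMr ?rn_ge0 // exprn_ile1.
Qed.

(** * The image of the origin is interior *)

Section BasePoint.
Variables (R : realType) (H1 K1 H2 K2 : hilbertType R) (d1 d2 : nat).
Local Notation C := R[i].
Variables (Q1 : 'I_d1 -> {linear H1 -> K1}) (Q2 : 'I_d2 -> {linear H2 -> K2}).
Hypotheses (Q1_indep : lin_indep Q1) (Q2_indep : lin_indep Q2).
Hypothesis Q1_bounded : bounded_ops Q1.
Variables (Phi : gfun (ncball Q1) -> gfun (ncball Q2)) (Psi : gfun (ncball Q2) -> gfun (ncball Q1)).
Hypothesis iso : iso_pair Phi Psi.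

(* The character of the second algebra that corresponds to evaluation at the
   origin of the first ball; it may a priori lie on the boundary. *)
Let b : 'I_d2 -> C := img Psi (origin Q1).

(** [Phi] of a coordinate may have no value at [b], but a polynomial close to it is small there,
    because applying [Psi] returns the coordinate, which vanishes at the origin; continuity of the
    polynomial along the radius does the rest. The parameter is [s ^+ 2] so that the point is [s]
    times [s *: b]: the inner factor brings the direction into the ball, the outer one is the slice
    variable. *)
Lemma radial_limit j e : 0 < e -> exists2 s0 : R, 0 <= s0 < 1 &
  forall s (hs : ncball Q2 (pt (fun k => (s ^+ 2)%:C * b k))), s0 <= s < 1 ->
    rn (val_at (Phi (gfun_var j)) hs) <= e.
Proof.
move=> e0; have e3 : 0 < e / 3 by rewrite divr_gt0.
have [[PA _ _ _ _] _ PK _] := iso.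
have Ax := Aalg_var Q1_indep j; have APx := PA _ Ax.
have /AalgP-/(_ Q2_indep)[_ /(_ _ e3)[p hp]] := APx.
have := Phi_sub_poly Q2_indep Q1_indep (iso_pair_sym iso) (ball_pt (origin Q1)) (ltW e3) APx hp.
move=> /(mx_le_entry 0 0); rewrite (PK _ Ax) spec_pt -/b !mxE.
rewrite /gfun_var ball_ptE ffunE !mxE mul0r sub0r rnN => hb.
pose q := slice p (fun=> 0) b.
have qE t : q.[t] = ncpoly_eval p (pt (fun k => t * b k)) 0 0.
  rewrite (@slice_val _ _ p (fun=> 0) b t) //.
  by apply/funext => k; rewrite add0r.
have q1 : rn q.[1] <= e / 3.
  rewrite qE (_ : (fun k => _) = b) //; apply/funext => k; by rewrite mul1r.
have [M M0 hM] := horner_lipschitz_at1 q.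
have D0 : 0 < 2 * M + e / 3 by lra.
(* Since [1 - s ^+ 2 <= 2 * (1 - s)], this threshold makes the Lipschitz term at most [e / 3]. *)
exists (1 - (e / 3) / (2 * M + e / 3)) => [|s hs /andP[s0 s1]].
  apply/andP; split; first by rewrite subr_ge0 ler_pdivrMr // mul1r; lra.
  by rewrite ltrBlDr ltrDl divr_gt0.
have s00 : 0 <= s.
  by apply: le_trans s0; rewrite subr_ge0 ler_pdivrMr // mul1r; lra.
have s2 : 0 <= s ^+ 2 <= 1 by rewrite sqr_ge0 exprn_ile1 // ltW.
have := approx_val hs hp; rewrite -(qE (s ^+ 2)%:C).
have := hM _ s2; set v := val_at _ _; set w := q.[_]; set u := q.[1].
move=> h1 h2; have : M * (1 - s ^+ 2) <= e / 3.
  have : (1 - s) * (2 * M + e / 3) <= e / 3 by rewrite -ler_pdivlMr //; lra.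
  nra.
rewrite (_ : v = (v - w) + (w - u) + u); last by ring.
have := rnD ((v - w) + (w - u)) u; have := rnD (v - w) (w - u); rewrite -/u in q1; lra.
Qed.

(** If the pencil at [a] nearly attained norm 1 on some [h], a linear function of norm at most 1
    would be nearly unimodular at [a]. Its image under [Phi] would then be nearly constant between
    the origin and the point [s ^+ 2] times [b], where all coordinates, hence the function, are
    small. *)
Lemma base_point_norm_lt1 : exists r : R, [/\ 0 <= r, r < 1 & pencil_le Q1 (img Phi (origin Q2)) r].
Proof.
have [M M0 hM] := ops_bound Q1_bounded.
(* The linear function has [d1] coefficients of size at most [M], so coordinates of size [e] give it
   a value at most 1/4. *)
pose e := (4 * (M * d1%:R + 1))^-1.
have D0 : 0 < 4 * (M * d1%:R + 1) by have := ler0n R d1; nra.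
have e0 : 0 < e by rewrite invr_gt0.
have /choice[s0 hs0] : forall j : 'I_d1, exists s0 : R, 0 <= s0 < 1 /\
    forall s (hs : ncball Q2 (pt (fun k => (s ^+ 2)%:C * b k))), s0 <= s < 1 ->
    rn (val_at (Phi (gfun_var j)) hs) <= e.
  by move=> j; have [s h1 h2] := radial_limit j e0; exists s.
pose s := \big[Num.max/0]_j s0 j.
have ss j : s0 j <= s by exact: le_bigmax.
have s1 : s < 1 by apply/bigmax_lt => // j _; have [/andP[]] := hs0 j.
have s00 : 0 <= s by exact: bigmax_ge_id.
have bb : pencil_le Q2 b 1 := img_closed Q2_indep Q1_indep (iso_pair_sym iso) _.
have sb : pencil_le Q2 (fun k => s%:C * b k) s.
  by have := pencil_leZ s%:C bb; rewrite rn_real ger0_norm // mulr1.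
have hs : ncball Q2 (pt (fun k => (s ^+ 2)%:C * b k)).
  apply: (@ncball_tens _ _ _ _ _ _ s); first by rewrite s00.
  have s2 : 0 <= s ^+ 2 by rewrite sqr_ge0.
  have := pencil_leZ (s ^+ 2)%:C bb; rewrite rn_real ger0_norm // mulr1.
  by apply: pencil_le_mono; rewrite expr2 ler_piMl // ltW.
(* Chosen so that [Num.sqrt (6 * dl) / (1 - s)] is 1/10; with [dl <= 1 / 600] the variation cannot
   bridge the gap from [1 - dl] to 1/4. It depends on [s] only and is fixed before [h]. *)
pose dl := ((1 - s) / 10) ^+ 2 / 6.
have s1' : 0 < 1 - s by rewrite subr_gt0.
have dl0 : 0 < dl by rewrite divr_gt0 // exprn_gt0 // divr_gt0.
have sq : Num.sqrt (6 * dl) = (1 - s) / 10.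
  rewrite /dl (_ : 6 * (_ / 6) = ((1 - s) / 10) ^+ 2); last by field.
  by rewrite sqrtr_sqr ger0_norm // divr_ge0 // ltW.
have dl1 : dl <= 1 / 600 by rewrite /dl; nra.
exists (1 - dl); split; [lra|lra|move=> h].
rewrite leNgt; apply/negP => hlt.
set a := img Phi (origin Q2) in hlt *; set g := pencil Q1 a h in hlt *.
have h0 : 0 < rn h.
  rewrite lt_neqAle rn_ge0 andbT; apply/eqP => h0.
  have hz : h = 0 by apply: rn_eq0.
  by move: hlt; rewrite /g /pencil hz big1 ?rn0 ?mulr0 ?ltxx // => j _; rewrite linear0 scaler0.
have g0 : 0 < rn g by apply: le_lt_trans hlt; rewrite mulr_ge0 ?rn_ge0 //; lra.
pose k := (rn h * rn g)^-1.
have k0 : 0 <= k by rewrite invr_ge0 mulr_ge0 ?rn_ge0.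
(* Compression by [h] and by its own image [g], normalised: its value at [a] is [rn g / rn h]. *)
pose c (j : 'I_d1) : C := k%:C * hdot (Q1 j h) g.
have c_le j : rn (c j) <= M.
  rewrite rnM rn_real ger0_norm // mulrC ler_pdivrMr ?mulr_gt0 //.
  apply: (le_trans (cauchy_schwarz _ _)); rewrite mulrA ler_wpM2r ?rn_ge0 //; exact: hM.
have Af : Aalg (ncball Q1) (gfun_lin c) := Aalg_lin Q1_indep c.
have fle : gfun_le (gfun_lin (Q := Q1) c) 1.
  move=> n X; have /ncballP[r [r0 r1 hX]] := ball_valP X.
  have := mx_leZ k%:C (mx_le_compress h g r0 hX); rewrite rn_real ger0_norm //.
  rewrite (_ : _ *: \sum_j _ = gfun_lin c X); last first.
    by rewrite scaler_sumr; apply: eq_bigr => j _; rewrite scalerA.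
  by apply: mx_le_trans; rewrite /k mulrA mulVf ?mul1r ?ltW // mulf_neq0 // gt_eqF.
have [[PA _ _ _ _] _ _ _] := iso.
have val0 : 1 - dl <= rn (val_at (Phi (gfun_lin c)) (origin Q2)).
  rewrite (img_lin Q1_indep Q2_indep iso) -/a.
  rewrite (_ : \sum_j _ = k%:C * hdot g g); last first.
    rewrite {1}/g /pencil dot_suml mulr_sumr; apply: eq_bigr => j _.
    by rewrite dotZl mulrCA; exact: mulrC.
  rewrite dotE rnM !rn_real !ger0_norm ?sqr_ge0 // /k.
  rewrite (_ : _ * _ = rn g / rn h); last by field; rewrite !gt_eqF.
  by rewrite ler_pdivlMr // ltW.
have valb : rn (val_at (Phi (gfun_lin c)) hs) <= 1 / 4.
  rewrite (img_lin Q1_indep Q2_indep iso); apply: (le_trans (rn_sum _ _ _)).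
  apply: (@le_trans _ _ (\sum_(j < d1) M * e)).
    apply: ler_sum => j _; rewrite rnM ler_pM ?rn_ge0 //.
    by have [_ /(_ s hs)] := hs0 j; apply; rewrite ss.
  rewrite sumr_const card_ord -[leLHS]mulr_natr mulrAC ler_pdivrMr //.
  by have := ler0n R d1; nra.
have s01 : 0 <= s < 1 by rewrite s00.
have zs : rn (s%:C : C) < 1 by rewrite rn_real ger0_norm.
have dl12 : 0 < dl <= 1 / 2 by rewrite dl0 /=; lra.
have ye : (fun k => (s ^+ 2)%:C * b k) = (fun k => s%:C * (s%:C * b k)).
  by apply/funext => i; rewrite mulrA -rmorphM expr2.
have := val_almost_constant Q2_indep hs (PA _ Af) (Phi_le iso ler01 Af fle)
  s01 sb zs ye dl12 val0.
rewrite rn_real ger0_norm // sq mulrAC mulfV ?gt_eqF // mul1r.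
have := rnB (val_at (Phi (gfun_lin c)) hs) (val_at (Phi (gfun_lin c)) hs - val_at (Phi (gfun_lin c)) (origin Q2)).
rewrite opprB addrCA subrr addr0; lra.
Qed.

End BasePoint.

(** * Moving the base point towards the origin *)

Section Improvement.
Variables (R : realType) (H1 K1 H2 K2 : hilbertType R) (d1 d2 : nat).
Local Notation C := R[i].

Lemma mul_i (a b : R) : 'i * (a +i* b)%C = (- b +i* a)%C :> C.
Proof. by rewrite -complexiE; simpc. Qed.

(* The Cayley parametrisation 1 + z = (1 + i t)^2 / (1 + t^2) of the circle. *)
Lemma turning_point (t : R) : 0 <= t <= 1 / 2 -> exists z : C,
  [/\ rn (1 + z) = 1, rn z <= 2 * t & rn (1 + 'i * z) <= 1 - t].
Proof.
move=> /andP[t0 t2]; have D : 0 < 1 + t ^+ 2 by rewrite ltr_pwDl ?sqr_ge0.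
have D1 : 1 + t ^+ 2 != 0 by rewrite gt_eqF.
exists ((- 2 * t ^+ 2 / (1 + t ^+ 2)) +i* (2 * t / (1 + t ^+ 2)))%C; rewrite mul_i; split.
- apply/eqP; rewrite -(eqrXn2 (n := 2)) ?rn_ge0 // rn_sqr /= expr1n; apply/eqP.
  by rewrite add0r; field.
- rewrite -(ler_pXn2r (n := 2)) ?nnegrE ?rn_ge0 ?mulr_ge0 // rn_sqr /=.
  rewrite (_ : _ + _ = (2 * t) ^+ 2 / (1 + t ^+ 2)); last by field.
  by rewrite ler_pdivrMr // ler_peMr ?sqr_ge0 // lerDl sqr_ge0.
(* ['i * z] is about [- 2 * t], so the modulus drops by about [2 * t]; half of this drop absorbs the
   terms of higher order. *)
- rewrite -(ler_pXn2r (n := 2)) ?nnegrE ?rn_ge0 //; last by lra.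
  rewrite rn_sqr /= (_ : _ + _ = (1 + 5 * t ^+ 2 - 4 * t) / (1 + t ^+ 2)); last by field.
  rewrite ler_pdivrMr //; nra.
Qed.

Variables (Q1 : 'I_d1 -> {linear H1 -> K1}) (Q2 : 'I_d2 -> {linear H2 -> K2}).
Hypotheses (Q1_indep : lin_indep Q1) (Q2_indep : lin_indep Q2).
Hypotheses (Q1_bounded : bounded_ops Q1) (Q2_bounded : bounded_ops Q2).

(** [D] and [t0] precede the isomorphism so that one step size fits all isomorphisms near the
    infimum. They are built from bounds on coordinates and pencils and from the distance of [r0] to
    1. *)
Lemma base_point_improve (r0 : R) : 0 <= r0 < 1 -> exists D t0 : R, [/\ 0 < D, 0 < t0 &
  forall (Phi : gfun (ncball Q1) -> gfun (ncball Q2)) (Psi : gfun (ncball Q2) -> gfun (ncball Q1)) r t,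
    iso_pair Phi Psi -> 0 <= r <= r0 -> pencil_le Q1 (img Phi (origin Q2)) r -> 0 < t <= t0 ->
    exists (Phi' : gfun (ncball Q1) -> gfun (ncball Q2)) (Psi' : gfun (ncball Q2) -> gfun (ncball Q1)),
      iso_pair Phi' Psi' /\
      pencil_le Q1 (img Phi' (origin Q2)) ((1 - t) * r + D * t ^+ 2)].
Proof.
move=> /andP[r00 r01].
have [Cx Cx0 hCx] : exists2 Cx : R, 0 < Cx & forall j, gfun_le (gfun_var (Q := Q1) j) Cx.
  have [M M0 hM] := ball_coord_bound Q1_indep; exists (M + 1); first by rewrite ltr_wpDl.
  by move=> j n X; apply: mx_le_trans (hM j n X); rewrite lerDl.
have [Cy Cy0 hCy] : exists2 Cy : R, 0 < Cy & forall j, gfun_le (gfun_var (Q := Q2) j) Cy.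
  have [M M0 hM] := ball_coord_bound Q2_indep; exists (M + 1); first by rewrite ltr_wpDl.
  by move=> j n X; apply: mx_le_trans (hM j n X); rewrite lerDl.
have [M1 M10 hM1] := pencil_entries Q1_bounded.
have [M2 M20 hM2] := pencil_entries Q2_bounded.
(* The radius of slices at [a]: the direction is [k] times [a], so a displacement [z0] times [a] has
   slice variable [z0 / k]. *)
pose k := (1 - r0) / 2; have k0 : 0 < k by rewrite divr_gt0 // subr_gt0.
have kr : r0 + k < 1 by rewrite /k; lra.
pose D := M1 * (8 * Cx * M2 * (16 * Cy)) / k ^+ 2.
(* The first bound keeps the slice variable below 1/2, the second keeps the points [wa], [wb] and
   [w] in the ball of radius 1/4. *)
pose t0 := Num.min (k / 8) (k / (16 * M2 * Cy)).
have MC0 : 0 < 16 * M2 * Cy by rewrite !mulr_gt0.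
exists D, t0; split.
- by rewrite divr_gt0 ?exprn_gt0 // !mulr_gt0.
- by rewrite lt_min; apply/andP; split; rewrite divr_gt0.
move=> Phi Psi r t iso /andP[r_ge0 rr0] ha_le /andP[tp]; rewrite le_min => /andP[t8 t16].
pose T := t / k; have T0 : 0 < T by rewrite divr_gt0.
have T8 : T <= 1 / 8 by rewrite ler_pdivrMr //; lra.
have T16 : 16 * M2 * Cy * T <= 1.
  by rewrite mulrA ler_pdivrMr // mul1r -ler_pdivlMl // mulrC.
have [z0 [w1 z0t iz0]] : exists z : C,
    [/\ rn (1 + z) = 1, rn z <= 2 * t & rn (1 + 'i * z) <= 1 - t].
  by apply: turning_point; rewrite ltW //=; rewrite /k in t8; lra.
have iso' := iso_pair_sym iso.
have [[PA _ _ _ _] [SA _ _ _ _] _ _] := iso.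
set a := img Phi (origin Q2) in ha_le.
have r1 : r < 1 by apply: le_lt_trans rr0 r01.
have ha : ncball Q1 (pt a) by apply: ncball_tens ha_le; rewrite r_ge0.
pose y1 j := k%:C * a j.
have y1_le : pencil_le Q1 y1 k.
  have := pencil_leZ k%:C ha_le; rewrite rn_real gtr0_norm //.
  by apply: pencil_le_mono; rewrite ler_piMr ?ltW.
pose z := z0 / k%:C.
have kC : k%:C != 0 :> C by rewrite -[0]/(0%:C) (inj_eq (@complexI _)) gt_eqF.
have zk : z * k%:C = z0 by rewrite divfK.
have z_le : rn z <= 2 * T.
  have zkn : rn z * k = rn z0 by rewrite -zk rnM rn_real gtr0_norm.
  by rewrite -(ler_pM2r k0) zkn -mulrA divfK ?gt_eqF.
have z2 : rn z <= 1 / 2 by lra.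
pose ya j := (1 + z0) * a j; pose yb j := (1 + 'i * z0) * a j.
have yaE : ya = (fun j => a j + z * y1 j).
  by apply/funext => j; rewrite /ya /y1 mulrA zk mulrDl mul1r.
have ybE : yb = (fun j => a j + 'i * z * y1 j).
  by apply/funext => j; rewrite /yb /y1 mulrA -(mulrA 'i) zk mulrDl mul1r.
have hya : ncball Q1 (pt ya).
  apply: (@ncball_tens _ _ _ _ _ _ r); first by rewrite r_ge0.
  by have := pencil_leZ (1 + z0) ha_le; rewrite w1 mul1r.
have yb_le : pencil_le Q1 yb ((1 - t) * r).
  by apply: pencil_le_mono (pencil_leZ _ ha_le); rewrite ler_wpM2r.
have hyb : ncball Q1 (pt yb).
  apply: ncball_tens yb_le; rewrite mulr_ge0 //=; last by rewrite /k in t8; lra.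
  by apply: le_lt_trans r1; rewrite ler_piMl //; lra.
have Ga j : val_at (Psi (gfun_var j)) ha = 0.
  by rewrite (img_back Q1_indep Q2_indep iso ha (Aalg_var Q2_indep j)) val_at_var.
have rk : r + k < 1 by lra.
have ASy j : Aalg (ncball Q1) (Psi (gfun_var j)) by exact/SA/Aalg_var.
have SyC j : gfun_le (Psi (gfun_var j)) Cy.
  exact: (Phi_le iso' (ltW Cy0) (Aalg_var Q2_indep j) (hCy j)).
have APx j : Aalg (ncball Q2) (Phi (gfun_var j)) by exact/PA/Aalg_var.
have PxC j : gfun_le (Phi (gfun_var j)) Cx.
  exact: (Phi_le iso (ltW Cx0) (Aalg_var Q1_indep j) (hCx j)).
pose wa := img Psi hya; pose wb := img Psi hyb.
have wa_le j : rn (wa j) <= 2 * Cy * rn z.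
  have := val_lipschitz Q1_indep (ASy j) (ltW Cy0) (SyC j) ha hya r_ge0 (ltW k0) rk ha_le y1_le z2 yaE.
  by rewrite Ga subr0.
have riz : rn ('i * z) = rn z by rewrite rnM rn_i mul1r.
have wb_le j : rn (wb j) <= 2 * Cy * rn z.
  have iz2 : rn ('i * z) <= 1 / 2 by rewrite riz.
  have := val_lipschitz Q1_indep (ASy j) (ltW Cy0) (SyC j) ha hyb r_ge0 (ltW k0) rk ha_le y1_le iz2 ybE.
  by rewrite Ga subr0 riz.
have wab_le j : rn ('i * wa j - wb j) <= 4 * Cy * rn z ^+ 2.
  have := val_quarter_turn Q1_indep (ASy j) (ltW Cy0) (SyC j) ha hya hyb r_ge0 (ltW k0) rk ha_le y1_le z2 yaE ybE.
  by rewrite Ga !subr0.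
have z_ge0 := rn_ge0 z.
have small y : (forall j, rn (y j) <= 2 * Cy * rn z) -> pencil_le Q2 y (1 / 4).
  have Cz : 0 <= 2 * Cy * rn z by rewrite !mulr_ge0 // ltW.
  move=> hy; apply: pencil_le_mono (hM2 y _ Cz hy).
  have : M2 * Cy * rn z <= M2 * Cy * (2 * T) by rewrite ler_wpM2l // mulr_ge0 ?ltW.
  nra.
have q4 : 0 <= (1 / 4 : R) < 1 by apply/andP; split; lra.
have hwa : ncball Q2 (pt wa) by apply: ncball_tens q4 _; exact: small.
have hwb : ncball Q2 (pt wb) by apply: ncball_tens q4 _; exact: small.
pose w j := 'i * wa j.
have hw : ncball Q2 (pt w).
  by apply: ncball_tens q4 _; apply: small => j; rewrite rnM rn_i mul1r.
have Fwb j : val_at (Phi (gfun_var j)) hwb = yb j.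
  by rewrite (img_back Q2_indep Q1_indep iso' hwb (Aalg_var Q1_indep j)) val_at_var.
pose E := 16 * Cy * T ^+ 2; have E0 : 0 < E by apply: mulr_gt0; [exact: mulr_gt0|exact: exprn_gt0].
have wE j : rn (w j - wb j) <= E.
  apply: (le_trans (wab_le j)); rewrite /E.
  have : rn z ^+ 2 <= (2 * T) ^+ 2 by rewrite ler_pXn2r ?nnegrE // mulr_ge0 // ltW.
  nra.
(* [q] normalises [w - wb] to a direction of pencil norm at most 1/4, so that the Lipschitz estimate
   applies on the slice from [wb] with variable [q], which is of order [t ^+ 2]. *)
pose q := 4 * M2 * E; have q0 : 0 < q by apply: mulr_gt0 => //; exact: mulr_gt0.
have q2 : q <= 1 / 2.
  rewrite /q /E (_ : _ * _ = 4 * (16 * M2 * Cy * T) * T); last by ring.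
  have : 16 * M2 * Cy * T * T <= 1 * T by rewrite ler_wpM2r // ltW.
  lra.
pose v j := (q%:C)^-1 * (w j - wb j).
have v_le : pencil_le Q2 v (1 / 4).
  have := hM2 _ _ (ltW E0) wE => /(pencil_leZ (q^-1)%:C).
  rewrite rn_real ger0_norm ?invr_ge0 ?ltW //.
  rewrite (_ : q^-1 * (M2 * E) = 1 / 4); last by rewrite /q; field; rewrite !gt_eqF.
  by rewrite fmorphV.
have wv : w = (fun j => wb j + q%:C * v j).
  apply/funext => j; rewrite /v mulVKf ?subrKC //.
  by rewrite -[0]/(0%:C) (inj_eq (@complexI _)) gt_eqF.
have Fw j : rn (val_at (Phi (gfun_var j)) hw - yb j) <= 2 * Cx * q.
  have q44 : (1 / 4 + 1 / 4 : R) < 1 by lra.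
  have q4' : 0 <= (1 / 4 : R) by lra.
  have qz : rn (q%:C : C) <= 1 / 2 by rewrite rn_real gtr0_norm.
  have := val_lipschitz Q2_indep (APx j) (ltW Cx0) (PxC j) hwb hw q4' q4' q44
    (small _ wb_le) v_le qz wv.
  by rewrite Fwb rn_real gtr0_norm.
have Fw_le : pencil_le Q1 (img Phi hw) ((1 - t) * r + D * t ^+ 2).
  have Cq0 : 0 <= 2 * Cx * q by apply/ltW/mulr_gt0 => //; exact: mulr_gt0.
  have := pencil_leD yb_le (hM1 (fun j => val_at (Phi (gfun_var j)) hw - yb j) _ Cq0 Fw).
  rewrite (_ : (fun j => yb j + _) = img Phi hw); last first.
    by apply/funext => j; rewrite addrC subrK.
  apply: pencil_le_mono; rewrite le_eqVlt; apply/orP; left; apply/eqP; congr (_ + _).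
  by rewrite /q /E /D /T; field; rewrite gt_eqF.
have c1 : rn (1 + z0) <= 1 by rewrite w1.
have ci : rn ('i : C) <= 1 by rewrite rn_i.
pose m1 := maps_ball_scalar (Q := Q1) c1; pose m2 := maps_ball_scalar (Q := Q2) ci.
have [R1 iso1] := rotation_iso Q1_indep m1 w1.
have [R2 iso2] := rotation_iso Q2_indep m2 (rn_i R).
have isoF := iso_pair_comp (iso_pair_comp (iso_pair_comp (iso_pair_comp iso iso2) iso') iso1) iso.
(* Points travel in the opposite order: the origin goes to [a], then [ya], [wa], [w], and finally to
   the image of [w] under F. *)
exists (Phi \o (pullback m1 \o (Psi \o (pullback m2 \o Phi)))); eexists; split; first exact: isoF.
rewrite (_ : img _ _ = img Phi hw) //; apply/funext => j; rewrite /img /=.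
have [[RA1 _ _ _ _] _ _ _] := iso1; have [[RA2 _ _ _ _] _ _ _] := iso2.
have A2 := RA2 _ (APx j); have A3 := SA _ A2.
rewrite (img_comp Q1_indep Q2_indep iso ha (RA1 _ A3)).
rewrite (val_at_rotate m1 _ ha hya).
rewrite (img_comp Q2_indep Q1_indep iso' hwa A2).
by rewrite (val_at_rotate m2 _ hwa hw).
Qed.

End Improvement.

Section SmallBasePoint.
Variables (R : realType) (H1 K1 H2 K2 : hilbertType R) (d1 d2 : nat).
Local Notation C := R[i].
Variables (Q1 : 'I_d1 -> {linear H1 -> K1}) (Q2 : 'I_d2 -> {linear H2 -> K2}).
Hypotheses (Q1_indep : lin_indep Q1) (Q2_indep : lin_indep Q2).
Hypotheses (Q1_bounded : bounded_ops Q1) (Q2_bounded : bounded_ops Q2).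

Definition base_norm_le (r : R) : Prop :=
  exists (Phi : gfun (ncball Q1) -> gfun (ncball Q2)) (Psi : gfun (ncball Q2) -> gfun (ncball Q1)),
    iso_pair Phi Psi /\ pencil_le Q1 (img Phi (origin Q2)) r.

Lemma base_norm_le_small Phi Psi : iso_pair (Q1 := Q1) (Q2 := Q2) Phi Psi ->
  forall e : R, 0 < e -> base_norm_le e.
Proof.
move=> iso; have [r0 [r00 r01 hr0]] := base_point_norm_lt1 Q1_indep Q2_indep Q1_bounded iso.
pose S := [set r : R | 0 <= r /\ base_norm_le r].
have Sr0 : S r0 by split=> //; exists Phi, Psi.
have Slb : lbound S 0 by move=> r [].
have hiS : has_inf S by split; [exists r0|exists 0].
suff rho0 : inf S <= 0.
  move=> e e0; have [r [r_ge0 [Phi' [Psi' [iso' hr]]]] re] := @inf_adherent _ S e e0 hiS.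
  exists Phi', Psi'; split=> //; apply: pencil_le_mono hr.
  by apply: le_trans (ltW re) _; rewrite gerDr.
rewrite leNgt; apply/negP => rho0; set rho := inf S in rho0.
have r01' : 0 <= r0 < 1 by rewrite r00.
have [D [t0 [D0 t00 step]]] := base_point_improve Q1_indep Q2_indep Q1_bounded Q2_bounded r01'.
(* With [D * t <= rho / 4] and [r] within [t * rho / 4] of [rho], the gain [t * r] exceeds both
   together, and the new bound falls below [rho]. *)
pose t := Num.min t0 (Num.min (rho / (4 * D)) (1 / 2)).
have tp : 0 < t by rewrite !lt_min t00 /= !divr_gt0 // mulr_gt0.
have tt0 : t <= t0 by rewrite ge_min lexx.
have tD : D * t <= rho / 4.
  have : t <= rho / (4 * D) by rewrite !ge_min lexx orbT.
  by rewrite ler_pdivlMr ?mulr_gt0 // ler_pdivlMr //; lra.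
have t2 : t <= 1 / 2 by rewrite !ge_min lexx !orbT.
have eta0 : 0 < t * rho / 4 by rewrite !divr_gt0 // mulr_gt0.
(* The step is uniform only up to [r0]; if the approximating element exceeds [r0], then [r0] itself
   is closer to the infimum. *)
have [r [Sr rr0 r_lt]] : exists r, [/\ S r, r <= r0 & r < rho + t * rho / 4].
  have [r Sr re] := @inf_adherent _ S _ eta0 hiS.
  have [rr|rr] := leP r r0; first by exists r.
  by exists r0; split=> //; exact: lt_trans rr re.
have rho_r : rho <= r by apply: ge_inf => //; exists 0.
have [r_ge0 [Phi' [Psi' [iso' hr]]]] := Sr.
have r_in : 0 <= r <= r0 by rewrite r_ge0.
have t_in : 0 < t <= t0 by rewrite tp.
have [P2 [S2 [iso2 h2]]] := step _ _ _ _ iso' r_in hr t_in.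
have : rho <= (1 - t) * r + D * t ^+ 2.
  apply: ge_inf; first by exists 0.
  split; last by exists P2, S2.
  have : 0 <= (1 - t) * r by rewrite mulr_ge0 //; lra.
  by move=> /addr_ge0; apply; rewrite mulr_ge0 ?sqr_ge0 // ltW.
have : D * t ^+ 2 <= rho / 4 * t by rewrite expr2 mulrA ler_wpM2r // ltW.
nra.
Qed.

End SmallBasePoint.

(** * Derivatives through upper triangular jets *)

Section Jets.
Variables (R : realType) (H K : hilbertType R) (d : nat).
Local Notation C := R[i].

Definition jet_mx n (c : C) (M : 'M[C]_n.+1) : 'M[C]_((n + n.+1).+1) :=
  (block_mx c%:M M 0 c%:M : 'M_(n.+1 + n.+1)).

Lemma jet_mxD n c c' (M M' : 'M[C]_n.+1) : jet_mx c M + jet_mx c' M' = jet_mx (c + c') (M + M').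
Proof.
have := add_block_mx c%:M M 0 c%:M c'%:M M' 0 (c'%:M : 'M[C]_n.+1).
by rewrite addr0 -!raddfD.
Qed.

Lemma jet_mxZ n a c (M : 'M[C]_n.+1) : a *: jet_mx c M = jet_mx (a * c) (a *: M).
Proof.
have := scale_block_mx a c%:M M 0 (c%:M : 'M[C]_n.+1).
by rewrite scaler0 !scale_scalar_mx.
Qed.

Lemma jet_mxM n c c' (M M' : 'M[C]_n.+1) :
  jet_mx c M *m jet_mx c' M' = jet_mx (c * c') (c *: M' + c' *: M).
Proof.
have := mulmx_block c%:M M 0 c%:M c'%:M M' 0 (c'%:M : 'M[C]_n.+1).
by rewrite !mulmx0 !mul0mx addr0 !add0r -!scalar_mxM mul_scalar_mx mul_mx_scalar.
Qed.

Lemma jet_mx1 n : jet_mx 1 (0 : 'M[C]_n.+1) = 1.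
Proof. by rewrite /jet_mx -scalar_mx_block. Qed.

Lemma jet_mx_inj n c c' (M M' : 'M[C]_n.+1) : jet_mx c M = jet_mx c' M' -> M = M'.
Proof.
by move=> /(@eq_block_mx _ n.+1 n.+1 n.+1 n.+1)[].
Qed.

Lemma jet_mx_entry n c (M : 'M[C]_n.+1) i j :
  rn (jet_mx c M i j) <= rn c + \sum_k \sum_l rn (M k l).
Proof.
have S0 : 0 <= \sum_k \sum_l rn (M k l) by do 2!(apply: sumr_ge0 => ? _); exact: rn_ge0.
have hc (k l : 'I_n.+1) : rn ((c%:M : 'M_n.+1) k l) <= rn c + \sum_k \sum_l rn (M k l).
  rewrite mxE; case: eqP => _; rewrite ?mulr1n ?mulr0n ?rn0 ?addr_ge0 ?rn_ge0 //.
  by rewrite lerDl.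
rewrite /jet_mx -(splitK (i : 'I_(n.+1 + n.+1))) -(splitK (j : 'I_(n.+1 + n.+1))).
case: (fintype.split _) => k; case: (fintype.split _) => l /=.
- by rewrite (@block_mxEul _ n.+1 n.+1 n.+1 n.+1).
- rewrite (@block_mxEur _ n.+1 n.+1 n.+1 n.+1); apply: ler_wpDl; first exact: rn_ge0.
  rewrite (bigD1 k) //= (bigD1 l) //= -addrA lerDl addr_ge0 //.
    by apply: sumr_ge0 => *; exact: rn_ge0.
  by do 2!(apply: sumr_ge0 => ? _); exact: rn_ge0.
- by rewrite (@block_mxEdl _ n.+1 n.+1 n.+1 n.+1) mxE rn0 addr_ge0 ?rn_ge0.
- by rewrite (@block_mxEdr _ n.+1 n.+1 n.+1 n.+1).
Qed.

(** Jets multiply like dual numbers, so the corner obeys the Leibniz rule. As [a] is scalar it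
    commutes with [Y], and the derivative is a scalar combination of the [Y i], the same at every
    level. *)
Lemma jet_poly (p : ncpoly R d) (a : 'I_d -> C) : exists D : 'I_d -> C,
  forall n (Y : mtuple R d n),
    ncpoly_eval p (jet a Y) = jet_mx (ncpoly_eval p (pt a) 0 0) (\sum_i D i *: Y i).
Proof.
have word (w : seq 'I_d) : exists D : 'I_d -> C, forall n (Y : mtuple R d n),
    \prod_(j <- w) jet a Y j = jet_mx ((\prod_(j <- w) pt a j) 0 0) (\sum_i D i *: Y i).
  elim: w => [|j w [D h]].
    exists (fun=> 0) => n Y; rewrite !big_nil big1 ?mxE ?jet_mx1 // => i _.
    by rewrite scale0r.
  set c := (\prod_(j <- w) pt a j) 0 0 in h.
  exists (fun i => a j * D i + c * (i == j)%:R) => n Y.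
  rewrite !big_cons h ffunE; apply: etrans (jet_mxM _ _ _ _) _; congr jet_mx.
    by rewrite ffunE -scalerAl mul1r mxE.
  under [RHS]eq_bigr do rewrite scalerDl -!scalerA.
  rewrite big_split /= -!scaler_sumr; congr (_ + _ *: _).
  rewrite (bigD1 j) //= eqxx scale1r big1 ?addr0 // => i /negbTE ->.
  by rewrite scale0r.
rewrite /ncpoly_eval; elim: (enum_fset (finsupp p)) => [|w s [D h]].
  exists (fun=> 0) => n Y; rewrite !big_nil mxE big1 => [|i _]; last by rewrite scale0r.
  by rewrite -(scale0r (jet_mx 1 0)) jet_mxZ mul0r scaler0.
have [D' h'] := word w.
exists (fun i => p w * D' i + D i) => n Y.
rewrite !big_cons h h' jet_mxZ jet_mxD mxE mxE; congr jet_mx.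
under [RHS]eq_bigr do rewrite scalerDl -scalerA.
by rewrite big_split /= -scaler_sumr.
Qed.

Variable Q : 'I_d -> {linear H -> K}.
Hypotheses (Q_indep : lin_indep Q) (Q_bounded : bounded_ops Q).

(** Coordinate directions scaled to fit between [a] and the boundary; derivative matrices are read
    off on them. *)
Lemma small_unit_jet (a : 'I_d -> C) r : 0 <= r < 1 -> pencil_le Q a r ->
  exists2 t : R, 0 < t & forall i, exists c, [/\ 0 <= c, r + c < 1 &
    ampl_le Q (pt (fun j => t%:C * (j == i)%:R)) c].
Proof.
move=> /andP[r0 r1] ha; have [M M0 hM] := pencil_entries Q_bounded.
pose t := (1 - r) / 2 / M; have t0 : 0 < t by rewrite !divr_gt0 // subr_gt0.
exists t => // i; exists (M * t); split; first by rewrite mulr_ge0 ?ltW.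
  by rewrite /t mulrC divfK ?gt_eqF //; lra.
apply: ampl_le_tens1; first by rewrite mulr_ge0 ?ltW.
apply: hM => [|j]; first exact: ltW.
have tw := ltW t0.
by rewrite rnM rn_real gtr0_norm //; case: eqP => _; rewrite ?rn1 ?rn0 ?mulr1 ?mulr0.
Qed.

Lemma ncball_jet a n (Y : mtuple R d n) r c : 0 <= r -> 0 <= c -> r + c < 1 ->
  pencil_le Q a r -> ampl_le Q Y c -> ncball Q (jet a Y).
Proof.
move=> r0 c0 rc ha hY; apply/ncballP; exists (r + c); split=> //; first exact: addr_ge0.
exact: ampl_le_jet.
Qed.

(* [D] is the derivative of [f] at the scalar point [a]. *)
Lemma jet_Aalg f a r (ha : ncball Q (pt a)) : Aalg (ncball Q) f -> 0 <= r < 1 -> pencil_le Q a r ->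
  exists D : 'I_d -> C, forall n (Y : mtuple R d n) (hY : ncball Q (jet a Y)),
    f _ (ball_pt hY) = jet_mx (val_at f ha) (\sum_i D i *: Y i).
Proof.
move=> Af r01 har; have [t t0 ht] := small_unit_jet r01 har.
have /andP[r0 r1] := r01.
pose E i : mtuple R d 0 := pt (fun j => t%:C * (j == i)%:R).
have hE i : ncball Q (jet a (E i)).
  by have [c [c0 rc hc]] := ht i; exact: ncball_jet r0 c0 rc har hc.
have tC : t%:C != 0 :> C by rewrite -[0]/(0%:C) (inj_eq (@complexI _)) gt_eqF.
have rt : rn (t%:C : C) = t by rewrite rn_real gtr0_norm.
pose o0 : 'I_(1 + 1) := lshift 1 (0 : 'I_1); pose o1 : 'I_(1 + 1) := rshift 1 (0 : 'I_1).
(* The derivative is read from the corner of [f] at 2 by 2 jets; the derivatives of approximating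
   polynomials converge to it. *)
pose Df i := f _ (ball_pt (hE i)) o0 o1 / t%:C; exists Df => n Y hY.
set c := val_at f ha.
pose S := \sum_k \sum_l \sum_i rn (Y i k l).
have S0 : 0 <= S by do 3!(apply: sumr_ge0 => ? _); exact: rn_ge0.
apply/matrixP => i j; apply/eqP; rewrite -subr_eq0; apply/eqP/rn_eq0.
apply/eqP; rewrite eq_le rn_ge0 andbT; apply/ler_addgt0Pl => e e0; rewrite addr0.
(* One error from approximating [f] at the jet, one at [a], and [S / t] from the derivative. *)
pose K0 := 2 + S / t; have St0 : 0 <= S / t by rewrite divr_ge0 // ltW.
have K00 : 0 < K0 by rewrite ltr_pwDl.
pose e' := e / K0; have eK : 0 < e' by rewrite divr_gt0.
have /AalgP-/(_ Q_indep)[_ /(_ _ eK)[p hp]] := Af.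
have [Dp hD] := jet_poly p a.
have := approx_val ha hp; rewrite -/c; set cp := ncpoly_eval p _ 0 0 => hc.
have hDp k : rn (Df k - Dp k) <= e' / t.
  rewrite ler_pdivlMr // -[X in _ * X]rt -rnM mulrBl divfK //.
  have := hp _ (ball_pt (hE k)) => /(mx_le_entry o0 o1); rewrite ball_ptE hD.
  rewrite mxE; congr (rn (_ + _) <= _); rewrite mxE; congr (- _).
  rewrite /jet_mx [LHS](@block_mxEur _ 1 1 1 1) summxE (bigD1 k) //= big1 => [|l lk].
    by rewrite addr0 !mxE ffunE !mxE eqxx !mulr1.
  by rewrite !mxE ffunE !mxE (negbTE lk) mulr0 mul0r mulr0.
have hW := hp _ (ball_pt hY); rewrite ball_ptE hD in hW.
move: hW => /(mx_le_entry i j).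
rewrite (_ : f _ (ball_pt hY) i j - _ =
  (f _ (ball_pt hY) - jet_mx cp (\sum_k Dp k *: Y k)) i j +
  jet_mx (cp - c) (\sum_k (Dp k - Df k) *: Y k) i j); last first.
  rewrite (_ : jet_mx (cp - c) _ = jet_mx cp (\sum_k Dp k *: Y k) - jet_mx c (\sum_k Df k *: Y k)).
    by rewrite !mxE addrA subrK.
  rewrite -[- jet_mx c _]scaleN1r jet_mxZ jet_mxD mulN1r; congr jet_mx.
  rewrite scaleN1r -sumrB; apply: eq_bigr => k _; by rewrite scalerBl.
move=> h1; apply: (le_trans (rnD _ _)).
have := jet_mx_entry (cp - c) (\sum_k (Dp k - Df k) *: Y k) i j.
have h2 : \sum_k \sum_l rn ((\sum_i (Dp i - Df i) *: Y i) k l) <= e' / t * S.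
  rewrite /S mulr_sumr; apply: ler_sum => k _; rewrite mulr_sumr; apply: ler_sum => l _.
  rewrite summxE mulr_sumr; apply: (le_trans (rn_sum _ _ _)); apply: ler_sum => m _.
  by rewrite mxE rnM ler_wpM2r ?rn_ge0 // -rnN opprB.
have h3 : rn (cp - c) <= e' by rewrite -rnN opprB.
have eE : e' + (e' + e' / t * S) = e.
  rewrite (_ : _ + _ = e' * K0); first by rewrite divfK ?gt_eqF.
  by rewrite /K0 !mulrDr mulrA mulrAC; lra.
move=> h4; rewrite -eE; apply: lerD => //; apply: (le_trans h4); exact: lerD.
Qed.

End Jets.

Section DerivativePair.
Variable R : realType.
Local Notation C := R[i].

Section OneSide.
Variables (H1 K1 H2 K2 : hilbertType R) (d1 d2 : nat).
Variables (Q1 : 'I_d1 -> {linear H1 -> K1}) (Q2 : 'I_d2 -> {linear H2 -> K2}).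
Hypotheses (Q1_indep : lin_indep Q1) (Q2_indep : lin_indep Q2).
Hypotheses (Q1_bounded : bounded_ops Q1) (Q2_bounded : bounded_ops Q2).
Variables (Phi : gfun (ncball Q1) -> gfun (ncball Q2)) (Psi : gfun (ncball Q2) -> gfun (ncball Q1)).
Hypothesis iso : iso_pair Phi Psi.

Lemma spec_back n (Y : ncball Q2 (n := n)) (hX : ncball Q1 (spec Phi Y)) :
  spec Psi (ball_pt hX) = set_val Y.
Proof.
have [_ [SA _ _ _ _] _ SK] := iso.
apply/ffunP => i; have Ai := Aalg_var Q2_indep i.
by rewrite ffunE -(Phi_comp Q1_indep Q2_indep iso hX (SA _ Ai)) SK.
Qed.

Lemma spec_jet a r (ha : ncball Q2 (pt a)) : 0 <= r < 1 -> pencil_le Q2 a r ->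
  exists A : 'M[C]_(d1, d2), forall n (Y : mtuple R d2 n) (hY : ncball Q2 (jet a Y)),
    spec Phi (ball_pt hY) = jet (img Phi ha) (mxtup A Y).
Proof.
move=> r01 har; have [[PA _ _ _ _] _ _ _] := iso.
have /choice[D hD] : forall j : 'I_d1, exists D : 'I_d2 -> C,
    forall n (Y : mtuple R d2 n) (hY : ncball Q2 (jet a Y)),
    Phi (gfun_var j) (ball_pt hY) = jet_mx (val_at (Phi (gfun_var j)) ha) (\sum_i D i *: Y i).
  move=> j; have [D hD] := jet_Aalg Q2_indep Q2_bounded ha (PA _ (Aalg_var Q1_indep j)) r01 har.
  by exists D.
exists (\matrix_(j, i) D j i) => n Y hY; apply/ffunP => j; rewrite ffunE hD ffunE ffunE.
by under [in RHS]eq_bigr do rewrite mxE.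
Qed.

Lemma spec_jet_contractive n a (Y : mtuple R d2 n) (hY : ncball Q2 (jet a Y)) b X :
  spec Phi (ball_pt hY) = jet b X -> ampl_le Q1 X 1.
Proof.
move=> e; have := spec_closed_ball Q1_indep Q2_indep iso (ball_pt hY).
by rewrite e; exact: ampl_le_jet_corner.
Qed.

End OneSide.

Lemma jet_inj d n a a' (Y Y' : mtuple R d n) : jet a Y = jet a' Y' -> Y = Y'.
Proof.
move=> e; apply/ffunP => j; have := congr1 (fun Z : mtuple R d (n + n.+1) => Z j) e.
by rewrite !ffunE => /jet_mx_inj.
Qed.

Lemma mx_eq1_pt d (M : 'M[C]_d) :
  (forall i, exists2 u, u != 0 & mxtup M (pt (fun j => u * (j == i)%:R)) = pt (fun j => u * (j == i)%:R)) ->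
  M = 1%:M.
Proof.
move=> h; apply/matrixP => k i; have [u u0 /ffunP/(_ k)] := h i.
rewrite !ffunE (bigD1 i) //= big1 ?addr0 => [|j /negbTE ji]; last first.
  by rewrite ffunE ji mulr0 scale0r scaler0.
move=> /matrixP/(_ 0 0); rewrite ffunE !mxE !eqxx !mulr1 mulrC.
by move=> /(mulfI u0).
Qed.

Lemma mxtupZ d1 d2 (A : 'M[C]_(d2, d1)) n a (X : mtuple R d1 n) :
  mxtup A (a *: X) = a *: mxtup A X.
Proof. exact: linearZ. Qed.

Lemma pt_scale d (y : 'I_d -> C) a : pt (fun j => a * y j) = a *: pt y.
Proof. by apply/ffunP => j; rewrite !ffunE scalerA. Qed.

Lemma ampl_le_scale (H K : hilbertType R) d (Q : 'I_d -> {linear H -> K}) n (X : mtuple R d n) a c :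
  ampl_le Q X c -> ampl_le Q (a *: X) (rn a * c).
Proof.
move=> /(ampl_leZ a); congr (ampl_le _ _ _); by apply/ffunP => j; rewrite !ffunE.
Qed.

Variables (H1 K1 H2 K2 : hilbertType R) (d1 d2 : nat).
Variables (Q1 : 'I_d1 -> {linear H1 -> K1}) (Q2 : 'I_d2 -> {linear H2 -> K2}).
Hypotheses (Q1_indep : lin_indep Q1) (Q2_indep : lin_indep Q2).
Hypotheses (Q1_bounded : bounded_ops Q1) (Q2_bounded : bounded_ops Q2).
Variables (Phi : gfun (ncball Q1) -> gfun (ncball Q2)) (Psi : gfun (ncball Q2) -> gfun (ncball Q1)).
Hypothesis iso : iso_pair Phi Psi.

(** [A] and [B] are the derivatives of F at 0 and of G at [a]. Jets at 0 cost nothing, whereas a jet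
    at [a] lies in the ball only if [r + c < 1]; this asymmetry is the defect that vanishes with
    [r]. *)
Lemma derivative_pair r : 0 <= r < 1 -> pencil_le Q1 (img Phi (origin Q2)) r ->
  exists (A : 'M[C]_(d1, d2)) (B : 'M[C]_(d2, d1)), [/\ A *m B = 1%:M, B *m A = 1%:M,
    (forall n (Y : mtuple R d2 n), ncball Q2 Y -> ampl_le Q1 (mxtup A Y) 1) &
    (forall n (X : mtuple R d1 n) c, 0 <= c -> r + c < 1 -> ampl_le Q1 X c ->
       ampl_le Q2 (mxtup B X) 1)].
Proof.
move=> r01 har; have /andP[r0 r1] := r01; have iso' := iso_pair_sym iso.
set a := img Phi (origin Q2) in har.
have ha : ncball Q1 (pt a) by exact: ncball_tens har.
have z01 : 0 <= (0 : R) < 1 by rewrite lexx ltr01.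
have zle : pencil_le Q2 (fun=> 0) 0 by exact: pencil_le0.
have [A hA] := spec_jet Q1_indep Q2_indep Q2_bounded iso (origin Q2) z01 zle.
have [B hB] := spec_jet Q2_indep Q1_indep Q1_bounded iso' ha r01 har.
have Ga : img Psi ha = (fun=> 0).
  apply/funext => i; rewrite /img (img_back Q1_indep Q2_indep iso ha (Aalg_var Q2_indep i)).
  by rewrite val_at_var.
rewrite Ga in hB; rewrite -/a in hA.
have jet2 n (Y : mtuple R d2 n) : ncball Q2 Y -> ncball Q2 (jet (fun=> 0) Y).
  move=> /ncballP[c [c0 c1 hY]]; apply: (ncball_jet (r := 0) (c := c)) => //.
  by rewrite add0r.
have jet1 n (X : mtuple R d1 n) c : 0 <= c -> r + c < 1 -> ampl_le Q1 X c -> ncball Q1 (jet a X).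
  by move=> c0 rc hX; exact: ncball_jet r0 c0 rc har hX.
have cA n (Y : mtuple R d2 n) : ncball Q2 Y -> ampl_le Q1 (mxtup A Y) 1.
  move=> hY; exact: (spec_jet_contractive Q1_indep Q2_indep iso (hA _ _ (jet2 _ _ hY))).
have cB n (X : mtuple R d1 n) c : 0 <= c -> r + c < 1 -> ampl_le Q1 X c -> ampl_le Q2 (mxtup B X) 1.
  move=> c0 rc hX.
  exact: (spec_jet_contractive Q2_indep Q1_indep iso' (hB _ _ (jet1 _ _ _ c0 rc hX))).
exists A, B; split=> //; apply: mx_eq1_pt => i.
- have [t t0 ht] := small_unit_jet Q1_bounded r01 har.
  have [c [c0 rc hE]] := ht i; set E := pt _ in hE.
  (* [B] is only known to map into the closed ball; halving puts the image inside, where F may be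
     applied. *)
  pose s : C := (1 / 2 : R)%:C; have rs : rn s = 1 / 2 by rewrite rn_real ger0_norm //; lra.
  have s0 : s != 0 by apply/eqP => s0; move: rs; rewrite s0 rn0; lra.
  exists (s * t%:C).
    by rewrite mulf_neq0 // -[0]/(0%:C) (inj_eq (@complexI _)) gt_eqF.
  pose X := s *: E; rewrite (_ : pt _ = X); last first.
    by rewrite /X /E -pt_scale; congr pt; apply/funext => j; rewrite mulrA.
  have hX : ncball Q1 (jet a X).
    apply: (jet1 _ _ c) => //; apply: ampl_le_mono (ampl_le_scale s hE).
    by rewrite rs; lra.
  have hBX : ncball Q2 (mxtup B X).
    apply/ncballP; exists (1 / 2); split; [lra|lra|].
    have := ampl_le_scale s (cB _ _ _ c0 rc hE).
    by rewrite rs mulr1 /X mxtupZ.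
  have e := hB _ _ hX; have hS : ncball Q2 (spec Psi (ball_pt hX)) by rewrite e; exact: jet2.
  have := spec_back Q2_indep Q1_indep iso' hS.
  rewrite (_ : ball_pt hS = ball_pt (jet2 _ _ hBX)); last exact: ball_val_inj.
  by rewrite hA mxtup_mul => /jet_inj.
- have [t t0 ht] := small_unit_jet Q2_bounded z01 zle.
  have [c [c0 rc hE]] := ht i; set E := pt _ in hE; rewrite add0r in rc.
  have bE : ncball Q2 E by apply/ncballP; exists c.
  (* This factor brings the image under [A] to norm at most [(1 - r) / 2], so its jet at [a] is
     inside the ball. *)
  pose s : C := ((1 - r) / 2 : R)%:C.
  have rs : rn s = (1 - r) / 2 by rewrite rn_real ger0_norm //; lra.
  have s0 : s != 0 by apply/eqP => s0; move: rs; rewrite s0 rn0; lra.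
  exists (s * t%:C).
    by rewrite mulf_neq0 // -[0]/(0%:C) (inj_eq (@complexI _)) gt_eqF.
  pose Y := s *: E; rewrite (_ : pt _ = Y); last first.
    by rewrite /Y /E -pt_scale; congr pt; apply/funext => j; rewrite mulrA.
  have bY : ncball Q2 Y.
    apply/ncballP; exists (rn s * c); split; [by rewrite mulr_ge0 ?rn_ge0| |exact: ampl_le_scale].
    by apply: le_lt_trans rc; rewrite ler_piMl // rs; lra.
  have hY := jet2 _ _ bY.
  have hAY : ncball Q1 (jet a (mxtup A Y)).
    apply: (jet1 _ _ ((1 - r) / 2)); [lra|lra|].
    have := ampl_le_scale s (cA _ _ bE).
    by rewrite rs mulr1 /Y mxtupZ.
  have e := hA _ _ hY; have hS : ncball Q1 (spec Phi (ball_pt hY)) by rewrite e.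
  have := spec_back Q1_indep Q2_indep iso hS.
  rewrite (_ : ball_pt hS = ball_pt hAY); last exact: ball_val_inj.
  by rewrite hB mxtup_mul => /jet_inj.
Qed.

End DerivativePair.

(** * Limits of derivative pairs *)

Section Compactness.
Variable R : realType.

Lemma ultra_limit (U : set_system nat) (UU : UltraFilter U) (u : nat -> R) (M : R) :
  (forall k, `|u k| <= M) -> exists l, forall e, 0 < e -> U [set k | `|u k - l| < e].
Proof.
move=> hM; pose S := [set x : R | U [set k | x <= u k]].
have Sm : S (- M).
  by apply: filterS filterT => k _ /=; have := hM k; rewrite ler_norml => /andP[].
have SM : ubound S M.
  move=> x Sx; rewrite leNgt; apply/negP => Mx.
  have /filter_ex[k /=] := Sx; apply/negP; rewrite -ltNge; apply: le_lt_trans Mx.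
  by have := hM k; rewrite ler_norml => /andP[].
have hS : has_sup S by split; [exists (- M)|exists M].
exists (sup S) => e e0.
have [x Sx xe] := sup_adherent e0 hS.
have [Se|Se] := in_ultra_setVsetC [set k | sup S + e / 2 <= u k] UU.
  have : sup S + e / 2 <= sup S by apply: ub_le_sup => //; exists M.
  lra.
apply: filterS (filterI Sx Se) => k [/= xk /negP]; rewrite -ltNge => ku.
by rewrite ltr_norml; apply/andP; split; lra.
Qed.

(** One ultrafilter containing the tails serves all coordinates at once, which replaces successive
    extraction of subsequences. *)
Lemma bolzano_weierstrass (I : finType) (u : nat -> I -> R) (M : R) :
  (forall k i, `|u k i| <= M) -> exists l : I -> R, forall e N, 0 < e ->
    exists2 k, (N <= k)%N & forall i, `|u k i - l i| < e.
Proof.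
move=> hM; have [U [UU FU]] := ultraFilterLemma (F := \oo) _.
have /choice[l hl] : forall i, exists l, forall e, 0 < e -> U [set k | `|u k i - l| < e].
  by move=> i; exact: ultra_limit (fun k => hM k i).
exists l => e N e0.
have h : U [set k | forall i, `|u k i - l i| < e].
  by apply: filter_forall => i; exact: hl.
have hN : U [set k | (N <= k)%N] by apply: FU; exact: nbhs_infty_ge.
by have [k [kh kN]] := filter_ex (filterI h hN); exists k.
Qed.

End Compactness.

Section Limits.
Variable R : realType.
Local Notation C := R[i].

Lemma mx_bolzano_weierstrass d1 d2 (A : nat -> 'M[C]_(d1, d2)) (B : nat -> 'M[C]_(d2, d1)) (M : R) :
  (forall k i j, rn (A k i j) <= M) -> (forall k i j, rn (B k i j) <= M) ->
  exists A' B', forall e N, 0 < e -> exists2 k, (N <= k)%N &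
    (forall i j, rn ((A' - A k) i j) <= e) /\ (forall i j, rn ((B' - B k) i j) <= e).
Proof.
have part_le (z : C) (b : bool) : `|if b then complex.Re z else complex.Im z| <= rn z.
  rewrite -(ler_pXn2r (n := 2)) ?nnegrE ?rn_ge0 // rn_sqr real_normK ?num_real //.
  by case: b; rewrite ?lerDl ?lerDr sqr_ge0.
have rn_part (z : C) : rn z <= `|complex.Re z| + `|complex.Im z|.
  rewrite -(ler_pXn2r (n := 2)) ?nnegrE ?rn_ge0 ?addr_ge0 // rn_sqr sqrrD.
  by rewrite !real_normK ?num_real // addrAC lerDl mulrn_wge0 // mulr_ge0.
move=> hA hB.
pose z k (i : ('I_d1 * 'I_d2) + ('I_d2 * 'I_d1)) : C :=
  match i with inl p => A k p.1 p.2 | inr p => B k p.1 p.2 end.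
pose u k (i : (('I_d1 * 'I_d2) + ('I_d2 * 'I_d1)) * bool) : R :=
  if i.2 then complex.Re (z k i.1) else complex.Im (z k i.1).
have [|l hl] := @bolzano_weierstrass R _ u M.
  by move=> k [i b]; apply: le_trans (part_le _ b) _; case: i => p; [exact: hA|exact: hB].
pose L i : C := (l (i, true) +i* l (i, false))%C.
exists (\matrix_(i, j) L (inl (i, j))), (\matrix_(i, j) L (inr (i, j))) => e N e0.
have [k kN hk] := hl (e / 2) N (divr_gt0 e0 (ltr0n _ 2)).
have close i : rn (L i - z k i) <= e.
  apply: (le_trans (rn_part _)); have := hk (i, true); have := hk (i, false).
  rewrite /u /L /=; case: (z k i) => a b /=; rewrite distrC => h1; rewrite distrC => h2.
  by rewrite [e]splitr; apply: lerD; exact: ltW.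
exists k => //; split=> i j.
  by have := close (inl (i, j)); rewrite !mxE.
by have := close (inr (i, j)); rewrite !mxE.
Qed.

Lemma limit_inverse d d' (A : 'M[C]_(d, d')) (B : 'M[C]_(d', d)) (M : R) : 0 <= M ->
  (forall e, 0 < e -> exists A' B', [/\ A' *m B' = 1%:M, forall i j, rn (A' i j) <= M,
     forall i j, rn ((A - A') i j) <= e & forall i j, rn ((B - B') i j) <= e]) ->
  A *m B = 1%:M.
Proof.
move=> M0 h; pose S := \sum_i \sum_j rn (B i j).
have S0 : 0 <= S by do 2!(apply: sumr_ge0 => ? _); exact: rn_ge0.
have BS l j : rn (B l j) <= S.
  rewrite /S (bigD1 l) //= (bigD1 j) //= -addrA lerDl addr_ge0 //.
    by apply: sumr_ge0 => *; exact: rn_ge0.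
  by do 2!(apply: sumr_ge0 => ? _); exact: rn_ge0.
apply/matrixP => i j; apply/eqP; rewrite -subr_eq0; apply/eqP/rn_eq0.
apply/eqP; rewrite eq_le rn_ge0 andbT; apply/ler_addgt0Pl => e e0; rewrite addr0.
pose k := d'%:R * (S + M) + 1; have k0 : 0 < k by rewrite ltr_wpDl // mulr_ge0 // addr_ge0.
have [A' [B' [AB hA hAA hBB]]] := h _ (divr_gt0 e0 k0).
rewrite -AB (_ : _ - _ = ((A - A') *m B + A' *m (B - B')) i j); last first.
  by rewrite mulmxBl mulmxBr addrA subrK !mxE.
rewrite mxE; apply: (le_trans (rnD _ _)).
apply: (@le_trans _ _ (d'%:R * (e / k * S) + d'%:R * (M * (e / k)))).
  have sum_const (x : R) : d'%:R * x = \sum_(l < d') x by rewrite sumr_const card_ord mulr_natl.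
  rewrite !sum_const; apply: lerD; rewrite mxE; apply: (le_trans (rn_sum _ _ _));
    by apply: ler_sum => l _; rewrite rnM ler_pM ?rn_ge0.
rewrite (_ : _ + _ = e * ((d'%:R * (S + M)) / k)); last by ring.
by rewrite ler_piMr ?(ltW e0) // ler_pdivrMr // mul1r lerDl.
Qed.

Lemma mxtup_perturb (H K : hilbertType R) d1 d2 (Q : 'I_d1 -> {linear H -> K}) n (Y : mtuple R d2 n) :
  bounded_ops Q -> exists2 M : R, 0 <= M & forall (D : 'M[C]_(d1, d2)) e, 0 <= e ->
    (forall i j, rn (D i j) <= e) -> ampl_le Q (mxtup D Y) (M * e).
Proof.
move=> Qb; have [M M0 hM] := ampl_le_entries Qb.
pose S := \sum_j \sum_k \sum_l rn (Y j k l).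
have S0 : 0 <= S by do 3!(apply: sumr_ge0 => ? _); exact: rn_ge0.
exists (M * (n.+1 * n.+1)%:R * S) => [|D e e0 hD]; first by rewrite !mulr_ge0 // ltW.
rewrite -mulrA; apply: hM => [|i k l]; first by rewrite mulr_ge0.
rewrite ffunE summxE; apply: (le_trans (rn_sum _ _ _)); rewrite /S mulr_suml.
apply: ler_sum => j _; rewrite mxE rnM mulrC ler_pM ?rn_ge0 //.
rewrite (bigD1 k) //= (bigD1 l) //= -addrA lerDl addr_ge0 //.
  by apply: sumr_ge0 => *; exact: rn_ge0.
by do 2!(apply: sumr_ge0 => ? _); exact: rn_ge0.
Qed.

(** A limit of contractions yields only the closed ball. Strictness is regained by applying the
    approximants to [t] times [Y] with [t > 1] and dividing by [t]. *)
Lemma limit_maps_ball (H1 K1 H2 K2 : hilbertType R) d1 d2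
    (Q1 : 'I_d1 -> {linear H1 -> K1}) (Q2 : 'I_d2 -> {linear H2 -> K2}) (A : 'M[C]_(d1, d2)) :
  bounded_ops Q1 ->
  (forall n (Y : mtuple R d2 n), ncball Q2 Y -> exists2 t : R, 1 < t & forall e, 0 < e ->
     exists2 A' : 'M[C]_(d1, d2), (forall i j, rn ((A - A') i j) <= e) &
       ampl_le Q1 (mxtup A' (t%:C *: Y)) 1) ->
  maps_ball Q1 Q2 A.
Proof.
move=> Qb h n Y /h[t t1 ht]; have t0 : 0 < t by lra.
have [M M0 hM] := mxtup_perturb (t%:C *: Y) Qb.
(* The perturbation is then at most [(t - 1) / 2], so the norm stays below [t] before the
   division. *)
have e0 : 0 < (t - 1) / 2 / (M + 1) by rewrite !divr_gt0 ?subr_gt0 // ltr_wpDl.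
have [A' AA' hA'] := ht _ e0; set e := _ / (M + 1) in e0 AA'.
have := ampl_leD hA' (hM _ _ (ltW e0) AA').
rewrite (_ : [ffun j => _] = mxtup A (t%:C *: Y)); last first.
  apply/ffunP => i; rewrite !ffunE -big_split /=; apply: eq_bigr => j _.
  by rewrite -scalerDl !mxE subrKC.
move=> /(ampl_le_scale (t^-1)%:C); rewrite -mxtupZ scalerA -rmorphM mulVf ?gt_eqF // scale1r.
rewrite rn_real ger0_norm ?invr_ge0 ?(ltW t0) // => hA.
have Me : M * e <= (t - 1) / 2.
  by rewrite /e mulrA ler_pdivrMr ?ltr_wpDl //; nra.
have Me0 : 0 <= M * e by rewrite mulr_ge0 // ltW.
apply/ncballP; exists (t^-1 * (1 + M * e)); split=> //.
  by rewrite mulr_ge0 ?invr_ge0 ?(ltW t0) ?addr_ge0.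
by rewrite mulrC ltr_pdivrMr // mul1r; lra.
Qed.

End Limits.

(** * From isomorphic algebras to linearly isomorphic balls *)

Section Main.
Variables (R : realType) (H1 K1 H2 K2 : hilbertType R) (d1 d2 : nat).
Local Notation C := R[i].
Variables (Q1 : 'I_d1 -> {linear H1 -> K1}) (Q2 : 'I_d2 -> {linear H2 -> K2}).
Hypotheses (Q1_indep : lin_indep Q1) (Q2_indep : lin_indep Q2).
Hypotheses (Q1_bounded : bounded_ops Q1) (Q2_bounded : bounded_ops Q2).

Lemma mxtup_pt_unit d d' (A : 'M[C]_(d, d')) u i j :
  mxtup A (pt (fun k => u * (k == i)%:R)) j 0 0 = A j i * u.
Proof.
rewrite ffunE summxE (bigD1 i) //= big1 ?addr0 => [|k /negbTE ki].
  by rewrite !mxE ffunE !mxE !eqxx !mulr1.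
by rewrite !mxE ffunE !mxE ki mulr0 mul0r mulr0.
Qed.

Lemma contractive_entries (H K : hilbertType R) d d' (Q : 'I_d -> {linear H -> K}) (t : R) :
  lin_indep Q -> 0 < t -> exists2 M : R, 0 <= M & forall A : 'M[C]_(d, d'),
    (forall i, ampl_le Q (mxtup A (pt (fun k => t%:C * (k == i)%:R))) 1) ->
    forall j i, rn (A j i) <= M.
Proof.
move=> Qi t0; have [M M0 hM] := coord_bound Qi.
exists (M / t) => [|A hA j i]; first by rewrite divr_ge0 // ltW.
have := hM _ _ _ ler01 (hA i) j => /(mx_le_entry 0 0).
by rewrite mxtup_pt_unit rnM rn_real gtr0_norm // mulr1 ler_pdivlMr.
Qed.

Lemma iso_pair_linear Phi Psi : iso_pair (Q1 := Q1) (Q2 := Q2) Phi Psi ->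
  exists (A : 'M[C]_(d1, d2)) (B : 'M[C]_(d2, d1)),
    [/\ A *m B = 1%:M, B *m A = 1%:M, maps_ball Q1 Q2 A & maps_ball Q2 Q1 B].
Proof.
(* Starting at 1/2 lets the test vectors scaled for radius 1/2 serve every [k], which bounds all
   entries uniformly. *)
move=> iso; pose r k : R := (k.+2%:R)^-1.
have r0 k : 0 < r k by rewrite invr_gt0.
have r12 k : r k <= 1 / 2.
  by rewrite div1r lef_pV2 ?posrE ?ltr0n // ler_nat.
have r01 k : 0 <= r k < 1.
  by rewrite (ltW (r0 k)) /=; apply: le_lt_trans (r12 k) _; lra.
pose P k (AB : 'M[C]_(d1, d2) * 'M[C]_(d2, d1)) :=
  [/\ AB.1 *m AB.2 = 1%:M, AB.2 *m AB.1 = 1%:M,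
    (forall n (Y : mtuple R d2 n), ncball Q2 Y -> ampl_le Q1 (mxtup AB.1 Y) 1) &
    (forall n (X : mtuple R d1 n) c, 0 <= c -> r k + c < 1 -> ampl_le Q1 X c ->
       ampl_le Q2 (mxtup AB.2 X) 1)].
have /choice[AB hAB] : forall k, exists AB, P k AB.
  move=> k.
  have [Phi' [Psi' [iso' hr]]] :=
    base_norm_le_small Q1_indep Q2_indep Q1_bounded Q2_bounded iso (r0 k).
  have [A [B h]] := derivative_pair Q1_indep Q2_indep Q1_bounded Q2_bounded iso' (r01 k) hr.
  by exists (A, B).
have half01 : 0 <= (1 / 2 : R) < 1 by apply/andP; split; lra.
have h12 : 0 <= (1 / 2 : R) by lra.
have [t1 t10 ht1] := small_unit_jet Q1_bounded half01 (pencil_le0 Q1 h12).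
have [t2 t20 ht2] := small_unit_jet Q2_bounded half01 (pencil_le0 Q2 h12).
have [MA MA0 hMA] := contractive_entries d2 Q1_indep t20.
have [MB MB0 hMB] := contractive_entries d1 Q2_indep t10.
pose M := MA + MB; have M0 : 0 <= M by exact: addr_ge0.
have bA k i j : rn ((AB k).1 i j) <= M.
  apply: le_trans (_ : MA <= M); last by rewrite lerDl.
  have [_ _ cA _] := hAB k; apply: hMA => l; apply: cA.
  have [c [c0 rc hE]] := ht2 l; apply/ncballP; exists c; split=> //; lra.
have bB k i j : rn ((AB k).2 i j) <= M.
  apply: le_trans (_ : MB <= M); last by rewrite lerDr.
  have [_ _ _ cB] := hAB k; apply: hMB => l.
  have [c [c0 rc hE]] := ht1 l; apply: cB hE => //.
  by apply: le_lt_trans rc; rewrite lerD2r.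
have [A [B hlim]] := mx_bolzano_weierstrass bA bB.
exists A, B; split.
- apply: (limit_inverse M0) => e e0; have [k _ [hA hB]] := hlim e 0%N e0.
  by exists (AB k).1, (AB k).2; split=> //; case: (hAB k).
- apply: (limit_inverse M0) => e e0; have [k _ [hA hB]] := hlim e 0%N e0.
  by exists (AB k).2, (AB k).1; split=> //; case: (hAB k).
- apply: limit_maps_ball => // n Y /ncball_expand[t t1' hY].
  exists t => // e e0; have [k _ [hA _]] := hlim e 0%N e0.
  exists (AB k).1 => //; have [_ _ cA _] := hAB k; apply: cA.
  by move: hY; congr (ncball _ _); apply/ffunP => j; rewrite !ffunE.
- apply: limit_maps_ball => // n X /ncball_expand[t t1' hX].
  have {}hX : ncball Q1 (t%:C *: X).
    by move: hX; congr (ncball _ _); apply/ffunP => j; rewrite !ffunE.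
  exists t => // e e0; have /ncballP[c [c0 c1 hc]] := hX.
  have d0 : 0 < 1 - c by rewrite subr_gt0.
  (* Beyond this index [r k < 1 - c], as the contraction property of the second matrix requires. *)
  have [k kN [_ hB]] := hlim e (Num.bound (1 - c)^-1) e0.
  exists (AB k).2 => //; have [_ _ _ cB] := hAB k; apply: cB hc => //.
  rewrite -ltrBrDr /r invf_plt ?posrE ?ltr0n //.
  apply: lt_le_trans (archi_boundP _) _; first by rewrite invr_ge0 ltW.
  by rewrite ler_nat; exact: leq_trans kN (leq_trans (leqnSn _) (leqnSn _)).
Qed.

End Main.

Theorem theorem6p26 (R : realType) (H1 K1 H2 K2 : hilbertType R)
    (d1 d2 : nat)
    (Q1 : 'I_d1 -> {linear H1 -> K1}) (Q2 : 'I_d2 -> {linear H2 -> K2})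
    (Q1_bounded : bounded_ops Q1) (Q1_indep : lin_indep Q1)
    (Q2_bounded : bounded_ops Q2) (Q2_indep : lin_indep Q2) :
  alg_completely_isometric_iso (ncball Q1) (ncball Q2) <->
  linearly_isomorphic (ncball Q1) (ncball Q2).
Proof.
rewrite (alg_isoP Q1_indep Q2_indep) (linearly_isomorphicP Q1_bounded Q2_bounded).
split=> [[Phi [Psi iso]]|[A [B [AB BA hA hB]]]].
  have [A [B [AB BA hA hB]]] := iso_pair_linear Q1_indep Q2_indep Q1_bounded Q2_bounded iso.
  by exists B, A.
exists (pullback hB), (pullback hA).
exact: pullback_iso_pair.
Qed.
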